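(* Let $W=G(2,2,n)$ and let $K$ be a proper field for $W$. A non-empty transverse collection $B$ is $K$-admissible if and only if whenever $H_{ij},H_{ij}^1,H_{i'j'}^\kappa\in B$, we have $H_{i'j'}^{\kappa+1}\in B$ as well. In that case, $\mathrm{Ann}_{K\mathrm{Stab}(B)}(B)=\mathrm{Aug}(K_B)$. Finally, the dimension of $\mathrm{Br}^K(W)$ over $K$ is $$n!\,2^{n-1}+(2^n+1)\sum_{r=1}^{2r\le n}\left(\frac{n!}{r!\,2^r(n-2r)!}\right)^2(n-2r)!.$$
   Context: All modules are finite dimensional over $K$. The group $G(2,2,n)\subseteq GL(\mathbb C^n)$ is the group of monomial matrices with non-zero entries in $\{1,-1\}$ whose product of non-zero entries is $1$. With coordinates $z_1,\dots,z_n$, its reflecting hyperplanes are $H_{ij}^\kappa:\ z_i=(-1)^\kappa z_j$ ($i\ne j$), $\kappa\in\mathbb Z$ (depending only on $\kappa$ mod $2$), and $H_{ij}=H_{ij}^0$. Complex reflection groups. A reflection of $V_W$ is an $r\in GL(V_W)$ such that $H_r:=\ker(r-1)$ has codimension $1$; $H_r$ is its reflecting hyperplane. $\mathcal R$ is the set of reflections in $W\subseteq GL(V_W)$ and $\mathcal H$ the set of their reflecting hyperplanes. $W$ acts on $\mathcal H$ by $wH=w(H)$ and on $\mathcal R$ by conjugation; $\sim$ denotes conjugacy. $\mathcal R_{a\to b}$ is the set of $s\in\mathcal R$ with $sa=b$. Distinct $H_1,H_2\in\mathcal H$ are transverse, $H_1\pitchfork H_2$, if they are the only elements of $\mathcal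 H$ containing $H_1\cap H_2$; $H_1\not\pitchfork H_2$ means distinct and not transverse. A transverse collection is a (possibly empty) set of pairwise transverse elements of $\mathcal H$; $\mathcal C$ is the set of all of them, with the induced $W$-action. $\mathrm{Stab}(B)=\{w\in W: wB=B\}$. Brauer-Chen algebra. Let $\delta,\mu_s$ ($s\in\mathcal R$) be indeterminates, $\underline\mu=\{\mu_s\}$, and $\mathcal A=\mathbb Z[\underline\mu^{\pm1},\delta^{\pm1}]/(\mu_s-\mu_{s'}\mid s\sim s')$. $\mathrm{Br}(W)$ is the $\mathcal A$-algebra generated by the elements of $W$ (with the group relations) and elements $e_H$, $H\in\mathcal H$, with relations: (B1) $e_H^2=\delta e_H$; (B2) $we_Hw^{-1}=e_{wH}$; (B3) $we_H=e_H$ if $H\subseteq\ker(w-1)$; (B4) $e_{H_1}e_{H_2}=e_{H_2}e_{H_1}$ if $H_1\pitchfork H_2$; (B5) $e_{H_1}e_{H_2}=\sum_{s\in\mathcal R_{H_2\to H_1}}\mu_s s\,e_{H_2}$ if $H_1\not\pitchfork H_2$. For an $\mathcal A$-algebra $R$, $\mathrm{Br}^R(W)=R\otimes_{\mathcal A}\mathrm{Br}(W)$. For $B\in\mathcal C$, $e_B=\prod_{H\in B}e_H$ ($e_\emptyset=1$). Proper rings. A (commutative) $\mathcal A$-algebra $R$ is proper for $W$ if $R$ is a domain of characteristic $0$; $\mathrm{Frac}(R)$ has a subfield $k_R$ containing the images of $\underline\mu$ over which every subgroup of $W$ splits; $\delta$ is transcendental over $k_R$ and $\mathrm{Frac}(R)$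 is a finite extension of $k_R(\delta)$. A proper field is a proper $R$ that is a field. Annihilators and admissibility. For $B\in\mathcal C$ let $\mathrm{Ann}_{KW}(e_B)=\{x\in KW: xe_B=0\text{ in }\mathrm{Br}^K(W)\}$. For $w\in W$ let $\pi_w:KW\to wK\mathrm{Stab}(B)$, $\pi_w(\sum_h\lambda_hh)=\sum_{h\in w\mathrm{Stab}(B)}\lambda_hh$. Then $\mathrm{Ann}_{K\mathrm{Stab}(B)}(B):=\sum_{w\in W}w^{-1}\pi_w(\mathrm{Ann}_{KW}(e_B))$. For a $K\mathrm{Stab}(B)$-module $V$, the pair $(B,V)$ is admissible if $\mathrm{Ann}_{KW}(e_B)\cdot\hat V=0$, where $\hat V$ is the image of $V$ in $\mathrm{Ind}_{K\mathrm{Stab}(B)}^{KW}V$. $B$ is $K$-admissible if $(B,V)$ is admissible for some $V\neq0$. The group $K_B$. Let $\mathcal R_B=\{r\in\mathcal R: H_r\in B\}$. $K_B$ is the subgroup of $\mathrm{Stab}(B)$ generated by $\mathcal R_B$ and all products $s_2^{-1}s_1$ with $s_1,s_2\in\mathcal R$ such that $s_1B=s_2B\ne B$ and $s_1H\neq s_2H$ for all $H\in B\setminus s_1B$. $\mathrm{Aug}(K_B)$ is the two-sided ideal of $K\mathrm{Stab}(B)$ generated by all $h-1$, $h\in K_B$. *)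

(* Defs.v *)
From HB Require Import structures.
From mathcomp Require Import all_boot all_order all_algebra all_fingroup.
From mathcomp Require Import all_solvable all_field all_character.
From mathcomp Require Import generic_quotient.
From mathcomp Require Import boolp reals complex.

Set Implicit Arguments.
Unset Strict Implicit.
Unset Printing Implicit Defensive.

Import GroupScope GRing.Theory.
Local Open Scope ring_scope.

Inductive pterm (R X : Type) : Type :=
  | PCst of R
  | PGen of X
  | PAdd of pterm R X & pterm R X
  | PMul of pterm R X & pterm R X.
Arguments PCst {R X}.
Arguments PGen {R X}.

Declare Scope pterm_scope.
Delimit Scope pterm_scope with PT.
Bind Scope pterm_scope with pterm.
Notation "s + t" := (PAdd s t) : pterm_scope.
Notation "s * t" := (PMul s t) : pterm_scope.

HB.instance Definition _ (R X : Type) := gen_eqMixin (pterm R X).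
HB.instance Definition _ (R X : Type) := gen_choiceMixin (pterm R X).

(* The least congruence containing rel that makes the quotient an associative
   unital R-algebra. *)
Inductive pcongr (R : comNzRingType) (X : Type)
    (rel : pterm R X -> pterm R X -> Prop) : pterm R X -> pterm R X -> Prop :=
  | pc_rel s t : rel s t -> pcongr rel s t
  | pc_refl t : pcongr rel t t
  | pc_sym s t : pcongr rel s t -> pcongr rel t s
  | pc_trans s t u : pcongr rel s t -> pcongr rel t u -> pcongr rel s u
  | pc_add s s' t t' :
      pcongr rel s s' -> pcongr rel t t' -> pcongr rel (s + t)%PT (s' + t')%PT
  | pc_mul s s' t t' :
      pcongr rel s s' -> pcongr rel t t' -> pcongr rel (s * t)%PT (s' * t')%PT
  | pc_addA s t u : pcongr rel (s + (t + u))%PT ((s + t) + u)%PT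
  | pc_addC s t : pcongr rel (s + t)%PT (t + s)%PT
  | pc_add0 t : pcongr rel (PCst 0 + t)%PT t
  | pc_addN t : pcongr rel (PCst (- 1) * t + t)%PT (PCst 0)
  | pc_mulA s t u : pcongr rel (s * (t * u))%PT ((s * t) * u)%PT
  | pc_mul1 t : pcongr rel (PCst 1 * t)%PT t
  | pc_mulDl s t u : pcongr rel ((s + t) * u)%PT (s * u + t * u)%PT
  | pc_mulDr s t u : pcongr rel (s * (t + u))%PT (s * t + s * u)%PT
  | pc_cstD a b : pcongr rel (PCst a + PCst b)%PT (PCst (a + b))
  | pc_cstM a b : pcongr rel (PCst a * PCst b)%PT (PCst (a * b))
  | pc_cstC a t : pcongr rel (PCst a * t)%PT (t * PCst a)%PT.

Section PresentedAlgebra.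
Variables (R : comNzRingType) (X : Type).
Variable rel : pterm R X -> pterm R X -> Prop.
Local Notation term := (pterm R X).

Definition pcongrb (s t : term) : bool := `[< pcongr rel s t >].

Lemma pcongrb_refl : reflexive pcongrb.
Proof. by move=> t; apply/asboolP/pc_refl. Qed.

Lemma pcongrb_sym : symmetric pcongrb.
Proof. by move=> s t; apply/asboolP/asboolP; apply: pc_sym. Qed.

Lemma pcongrb_trans : transitive pcongrb.
Proof.
by move=> t s u /asboolP st /asboolP tu; apply/asboolP/(pc_trans st tu).
Qed.

Canonical pcongr_equiv := EquivRel pcongrb pcongrb_refl pcongrb_sym pcongrb_trans.

Definition presalg : Type := {eq_quot pcongr_equiv}%qT.
HB.instance Definition _ := Choice.on presalg.

Definition pclass (t : term) : presalg := \pi_({eq_quot pcongr_equiv})%qT t.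

Lemma pclassP (s t : term) : pclass s = pclass t <-> pcongr rel s t.
Proof.
split; first by move=> /eqquotP/asboolP.
by move=> st; apply/eqquotP/asboolP.
Qed.

Definition prepr (x : presalg) : term := repr (x : {eq_quot pcongr_equiv}%qT).

Lemma preprK : cancel prepr pclass.
Proof. exact: reprK. Qed.

Lemma pclass_ind (P : presalg -> Prop) : (forall t, P (pclass t)) -> forall x, P x.
Proof. by move=> Pt x; rewrite -[x]preprK. Qed.

Lemma prepr_pclass t : pcongr rel (prepr (pclass t)) t.
Proof. by apply/pclassP; rewrite preprK. Qed.

Definition pcst (a : R) : presalg := pclass (PCst a).
Definition pgen (x : X) : presalg := pclass (PGen x).

Definition pa_add (x y : presalg) := pclass (prepr x + prepr y)%PT.
Definition pa_mul (x y : presalg) := pclass (prepr x * prepr y)%PT.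
Definition pa_opp (x : presalg) := pa_mul (pcst (- 1)) x.
Definition pa_scale (a : R) (x : presalg) := pa_mul (pcst a) x.

Lemma pa_addE s t : pa_add (pclass s) (pclass t) = pclass (s + t)%PT.
Proof. by apply/pclassP; apply: pc_add; apply: prepr_pclass. Qed.

Lemma pa_mulE s t : pa_mul (pclass s) (pclass t) = pclass (s * t)%PT.
Proof. by apply/pclassP; apply: pc_mul; apply: prepr_pclass. Qed.

Lemma pa_addA : associative pa_add.
Proof.
elim/pclass_ind=> s; elim/pclass_ind=> t; elim/pclass_ind=> u.
by rewrite !pa_addE; apply/pclassP/pc_addA.
Qed.

Lemma pa_addC : commutative pa_add.
Proof.
elim/pclass_ind=> s; elim/pclass_ind=> t.
by rewrite !pa_addE; apply/pclassP/pc_addC.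
Qed.

Lemma pa_add0 : left_id (pcst 0) pa_add.
Proof. by elim/pclass_ind=> s; rewrite pa_addE; apply/pclassP/pc_add0. Qed.

Lemma pa_addN : left_inverse (pcst 0) pa_opp pa_add.
Proof.
elim/pclass_ind=> s; rewrite /pa_opp pa_mulE pa_addE.
exact/pclassP/pc_addN.
Qed.

Lemma pa_mulA : associative pa_mul.
Proof.
elim/pclass_ind=> s; elim/pclass_ind=> t; elim/pclass_ind=> u.
by rewrite !pa_mulE; apply/pclassP/pc_mulA.
Qed.

Lemma pa_mul1 : left_id (pcst 1) pa_mul.
Proof. by elim/pclass_ind=> s; rewrite pa_mulE; apply/pclassP/pc_mul1. Qed.

Lemma pa_cstC a x : pa_mul (pcst a) x = pa_mul x (pcst a).
Proof. by elim/pclass_ind: x => s; rewrite !pa_mulE; apply/pclassP/pc_cstC. Qed.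

Lemma pa_mulr1 : right_id (pcst 1) pa_mul.
Proof. by move=> x; rewrite -pa_cstC pa_mul1. Qed.

Lemma pa_mulDl : left_distributive pa_mul pa_add.
Proof.
elim/pclass_ind=> s; elim/pclass_ind=> t; elim/pclass_ind=> u.
by rewrite !(pa_mulE, pa_addE); apply/pclassP/pc_mulDl.
Qed.

Lemma pa_mulDr : right_distributive pa_mul pa_add.
Proof.
elim/pclass_ind=> s; elim/pclass_ind=> t; elim/pclass_ind=> u.
by rewrite !(pa_mulE, pa_addE); apply/pclassP/pc_mulDr.
Qed.

HB.instance Definition _ := GRing.isPzRing.Build presalg
  pa_addA pa_addC pa_add0 pa_addN pa_mulA pa_mul1 pa_mulr1 pa_mulDl pa_mulDr.

Lemma pclassD s t : pclass (s + t)%PT = pclass s + pclass t.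
Proof. by rewrite -pa_addE. Qed.

Lemma pclassM s t : pclass (s * t)%PT = pclass s * pclass t.
Proof. by rewrite -pa_mulE. Qed.

Lemma pa_scaleA a b x : pa_scale a (pa_scale b x) = pa_scale (a * b) x.
Proof.
rewrite /pa_scale pa_mulA; congr pa_mul; rewrite pa_mulE.
exact/pclassP/pc_cstM.
Qed.

Lemma pa_scale1 : left_id 1 pa_scale.
Proof. exact: pa_mul1. Qed.

Lemma pa_scaleDr : right_distributive pa_scale +%R.
Proof. by move=> a x y; apply: pa_mulDr. Qed.

Lemma pa_scaleDl x : {morph pa_scale^~ x : a b / a + b}.
Proof.
move=> a b; rewrite /pa_scale -[RHS]pa_mulDl; congr pa_mul; rewrite pa_addE.
by apply/pclassP/pc_sym/pc_cstD.
Qed.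

HB.instance Definition _ := GRing.Zmodule_isLmodule.Build R presalg
  pa_scaleA pa_scale1 pa_scaleDr pa_scaleDl.

Lemma pa_scaleAl (a : R) (x y : presalg) : a *: (x * y) = (a *: x) * y.
Proof. exact: pa_mulA. Qed.

Lemma pa_scaleAr (a : R) (x y : presalg) : a *: (x * y) = x * (a *: y).
Proof.
rewrite -[LHS]/(pcst a * (x * y)) -[RHS]/(x * (pcst a * y)).
by rewrite !mulrA; congr (_ * y); apply: pa_cstC.
Qed.

Lemma pcstE a : pcst a = a *: (1 : presalg).
Proof. by rewrite -[RHS]/(pcst a * 1) mulr1. Qed.

Section Lift.
Variables (A : algType R) (g : X -> A).

Fixpoint peval (t : term) : A :=
  match t with
  | PCst a => a *: 1
  | PGen x => g x
  | PAdd s t => peval s + peval t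
  | PMul s t => peval s * peval t
  end.

Hypothesis g_rel : forall s t, rel s t -> peval s = peval t.

Lemma peval_congr s t : pcongr rel s t -> peval s = peval t.
Proof.
elim=> //=.
- by move=> {}s t' u _ -> _ ->.
- by move=> {}s s' {}t t' _ -> _ ->.
- by move=> {}s s' {}t t' _ -> _ ->.
- by move=> *; rewrite addrA.
- by move=> *; rewrite addrC.
- by move=> *; rewrite scale0r add0r.
- by move=> *; rewrite -scalerAl mul1r scaleN1r addNr scale0r.
- by move=> *; rewrite mulrA.
- by move=> *; rewrite scale1r mul1r.
- by move=> *; rewrite mulrDl.
- by move=> *; rewrite mulrDr.
- by move=> *; rewrite scalerDl.
- by move=> *; rewrite -scalerAl mul1r scalerA.
- by move=> *; rewrite -scalerAl mul1r -scalerAr mulr1.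
Qed.

Definition plift (x : presalg) : A := peval (prepr x).

Lemma plift_class t : plift (pclass t) = peval t.
Proof. exact/peval_congr/prepr_pclass. Qed.

Lemma plift_gen x : plift (pgen x) = g x.
Proof. by rewrite plift_class. Qed.

Lemma plift_cst a : plift (a *: (1 : presalg)) = a *: 1.
Proof. by rewrite -pcstE plift_class. Qed.

Lemma pliftD : {morph plift : x y / x + y}.
Proof.
elim/pclass_ind=> s; elim/pclass_ind=> t.
by rewrite -pclassD !plift_class.
Qed.

Lemma pliftM : {morph plift : x y / x * y}.
Proof.
elim/pclass_ind=> s; elim/pclass_ind=> t.
by rewrite -pclassM !plift_class.
Qed.

End Lift.
End PresentedAlgebra.

Definition galg (K : comNzRingType) (gT : finGroupType) : Type :=
  {ffun gT -> K^o}.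
HB.instance Definition _ (K : comNzRingType) (gT : finGroupType) :=
  Vector.on (galg K gT).

Section GroupAlgebra.
Variables (K : comNzRingType) (gT : finGroupType).
Implicit Types (x y z : galg K gT) (g h : gT).

Definition gelt g : galg K gT := [ffun h => (h == g)%:R].

Definition galg_mul x y : galg K gT := [ffun g => \sum_h x h * y (h^-1 * g)%g].

Lemma galg_mulA : associative galg_mul.
Proof.
move=> x y z; apply/ffunP=> g; rewrite !ffunE.
under eq_bigr do rewrite ffunE big_distrr /=.
under [RHS]eq_bigr do rewrite ffunE big_distrl /=.
rewrite [RHS]exchange_big /=; apply: eq_bigr => h _.
rewrite [RHS](reindex_inj (mulgI h)) /=; apply: eq_bigr => k _.
by rewrite mulKg invMg !mulgA mulrA.
Qed.

Lemma galg_mul1 : left_id (gelt 1%g) galg_mul.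
Proof.
move=> x; apply/ffunP=> g; rewrite !ffunE (bigD1 1%g) //= big1 => [|h /negPf h1].
  by rewrite ffunE eqxx mul1r addr0 invg1 mul1g.
by rewrite ffunE h1 mul0r.
Qed.

Lemma galg_mulr1 : right_id (gelt 1%g) galg_mul.
Proof.
move=> x; apply/ffunP=> g; rewrite !ffunE (bigD1 g) //= big1 => [|h /negPf h1].
  by rewrite ffunE mulVg eqxx mulr1 addr0.
by rewrite ffunE -eq_mulVg1 h1 mulr0.
Qed.

Lemma galg_mulDl : left_distributive galg_mul +%R.
Proof.
move=> x y z; apply/ffunP=> g; rewrite !ffunE -big_split /=.
by apply: eq_bigr => h _; rewrite ffunE mulrDl.
Qed.

Lemma galg_mulDr : right_distributive galg_mul +%R.
Proof.
move=> x y z; apply/ffunP=> g; rewrite !ffunE -big_split /=.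
by apply: eq_bigr => h _; rewrite ffunE mulrDr.
Qed.

Lemma galg_neq0 : gelt 1%g != 0.
Proof. by apply/eqP=> /ffunP/(_ 1%g)/eqP; rewrite !ffunE eqxx oner_eq0. Qed.

HB.instance Definition _ := GRing.Zmodule_isNzRing.Build (galg K gT)
  galg_mulA galg_mul1 galg_mulr1 galg_mulDl galg_mulDr galg_neq0.

Lemma galg_scaleAl (a : K) x y : a *: (x * y) = (a *: x) * y.
Proof.
apply/ffunP=> g; rewrite !ffunE -[LHS]/(a * _) big_distrr /=.
by apply: eq_bigr => h _; rewrite ffunE -[(a *: x h)]/(a * x h) mulrA.
Qed.
HB.instance Definition _ :=
  GRing.Lmodule_isLalgebra.Build K (galg K gT) galg_scaleAl.

Lemma galg_scaleAr (a : K) x y : a *: (x * y) = x * (a *: y).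
Proof.
apply/ffunP=> g; rewrite !ffunE -[LHS]/(a * _) big_distrr /=.
by apply: eq_bigr => h _; rewrite ffunE -[(a *: y _)]/(a * y _) mulrCA.
Qed.
HB.instance Definition _ :=
  GRing.Lalgebra_isAlgebra.Build K (galg K gT) galg_scaleAr.

(* The group algebra of S, as a subspace of that of gT. *)
Definition galg_on (S : {set gT}) x : Prop := forall g, x g != 0 -> g \in S.

End GroupAlgebra.

Definition lin_span (K : pzRingType) (V : lmodType K) (P : V -> Prop) (v : V) :
    Prop :=
  exists (m : nat) (c : 'I_m -> K) (u : 'I_m -> V),
    (forall i, P (u i)) /\ v = \sum_i c i *: u i.

Definition has_dim (K : pzRingType) (V : lmodType K) (d : nat) : Prop :=
  exists b : 'I_d -> V,
    forall v, exists! c : {ffun 'I_d -> K}, v = \sum_i c i *: b i.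

(* The reflection group is the image of rho, acting on the left on C^n by
   multiplication on column vectors. *)
Section ReflectionGroup.
Variables (C : fieldType) (n : nat) (W : finGroupType).
Variable rho : mx_representation C [set: W] n.
Implicit Types (w r s : W).

Definition actfun w : 'End('cV[C]_n) := linfun (mulmx (rho w)).

Definition fixsp w : {vspace 'cV[C]_n} := fixedSpace (actfun w).

Definition refls : {set W} := [set r | (\dim (fixsp r)).+1 == n].

Definition hyps : seq {vspace 'cV[C]_n} := [seq fixsp r | r in refls].

Definition hyper : finType := seq_sub hyps.
Implicit Types (H : hyper) (B : {set hyper}).

Definition hsp H : {vspace 'cV[C]_n} := ssval H.

Lemma hsp_inj : injective hsp. Proof. exact: val_inj. Qed.

Lemma actfunE w v : actfun w v = rho w *m v. Proof. by rewrite lfunE. Qed.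

Lemma actfun1 v : actfun 1%g v = v.
Proof. by rewrite actfunE repr_mx1 mul1mx. Qed.

Lemma actfunM w1 w2 v : actfun (w1 * w2)%g v = actfun w1 (actfun w2 v).
Proof. by rewrite !actfunE repr_mxM ?inE // mulmxA. Qed.

Lemma actfunK w v : actfun w^-1 (actfun w v) = v.
Proof. by rewrite -actfunM mulVg actfun1. Qed.

Lemma actfunVK w v : actfun w (actfun w^-1 v) = v.
Proof. by rewrite -actfunM mulgV actfun1. Qed.

Lemma actfun_inj w : lker (actfun w) = 0%VS.
Proof. by apply/eqP/lker0P; apply: can_inj (actfunK w). Qed.

Lemma fixsp_conj w r : fixsp (r ^ w^-1)%g = (actfun w @: fixsp r)%VS.
Proof.
apply/vspaceP=> v; apply/fixedSpaceP/memv_imgP => [|[u /fixedSpaceP ru ->]].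
  rewrite conjgE invgK !actfunM => fv; exists (actfun w^-1 v).
    by apply/fixedSpaceP; rewrite -[in RHS]fv actfunK.
  by rewrite actfunVK.
by rewrite conjgE invgK !actfunM actfunK ru.
Qed.

Lemma refls_conj w r : ((r ^ w)%g \in refls) = (r \in refls).
Proof.
rewrite !inE -{1}[w]invgK fixsp_conj limg_dim_eq //.
by rewrite actfun_inj capv0.
Qed.

Lemma hact_subproof w H : (actfun w @: hsp H)%VS \in hyps.
Proof.
case: H => U /= /imageP[r r_refl ->]; rewrite -fixsp_conj.
by apply/imageP; exists (r ^ w^-1)%g; rewrite ?refls_conj.
Qed.

Definition hact w H : hyper := SeqSub (hact_subproof w H).

Lemma hact1 H : hact 1%g H = H.
Proof.
apply: hsp_inj; rewrite /hsp /=; apply/vspaceP=> v.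
by apply/memv_imgP/idP => [[u uH ->]|vH]; [|exists v]; rewrite ?actfun1.
Qed.

Lemma hactM w1 w2 H : hact (w1 * w2)%g H = hact w1 (hact w2 H).
Proof.
apply: hsp_inj; rewrite /hsp /= -limg_comp; congr (_ @: _)%VS.
by apply/lfunP=> v; rewrite comp_lfunE actfunM.
Qed.

Definition cact w B : {set hyper} := hact w @: B.

Lemma cact1 B : cact 1%g B = B.
Proof. by rewrite /cact (eq_imset _ hact1) imset_id. Qed.

Lemma cactM w1 w2 B : cact (w1 * w2)%g B = cact w1 (cact w2 B).
Proof. by rewrite /cact -imset_comp; apply: eq_imset => H; apply: hactM. Qed.

Definition stab B : {set W} := [set w | cact w B == B].

Lemma stab_group_set B : group_set (stab B).
Proof.
apply/group_setP; split; first by rewrite inE cact1.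
move=> w1 w2; rewrite !inE => /eqP B1 /eqP B2.
by rewrite cactM B2 B1.
Qed.
Canonical stab_group B := Group (stab_group_set B).

Definition transverse H1 H2 : bool :=
  (H1 != H2) &&
  [forall H, (hsp H1 :&: hsp H2 <= hsp H)%VS ==> (H == H1) || (H == H2)].

Definition transverse_coll B : Prop :=
  {in B &, forall H1 H2, H1 != H2 -> transverse H1 H2}.

Definition refls_to (a b : hyper) : {set W} := [set s in refls | hact s a == b].

Definition KB_gens B : {set W} :=
  [set r in refls | [exists H in B, hsp H == fixsp r]] :|:
  [set (s2^-1 * s1)%g | s1 in refls, s2 in refls &
     [&& cact s1 B == cact s2 B, cact s1 B != B &
         [forall H in B :\: cact s1 B, hact s1 H != hact s2 H]]].

Definition KB B : {set W} := <<KB_gens B>>%g.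

(* The structure on R of an algebra over Z[mu^+-1, delta^+-1]/(mu_s - mu_s' |
   s ~ s'). Only the values of mu on refls matter. *)
Record brscalars (R : comUnitRingType) := BrScalars {
  mu : W -> R;
  delta : R;
  mu_unit : forall s, s \in refls -> mu s \is a GRing.unit;
  mu_conj : forall s w, s \in refls -> mu (s ^ w)%g = mu s;
  delta_unit : delta \is a GRing.unit
}.

Inductive brgen : Type := GenW of W | GenE of hyper.

Section BrauerChen.
Variables (R : comUnitRingType) (a : brscalars R).

Local Notation "''w' x" := (PGen (GenW x)) (at level 8, x at level 2).
Local Notation "''e' x" := (PGen (GenE x)) (at level 8, x at level 2).

Inductive brrel : pterm R brgen -> pterm R brgen -> Prop :=
  | br_one : brrel ('w 1%g) (PCst 1)
  | br_mul w1 w2 : brrel ('w (w1 * w2)%g) ('w w1 * 'w w2)%PT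
  | br_B1 H : brrel ('e H * 'e H)%PT (PCst (delta a) * 'e H)%PT
  | br_B2 w H : brrel ('w w * 'e H * 'w (w^-1)%g)%PT ('e (hact w H))
  | br_B3 w H : (hsp H <= fixsp w)%VS -> brrel ('w w * 'e H)%PT ('e H)
  | br_B4 H1 H2 : transverse H1 H2 -> brrel ('e H1 * 'e H2)%PT ('e H2 * 'e H1)%PT
  | br_B5 H1 H2 : H1 != H2 -> ~~ transverse H1 H2 ->
      brrel ('e H1 * 'e H2)%PT
        (\big[@PAdd R brgen/PCst 0]_(s in refls_to H2 H1)
            (PCst (mu a s) * ('w s * 'e H2))%PT).

(* The base change to R of an algebra presented over the ring of scalars has
   the same presentation over R. *)
Definition Br : Type := presalg brrel.
HB.instance Definition _ := GRing.PzRing.on Br.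
HB.instance Definition _ := GRing.Lmodule.on Br.

Definition br_triv (x : brgen) : R^o := if x is GenW _ then 1 else 0.

Lemma br_neq0 : (1 : Br) != 0.
Proof.
apply/eqP=> /pclassP/(@peval_congr _ _ _ R^o br_triv) => /= ev.
have /eqP : (1 : R) *: (1 : R^o) = 0 *: 1.
  apply: ev => s t; case=> /=; rewrite ?(mulr0, mul0r, mulr1, mul1r, scale1r) //.
  move=> H1 H2 _ _; elim/big_rec: _ => /= [|s' t' _ <-]; first by rewrite scale0r.
  by rewrite !mulr0 add0r.
by rewrite scale1r scale0r oner_eq0.
Qed.

HB.instance Definition _ := GRing.PzSemiRing_isNonZero.Build Br br_neq0.
HB.instance Definition _ :=
  GRing.Lmodule_isLalgebra.Build R Br (@pa_scaleAl _ _ brrel).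
HB.instance Definition _ :=
  GRing.Lalgebra_isAlgebra.Build R Br (@pa_scaleAr _ _ brrel).

Definition brw w : Br := pgen brrel (GenW w).
Definition bre H : Br := pgen brrel (GenE H).

(* For a transverse B the factors commute, so their order is immaterial. *)
Definition breB B : Br := \prod_(H in B) bre H.

Definition br_of_galg (x : galg R W) : Br := \sum_w x w *: brw w.

End BrauerChen.

Section Annihilators.
Variables (K : fieldType) (a : brscalars K) (B : {set hyper}).

Definition annKW (x : galg K W) : Prop := br_of_galg a x * breB a B = 0.

Definition proj_coset (w : W) (x : galg K W) : galg K W :=
  [ffun g => if g \in lcoset (stab B) w then x g else 0].

Definition annKStab (x : galg K W) : Prop :=
  exists y : W -> galg K W,
    (forall w, annKW (y w)) /\
    x = \sum_w gelt K (w^-1)%g * proj_coset w (y w).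

Definition augKB (x : galg K W) : Prop :=
  lin_span (fun z => exists (u v : galg K W) (h : W),
    [/\ galg_on (stab B) u, galg_on (stab B) v, h \in KB B &
        z = u * (gelt K h - 1) * v]) x.

Section Induced.
Variables (d : nat) (V : mx_representation K (stab B) d).

(* t : {ffun W -> 'cV_d} stands for the element \sum_w w (x) t w of the tensor
   product over K of KW and V. *)
Definition tens (x : galg K W) (v : 'cV[K]_d) : {ffun W -> 'cV[K]_d} :=
  [ffun w => (x w : K) *: v].

Definition tens_act (x : galg K W) (t : {ffun W -> 'cV[K]_d}) :
    {ffun W -> 'cV[K]_d} :=
  [ffun w => \sum_g (x g : K) *: t (g^-1 * w)%g].

(* The quotient by this subspace is the tensor product over KStab(B), that is,
   the induced module. *)
Definition tens_bal (t : {ffun W -> 'cV[K]_d}) : Prop :=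
  lin_span (fun u => exists (x : galg K W) (h : W) (v : 'cV[K]_d),
    h \in stab B /\ u = tens (x * gelt K h) v - tens x (V h *m v)) t.

Definition admissible_pair : Prop :=
  forall x (v : 'cV[K]_d), annKW x -> tens_bal (tens_act x (tens 1 v)).

End Induced.

Definition admissible : Prop :=
  exists (d : nat) (V : mx_representation K (stab B) d),
    (0 < d)%N /\ admissible_pair V.

End Annihilators.

(* The subfield of K generated by iota(k) and t. *)
Definition in_adjoin (k K : fieldType) (iota : {rmorphism k -> K}) (t c : K) :
    Prop :=
  exists p q : {poly k},
    (map_poly iota q).[t] != 0 /\ c = (map_poly iota p).[t] / (map_poly iota q).[t].

Definition proper_field (K : fieldType) (a : brscalars K) : Prop :=
  [pchar K] =i pred0 /\
  exists (k : fieldType) (iota : {rmorphism k -> K}),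
    [/\ forall s, s \in refls -> exists c, iota c = mu a s,
        forall G : {group W}, group_splitting_field k G,
        ~ algebraicOver iota (delta a) &
        exists (m : nat) (b : 'I_m -> K), forall x, exists c : 'I_m -> K,
          (forall i, in_adjoin iota (delta a) (c i)) /\ x = \sum_i c i * b i].

End ReflectionGroup.

Section G22.
Variables (C : fieldType) (n : nat).
Implicit Types (g h : 'M[C]_n) (s t : 'S_n) (e f : 'I_n -> C).

Definition monomial g : bool :=
  [forall i, #|[set j | g i j != 0]| == 1%N] &&
  [forall j, #|[set i | g i j != 0]| == 1%N].

Definition in_G22 g : bool :=
  [&& monomial g,
      [forall i, forall j, (g i j != 0) ==> (g i j \in [:: 1; -1])] &
      \prod_(ij : 'I_n * 'I_n | g ij.1 ij.2 != 0) g ij.1 ij.2 == 1].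

Definition sgnmx s e : 'M[C]_n := \matrix_(i, j) (if s i == j then e i else 0).

Lemma sgnmx_neq0 s e i j :
  (forall i, e i \in [:: 1; -1]) -> (sgnmx s e i j != 0) = (s i == j).
Proof.
move=> e_pm; rewrite mxE; case: ifP => _; last by rewrite eqxx.
by have := e_pm i; rewrite !inE => /orP[]/eqP->; rewrite ?oppr_eq0 oner_eq0.
Qed.

Lemma in_G22P g :
  reflect (exists s e, [/\ forall i, e i \in [:: 1; -1], \prod_i e i = 1
             & g = sgnmx s e]) (in_G22 g).
Proof.
have prodE s e : (forall i, e i \in [:: 1; -1]) ->
    \prod_(ij | sgnmx s e ij.1 ij.2 != 0) sgnmx s e ij.1 ij.2 = \prod_i e i.
  move=> e_pm; under eq_bigl do rewrite sgnmx_neq0 //.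
  rewrite -(pair_big_dep xpredT (fun i j => s i == j) (sgnmx s e)) /=.
  apply: eq_bigr => i _; rewrite (big_pred1 (s i)) ?mxE ?eqxx //.
apply: (iffP and3P) => [[/andP[/forallP row1 /forallP col1]] | [s [e]]].
  move=> /forallP g_pm /eqP g_prod.
  have /fin_all_exists[p pP] i : exists j, [set j | g i j != 0] = [set j].
    exact/cards1P.
  have gE i j : (g i j != 0) = (p i == j).
    by have /setP/(_ j) := pP i; rewrite !inE (eq_sym j).
  have p_inj : injective p.
    move=> i1 i2 eq_p; have /cards1P[i0 /setP ci] := col1 (p i1).
    have := ci i1; have := ci i2; rewrite !inE !gE eq_p eqxx.
    by move=> /esym/eqP-> /esym/eqP->.
  pose s := perm p_inj; pose e i := g i (s i).
  have e_pm i : e i \in [:: 1; -1].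
    by have /forallP/(_ (s i))/implyP := g_pm i; apply; rewrite gE permE.
  have gsE : g = sgnmx s e.
    apply/matrixP=> i j; rewrite mxE permE; case: eqP => [<-|/eqP pij].
      by rewrite /e permE.
    by apply/eqP; rewrite -[_ == 0]negbK gE.
  by exists s, e; split=> //; rewrite -(prodE s) // -gsE.
case=> e_pm e_prod ->; split; last by rewrite prodE // e_prod.
  apply/andP; split; apply/forallP=> i.
    rewrite (_ : [set _ | _] = [set s i]) ?cards1 //.
    by apply/setP=> j; rewrite !inE sgnmx_neq0 // eq_sym.
  rewrite (_ : [set _ | _] = [set s^-1 i]%g) ?cards1 //.
  by apply/setP=> j; rewrite !inE sgnmx_neq0 // (canF_eq (permK s)).
apply/forallP=> i; apply/forallP=> j; apply/implyP; rewrite sgnmx_neq0 //.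
by rewrite mxE => /eqP<-; rewrite eqxx.
Qed.

Lemma sgnmxM s t e f :
  sgnmx s e *m sgnmx t f = sgnmx (s * t)%g (fun i => e i * f (s i)).
Proof.
apply/matrixP=> i j; rewrite !mxE (bigD1 (s i)) //= big1 => [|k].
  by rewrite !mxE eqxx addr0 permM; case: ifP => // _; rewrite mulr0.
by rewrite !mxE eq_sym => /negPf->; rewrite mul0r.
Qed.

Lemma sgnmx_tr s e : (sgnmx s e)^T = sgnmx s^-1%g (fun i => e (s^-1 i)%g).
Proof.
apply/matrixP=> i j; rewrite !mxE (canF_eq (permKV s)) eq_sym.
by case: eqP => // ->; rewrite permK.
Qed.

Lemma in_G22_1 : in_G22 1%:M.
Proof.
apply/in_G22P; exists 1%g, (fun=> 1); split.
- by move=> i; rewrite inE eqxx.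
- by rewrite big1.
by apply/matrixP=> i j; rewrite !mxE perm1; case: eqP.
Qed.

Lemma in_G22_mul g h : in_G22 g -> in_G22 h -> in_G22 (g *m h).
Proof.
move=> /in_G22P[s [e [e_pm e1 ->]]] /in_G22P[t [f [f_pm f1 ->]]].
apply/in_G22P; rewrite sgnmxM; do 2!eexists; split; last by [].
  move=> i; have := e_pm i; have := f_pm (s i); rewrite !inE.
  by case/orP=> /eqP->; case/orP=> /eqP->;
     rewrite ?mulr1 ?mul1r ?mulN1r ?opprK ?eqxx ?orbT.
rewrite big_split /= e1 mul1r -[RHS]f1.
by rewrite [RHS](reindex_inj (@perm_inj _ s)).
Qed.

Lemma in_G22_tr g : in_G22 g -> in_G22 g^T.
Proof.
move=> /in_G22P[s [e [e_pm e1 ->]]]; apply/in_G22P; rewrite sgnmx_tr.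
do 2!eexists; split; last by []; first by move=> i; apply: e_pm.
by rewrite -[RHS]e1 [RHS](reindex_inj (@perm_inj _ s^-1%g)).
Qed.

Lemma in_G22_trV g : in_G22 g -> g^T *m g = 1%:M.
Proof.
move=> /in_G22P[s [e [e_pm e1 ->]]]; rewrite sgnmx_tr sgnmxM.
apply/matrixP=> i j; rewrite !mxE mulVg perm1; case: eqP => // _.
by have := e_pm (s^-1%g i); rewrite !inE => /orP[]/eqP->; rewrite ?mulrNN mulr1.
Qed.

Record G22 : Type := MkG22 { G22val : 'M[C]_n; G22valP : in_G22 G22val }.
HB.instance Definition _ := [isSub for G22val].

Definition G22_code (g : G22) : {ffun 'I_n * 'I_n -> option bool} :=
  [ffun ij => if G22val g ij.1 ij.2 == 0 then None
              else Some (G22val g ij.1 ij.2 == 1)].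

Definition G22_decode (c : {ffun 'I_n * 'I_n -> option bool}) : option G22 :=
  insub (\matrix_(i, j) (if c (i, j) is Some b then if b then 1 else -1 else 0)).

Lemma G22_codeK : pcancel G22_code G22_decode.
Proof.
move=> g; rewrite /G22_decode (_ : \matrix_(i, j) _ = G22val g) ?valK //.
apply/matrixP=> i j; rewrite mxE ffunE /=.
have [<-//|g0] := eqVneq (G22val g i j) 0.
case/and3P: (G22valP g) => _ /forallP/(_ i)/forallP/(_ j)/implyP/(_ g0).
by rewrite !inE; case: eqP => [-> | _ /eqP->].
Qed.

HB.instance Definition _ := Finite.copy G22 (pcan_type G22_codeK).

Definition G22_one : G22 := MkG22 in_G22_1.
Definition G22_mul (g h : G22) : G22 :=
  MkG22 (in_G22_mul (G22valP g) (G22valP h)).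
Definition G22_inv (g : G22) : G22 := MkG22 (in_G22_tr (G22valP g)).

Lemma G22_mulA : associative G22_mul.
Proof. by move=> g h k; apply: val_inj; apply: mulmxA. Qed.
Lemma G22_mul1 : left_id G22_one G22_mul.
Proof. by move=> g; apply: val_inj; apply: mul1mx. Qed.
Lemma G22_mulV : left_inverse G22_one G22_inv G22_mul.
Proof. by move=> g; apply: val_inj; apply: in_G22_trV (G22valP g). Qed.

HB.instance Definition _ :=
  Finite_isGroup.Build G22 G22_mulA G22_mul1 G22_mulV.

Lemma G22_mx_repr : mx_repr [set: G22] G22val.
Proof. by split. Qed.

Definition G22_rep : mx_representation C [set: G22] n :=
  MxRepresentation G22_mx_repr.

Definition Hform (i j : 'I_n) (k : int) (z : 'cV[C]_n) : C^o :=
  z i 0 - (- 1) ^ k * z j 0.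

Lemma Hform_linear i j k : linear (Hform i j k).
Proof.
move=> c z z'; rewrite /Hform !mxE -[c *: _]/(c * _).
by rewrite mulrDr mulrBr opprD addrACA (mulrCA c).
Qed.
HB.instance Definition _ i j k :=
  GRing.isLinear.Build C 'cV[C]_n C^o _ (Hform i j k) (Hform_linear i j k).

Definition Hij (i j : 'I_n) (k : int) : {vspace 'cV[C]_n} :=
  lker (linfun (Hform i j k)).

Lemma mem_Hij i j k z : (z \in Hij i j k) = (z i 0 == (- 1) ^ k * z j 0).
Proof. by rewrite memv_ker lfunE /= subr_eq0. Qed.

Definition Hij_in (i j : 'I_n) (k : int) (B : {set hyper G22_rep}) : Prop :=
  exists2 H, H \in B & hsp H = Hij i j k.

End G22.

(* Main.v *)
(* For x a signed index (i, b), let z_x := (-1)^b z_i; each hyperplane of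
   G(2,2,n) is {z_x = z_y} for two signed points x, y with distinct indices,
   whose indices form the support.  Distinct hyperplanes fail to be transverse
   exactly when their supports meet in one index, and then exactly one
   reflection, "th", carries one to the other.  Write "bar H" for the other
   hyperplane with the support of H.

   Suppose that a transverse collection B contains H and bar H.  For H' in B
   with a different support, the sign change z of one index of H and one of H'
   exchanges H' with bar H' and satisfies z e_B = e_B.  Hence e_{bar H'} e_B =
   z e_{H'} e_B = delta e_B, and e_B is, up to a power of delta, e_{cl B} where
   cl B adds all the bar H'.  So the elements u e_B, with B closed (cl B = B)
   and u in W / K_B, span Br.

   They are independent because Br acts on functions on the set of states
   (B, S), where B is closed and K_B S = S: w sends (B, S) to (wB, wS), while
   e_H multiplies by mu and moves B by th H1 H if some H1 in B is not transverse
   to H, and otherwise multiplies by delta and adjoins H to B and K_{cl(B + H)}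
   to S.  The first case does not depend on H1 because the quotients of the
   possible reflections th H1 H lie in K_B.  From the basis, Ann(e_B) for closed
   B is generated by the h - 1 with h in K_B, which gives admissibility and the
   annihilator; if B is not closed, some element of Ann(e_B) forces V = 0.

   The dimension is therefore the sum over closed B of [W : K_B].  A non-empty
   closed B consists of r hyperplanes with disjoint supports, |K_B| = 2^(2r-1) r!,
   or of r pairs {H, bar H} with disjoint supports, |K_B| = 2^(n-1) 2^r r!.  The
   orders come from orbit counting on signed points and on indices. *)

Require Import Defs.
From HB Require Import structures.
From mathcomp Require Import all_boot all_order all_algebra all_fingroup.
From mathcomp Require Import all_solvable all_character.
From mathcomp Require Import boolp reals complex zify.

Set Implicit Arguments.
Unset Strict Implicit.
Unset Printing Implicit Defensive.

Import GroupScope GRing.Theory.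
Local Open Scope ring_scope.

(** * Signed points *)

Section SignedPoints.
Variables (C : fieldType) (n : nat).
Hypothesis one_neqN1 : (1 : C) != -1.
Local Notation W := (G22 C n).
Local Notation rep := (G22_rep C n).
Local Notation hyper := (hyper rep).
Local Notation sp := ('I_n * bool)%type.
Implicit Types (w v : W) (x y : sp) (z : 'cV[C]_n) (H : hyper) (B : {set hyper}).

(** The defining relations bound the algebra only from above, so a concrete module has to show that
    nothing collapses. The second component of a state serves this purpose: adding a hyperplane to B
    enlarges K_B, and group elements must be forgotten exactly up to the larger group. Dividing e_B
    by delta^|B| makes it depend on the closure alone, so that joining a hyperplane costs one factor
    delta, however many hyperplanes the closure adds. The delicate relation is (B4), when every
    element of B is transverse to both hyperplanes or to neither, and some to neither; both products
    then go through one further hyperplane compatible with B.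

    Let M = n! / (r! 2^r (n-2r)!), the number of choices of r disjoint pairs of indices. There are M
    closed collections of r pairs {H, bar H}, each with index [W : K_B] = M (n-2r)!, and 2^r M
    collections of r hyperplanes with disjoint supports, each with index 2^(n-r) M (n-2r)!. Hence
    the factor 2^n + 1. In the second case orbit counting gives the order of a group containing K_B,
    and a parity character shows that K_B is smaller. *)

Lemma signC_inj : injective (fun b : bool => (-1) ^+ b : C).
Proof.
by case; case=> //= /eqP; rewrite ?[-1 == _]eq_sym (negPf one_neqN1).
Qed.

Lemma prod_sign (I : finType) (b : I -> bool) :
  \prod_i (-1) ^+ b i = (-1) ^+ (\big[addb/false]_i b i) :> C.
Proof.
by elim/big_rec2: _ => [|i y1 y2 _ ->]; rewrite ?expr0 // signr_addb.
Qed.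

Lemma G22_data w : {sb : 'S_n * {ffun 'I_n -> bool} |
  G22val w = sgnmx sb.1 (fun i => (-1) ^+ sb.2 i) &
  \big[addb/false]_i sb.2 i = false}.
Proof.
apply: cid2; have /in_G22P[s [e [e_pm e_prod wE]]] := G22valP w.
pose b := [ffun i => e i == -1].
have eE i : e i = (-1) ^+ b i.
  by rewrite ffunE; have := e_pm i; rewrite !inE => /orP[]/eqP->;
    rewrite ?eqxx ?expr1 // (negPf one_neqN1) expr0.
exists (s, b) => /=.
  by rewrite wE; apply/matrixP=> i j; rewrite !mxE; case: ifP.
apply: signC_inj; rewrite -prod_sign expr0 -[RHS]e_prod.
by apply: eq_bigr => i _; rewrite eE.
Qed.

Definition wperm w : 'S_n := (s2val (G22_data w)).1.
Definition wsgn w : {ffun 'I_n -> bool} := (s2val (G22_data w)).2.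

Lemma G22E w : G22val w = sgnmx (wperm w) (fun i => (-1) ^+ wsgn w i).
Proof. by rewrite /wperm /wsgn; case: (G22_data w). Qed.

Lemma wsgn_even w : \big[addb/false]_i wsgn w i = false.
Proof. by rewrite /wsgn; case: (G22_data w). Qed.

Lemma sgnmx_inj (s t : 'S_n) (a b : {ffun 'I_n -> bool}) :
  sgnmx s (fun i => (-1) ^+ a i : C) = sgnmx t (fun i => (-1) ^+ b i) ->
  s = t /\ a = b.
Proof.
move=> /matrixP E.
have st i : s i = t i.
  apply/esym/eqP; move: (E i (s i)); rewrite !mxE eqxx.
  by case: ifP => // _ /eqP; rewrite signr_eq0.
split; first exact/permP.
apply/ffunP=> i; apply: signC_inj; move: (E i (s i)).
by rewrite !mxE eqxx st eqxx.
Qed.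

Definition pt x w : sp := (wperm w x.1, x.2 (+) wsgn w x.1).
Definition neg x : sp := (x.1, ~~ x.2).

Lemma negK : involutive neg. Proof. by case=> i b; rewrite /neg /= negbK. Qed.
Lemma neg_neq x : (neg x == x) = false.
Proof. by case: x => i []; apply/eqP. Qed.

Lemma wM w v : wperm (w * v)%g = (wperm w * wperm v)%g /\
  (forall i, wsgn (w * v)%g i = wsgn w i (+) wsgn v (wperm w i)).
Proof.
have [] := @sgnmx_inj (wperm (w * v)%g) (wperm w * wperm v)%g
   (wsgn (w * v)%g) [ffun i => wsgn w i (+) wsgn v (wperm w i)].
  rewrite -G22E -[LHS]/(G22val w *m G22val v) (G22E w) (G22E v) sgnmxM.
  by apply/matrixP=> i j; rewrite !mxE ffunE signr_addb.
by move=> -> ->; split=> // i; rewrite ffunE.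
Qed.

Lemma ptM x w v : pt x (w * v)%g = pt (pt x w) v.
Proof. by case: (wM w v) => E1 E2; rewrite /pt /= E1 E2 permM addbA. Qed.

Lemma pt1 x : pt x 1%g = x.
Proof.
have [] := @sgnmx_inj (wperm 1%g) 1%g (wsgn 1%g) [ffun=> false].
  rewrite -G22E; apply/matrixP=> i j; rewrite !mxE perm1 ffunE expr0.
  by case: eqP.
by rewrite /pt => -> ->; rewrite perm1 ffunE addbF -surjective_pairing.
Qed.

Lemma pt_neg x w : pt (neg x) w = neg (pt x w).
Proof. by rewrite /pt /neg /= addNb. Qed.

Lemma ptK w x : pt (pt x w) w^-1%g = x. Proof. by rewrite -ptM mulgV pt1. Qed.
Lemma ptVK w x : pt (pt x w^-1%g) w = x. Proof. by rewrite -ptM mulVg pt1. Qed.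
Lemma pt_inj w : injective (pt^~ w). Proof. exact: (can_inj (g := pt^~ w^-1%g) (ptK w)). Qed.

Lemma pt_eq w v : (forall x, pt x w = pt x v) -> w = v.
Proof.
move=> E; apply: val_inj; rewrite -[val w]/(G22val w) -[val v]/(G22val v).
rewrite !G22E; apply/matrixP=> i j; rewrite !mxE.
by have [-> ->] := E (i, false).
Qed.

Lemma mkW_ex (s : 'S_n) (b : 'I_n -> bool) : \big[addb/false]_i b i = false ->
  {w | forall x, pt x w = (s x.1, x.2 (+) b x.1)}.
Proof.
move=> b_even.
have g_in : in_G22 (sgnmx s (fun i => (-1) ^+ b i : C)).
  apply/in_G22P; exists s, (fun i => (-1) ^+ b i); split=> //.
    by move=> i; rewrite !inE; case: (b i); rewrite ?eqxx ?orbT.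
  by rewrite prod_sign b_even.
exists (MkG22 g_in) => x.
have [] := @sgnmx_inj (wperm (MkG22 g_in)) s (wsgn (MkG22 g_in)) [ffun i => b i].
  by rewrite -G22E /=; apply/matrixP=> i j; rewrite !mxE ffunE.
by rewrite /pt => -> ->; rewrite ffunE.
Qed.

(* W acts on signed points from the right, so that [zc (w z) x = zc z (x w)]. *)
Definition zc z x : C := (-1) ^+ x.2 * z x.1 0.

Lemma zc_neg z x : zc z (neg x) = - zc z x.
Proof. by rewrite /zc /= -mulNr; case: x.2; rewrite ?expr0 ?expr1 ?opprK. Qed.

Lemma zc_inj z z' : zc z =1 zc z' -> z = z'.
Proof.
move=> E; apply/matrixP=> i j; rewrite ord1.
by have := E (i, false); rewrite /zc /= expr0 !mul1r.
Qed.

Lemma zc_act w z x : zc (actfun rep w z) x = zc z (pt x w).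
Proof.
have -> : actfun rep w z = G22val w *m z by rewrite actfunE.
rewrite G22E /zc mxE (bigD1 (wperm w x.1)) //=.
rewrite big1 ?addr0 => [|j]; first by rewrite mxE eqxx mulrA signr_addb.
by rewrite mxE eq_sym => /negPf->; rewrite mul0r.
Qed.

(** The equation z_x = z_y reads z_i = (-1)^k z_j with k the sum mod 2 of the two sign bits, hence
    the exclusive or. *)
Definition Hpt x y : {vspace 'cV[C]_n} :=
  locked (Hij C x.1 y.1 (Posz (x.2 (+) y.2))).

Lemma mem_Hpt x y z : (z \in Hpt x y) = (zc z x == zc z y).
Proof.
rewrite /Hpt -lock mem_Hij /zc -exprnP; case: x.2; case: y.2; rewrite /= ?expr0 ?expr1 ?mul1r //.
  by rewrite !mulN1r eqr_opp.
by rewrite !mulN1r eqr_oppLR.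
Qed.

Lemma mem_fixsp w z : reflect (forall x, zc z (pt x w) = zc z x) (z \in fixsp rep w).
Proof.
apply: (iffP fixedSpaceP) => [E x | E]; first by rewrite -zc_act E.
by apply: zc_inj => x; rewrite zc_act.
Qed.

Lemma HptC x y : Hpt x y = Hpt y x.
Proof. by apply/vspaceP=> z; rewrite !mem_Hpt eq_sym. Qed.

Lemma Hpt_neg x y : Hpt (neg x) (neg y) = Hpt x y.
Proof. by apply/vspaceP=> z; rewrite !mem_Hpt !zc_neg eqr_opp. Qed.

(** The basis vector dual to the coordinate at [x]. These vectors and their sums [vec2] are the test
    vectors that separate hyperplanes. *)
Definition dvec x : 'cV[C]_n := (-1) ^+ x.2 *: delta_mx x.1 0.

Lemma zc_dvec x y : zc (dvec x) y = (y == x)%:R - (y == neg x)%:R.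
Proof.
rewrite /zc !mxE eqxx andbT; case: x y => i b [j c] /=; rewrite /neg !xpair_eqE /=.
by have [_|ij] := eqVneq j i; rewrite /= ?mulr0 ?subrr //; case: b; case: c => /=;
  rewrite ?expr0 ?expr1 ?mulr1 ?mul1r ?mulrNN ?mulr1 ?subr0 ?sub0r.
Qed.

Lemma zcD z z' x : zc (z + z') x = zc z x + zc z' x.
Proof. by rewrite /zc mxE mulrDr. Qed.

Lemma pair1_neq x y : x.1 != y.1 -> [/\ (x == y) = false, (x == neg y) = false,
  (y == x) = false & (y == neg x) = false].
Proof.
by case: x y => i b [j c] /= /negPf ij; rewrite /neg !xpair_eqE [j == i]eq_sym ij.
Qed.

Definition vec2 x y := dvec x + dvec y.

Lemma vec2_in x y : x.1 != y.1 -> vec2 x y \in Hpt x y.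
Proof.
move=> /pair1_neq[e1 e2 e3 e4]; rewrite mem_Hpt !zcD !zc_dvec !eqxx e1 e2 e3 e4.
by rewrite ![_ == neg _]eq_sym !neg_neq !subr0 addr0 add0r.
Qed.

Lemma dvec_in x y k : k.1 != x.1 -> k.1 != y.1 -> dvec k \in Hpt x y.
Proof.
move=> /pair1_neq[_ _ e1 e2] /pair1_neq[_ _ e3 e4].
by rewrite mem_Hpt !zc_dvec e1 e2 e3 e4.
Qed.

Lemma Hpt_neq0 x y k : x.1 != y.1 -> exists2 z, z \in Hpt x y & zc z k != 0.
Proof.
move=> xy; have [kx|kx] := eqVneq k.1 x.1; last have [ky|ky] := eqVneq k.1 y.1.
- exists (vec2 x y); first exact: vec2_in.
  rewrite zcD !zc_dvec; have [e1 e2 _ _] : [/\ (k == y) = false, (k == neg y) = false, true & true].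
    by have [] := @pair1_neq k y; rewrite ?kx.
  rewrite e1 e2 subrr addr0; case: k x {e1 e2 xy} kx => i b [j c] /= ->.
  by rewrite /neg !xpair_eqE !eqxx /=; case: b; case: c; rewrite /= ?subr0 ?sub0r ?oppr_eq0 oner_eq0.
- exists (vec2 x y); first exact: vec2_in.
  rewrite zcD !zc_dvec; have [e1 e2 _ _] : [/\ (k == x) = false, (k == neg x) = false, true & true].
    by have [] := @pair1_neq k x.
  rewrite e1 e2 subrr add0r; case: k y {e1 e2 xy} ky kx => i b [j c] /= -> _.
  by rewrite /neg !xpair_eqE !eqxx /=; case: b; case: c; rewrite /= ?subr0 ?sub0r ?oppr_eq0 oner_eq0.
exists (dvec k); first exact: dvec_in.
by rewrite zc_dvec eqxx [k == _]eq_sym neg_neq subr0 oner_eq0.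
Qed.

(** A hyperplane determines its pair of points up to exchange and common sign. The vectors [dvec k]
    away from [x] and [y] force the indices of [x'] and [y'], and [vec2 x y] then forces the
    signs. *)
Lemma Hpt_sub x y x' y' : x.1 != y.1 -> x' != y' ->
  (forall z, z \in Hpt x y -> zc z x' = zc z y') ->
  [\/ x' = x /\ y' = y, x' = y /\ y' = x,
      x' = neg x /\ y' = neg y | x' = neg y /\ y' = neg x].
Proof.
move=> xy xy' E; have one0 : (1 : C) <> 0 by apply/eqP; rewrite oner_eq0.
have None0 : (-1 : C) <> 0 by apply/eqP; rewrite oppr_eq0 oner_eq0.
have ne' : x'.1 != y'.1.
  (* With equal indices [y'] would be [neg x'], and the equation 2 z_x' = 0 would hold on the whole
     hyperplane. *)
  apply/negP=> /eqP e1; have [z zH] := Hpt_neq0 x' xy; have := E z zH.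
  have -> : y' = neg x' by case: x' y' xy' e1 {E} => i b [j c] /= + E;
    rewrite E xpair_eqE eqxx /= => bc; rewrite /neg /=; congr pair; case: b c bc => [][].
  move=> /eqP; rewrite zc_neg -addr_eq0 -mulr2n -mulr_natl mulf_eq0 => /orP[|/eqP->].
    by rewrite mulr2n addr_eq0 (negPf one_neqN1).
  by rewrite eqxx.
have in_k : forall k : sp, (k = x' \/ k = y') -> (k.1 == x.1) || (k.1 == y.1).
  move=> k kE; apply/negPn/negP; rewrite negb_or => /andP[k1 k2].
  have [e1 e2 e3 e4] := pair1_neq ne'.
  have := E _ (dvec_in k1 k2); rewrite !zc_dvec.
  by case: kE => ->; rewrite ?eqxx ?e1 ?e2 ?e3 ?e4 ?[_ == neg _]eq_sym ?neg_neq ?subr0 ?sub0r // => /esym.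
have := E _ (vec2_in xy); have := in_k x' (or_introl erefl); have := in_k y' (or_intror erefl).
rewrite !zcD !zc_dvec.
case: x y x' y' {E in_k} xy xy' ne' => i b [j c] [i' b'] [j' c'] /= ij _ ij'.
rewrite /neg !xpair_eqE /=.
case/orP=> /eqP ej; case/orP=> /eqP ei; subst; rewrite ?eqxx in ij ij' => //.
  rewrite !eqxx /= (negPf ij') [i == j]eq_sym (negPf ij') /= !subrr ?add0r ?addr0.
  case: b c b' c' => [] [] [] [] /= /eqP; rewrite ?subr0 ?sub0r ?(negPf one_neqN1) 1?eq_sym ?(negPf one_neqN1) //= => _;
  by [apply: Or41|apply: Or42|apply: Or43|apply: Or44].
rewrite !eqxx /= (negPf ij') [j == i]eq_sym (negPf ij') /= !subrr ?add0r ?addr0.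
case: b c b' c' => [] [] [] [] /= /eqP; rewrite ?subr0 ?sub0r ?(negPf one_neqN1) 1?eq_sym ?(negPf one_neqN1) //= => _;
  by [apply: Or41|apply: Or42|apply: Or43|apply: Or44].
Qed.
End SignedPoints.

(** * Reflections *)

Section Reflections.
Variables (C : fieldType) (n : nat).
Hypothesis one_neqN1 : (1 : C) != -1.
Local Notation W := (G22 C n).
Local Notation rep := (G22_rep C n).
Local Notation hyper := (hyper rep).
Local Notation sp := ('I_n * bool)%type.
Local Notation pt := (pt one_neqN1).
Implicit Types (w v : W) (x y : sp) (z : 'cV[C]_n) (H : hyper) (B : {set hyper}).

Lemma same_pt x y : x.1 = y.1 -> y = x \/ y = neg x.
Proof.
by case: x y => i b [j c] /= <-; case: b c => [] []; by [left|right].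
Qed.

Lemma negb1 x y : x != y -> x.1 = y.1 -> y = neg x.
Proof. by move=> xy /same_pt[] // yx; rewrite yx eqxx in xy. Qed.

(** A reflection joining points of different sign changes the sign at both indices, so the product
    of the signs stays 1. The guard [x.1 != y.1] keeps the parity even when the two indices
    coincide. *)
Lemma tsp_even x y : \big[addb/false]_i
  [&& x.1 != y.1, x.2 (+) y.2 & i \in [set x.1; y.1]] = false.
Proof.
case: eqP => /= [_|/eqP xy]; first by rewrite big1.
rewrite (bigD1 x.1) //= (bigD1 y.1) 1?eq_sym //= !inE !eqxx orbT !andbT addbA addbb.
by rewrite big1 // => i /andP[/negPf ix /negPf iy]; rewrite !inE ix iy andbF.
Qed.

Definition tsp x y : W := sval (mkW_ex one_neqN1 (tperm x.1 y.1) (tsp_even x y)).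

Lemma tspE x y u : pt u (tsp x y) = (tperm x.1 y.1 u.1,
  u.2 (+) [&& x.1 != y.1, x.2 (+) y.2 & u.1 \in [set x.1; y.1]]).
Proof. by rewrite /tsp; case: (mkW_ex _ _ _) => /= w ->. Qed.

Lemma tspL x y : x.1 != y.1 -> pt x (tsp x y) = y.
Proof.
move=> xy; rewrite tspE xy !inE eqxx /= andbT tpermL.
by case: x y {xy} => i b [j c] /=; rewrite addbA addbb.
Qed.

Lemma tspR x y : x.1 != y.1 -> pt y (tsp x y) = x.
Proof.
move=> xy; rewrite tspE xy !inE eqxx orbT /= andbT tpermR.
by case: x y {xy} => i b [j c] /=; rewrite addbC addbK.
Qed.

Lemma tspD x y u : u.1 != x.1 -> u.1 != y.1 -> pt u (tsp x y) = u.
Proof.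
move=> ux uy; rewrite tspE tpermD 1?eq_sym // !inE (negPf ux) (negPf uy) /=.
by rewrite !andbF addbF -surjective_pairing.
Qed.

Lemma tsp_eq x y w : x.1 != y.1 -> pt x w = y -> pt y w = x ->
  (forall u, u.1 != x.1 -> u.1 != y.1 -> pt u w = u) -> w = tsp x y.
Proof.
move=> xy wx wy wD; apply: pt_eq one_neqN1 _ _ _ => u.
have [/esym/same_pt[]->|ux] := eqVneq u.1 x.1.
- by rewrite tspL.
- by rewrite !pt_neg tspL // wx.
have [/esym/same_pt[]->|uy] := eqVneq u.1 y.1.
- by rewrite tspR.
- by rewrite !pt_neg tspR // wy.
by rewrite tspD ?wD.
Qed.

Lemma tspC x y : x.1 != y.1 -> tsp x y = tsp y x.
Proof.
move=> xy; apply: tsp_eq; rewrite 1?eq_sym ?tspL ?tspR //.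
by move=> u uy ux; rewrite tspD.
Qed.

Lemma tsp_neg x y : x.1 != y.1 -> tsp (neg x) (neg y) = tsp x y.
Proof.
move=> xy; apply/esym/tsp_eq; rewrite // ?pt_neg ?tspL ?tspR //.
by move=> u ux uy; rewrite tspD.
Qed.

Lemma pt_idx x y w : (pt x w).1 == (pt y w).1 = (x.1 == y.1).
Proof. by rewrite /= (inj_eq perm_inj). Qed.

Lemma tspJ x y w : x.1 != y.1 ->
  (w * tsp x y * w^-1)%g = tsp (pt x w^-1%g) (pt y w^-1%g).
Proof.
move=> xy; apply: tsp_eq; rewrite ?pt_idx // ?ptM ?ptVK ?tspL ?tspR //.
move=> u ux uy; rewrite !ptM tspD ?ptK // -(pt_idx _ _ w^-1%g) ptK //.
Qed.

Lemma fixsp_tsp x y : x.1 != y.1 -> fixsp rep (tsp x y) = Hpt C x y.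
Proof.
move=> xy; apply/vspaceP=> z; rewrite mem_Hpt.
apply/(mem_fixsp one_neqN1)/eqP => [/(_ y)|E u]; first by rewrite tspR.
have [/esym/same_pt[]->|ux] := eqVneq u.1 x.1.
- by rewrite tspL.
- by rewrite pt_neg tspL // !zc_neg E.
have [/esym/same_pt[]->|uy] := eqVneq u.1 y.1.
- by rewrite tspR.
- by rewrite pt_neg tspR // !zc_neg E.
by rewrite tspD.
Qed.

Lemma dim_Hpt x y : x.1 != y.1 -> (\dim (Hpt C x y)).+1 = n.
Proof.
move=> xy; set f := linfun (@Hform C n x.1 y.1 (Posz (x.2 (+) y.2))).
have := limg_ker_dim f fullv; rewrite capfv dimvf.
have -> : dim 'cV[C]_n = n by rewrite /dim /= muln1.
have HE : Hpt C x y = lker f by rewrite /Hpt -lock.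
rewrite HE; suff -> : \dim (limg f) = 1%N by rewrite addn1.
apply/eqP; rewrite eqn_leq; apply/andP; split.
  by apply: leq_trans (dimvS (subvf _)) _; rewrite dimvf.
rewrite lt0n dimv_eq0; apply/eqP=> f0.
have : f (dvec C x) \in limg f by rewrite memv_img ?memvf.
rewrite f0 memv0 -memv_ker -HE mem_Hpt !zc_dvec eqxx.
have [_ _ -> ->] := pair1_neq xy.
by rewrite [x == neg x]eq_sym neg_neq subr0 subrr oner_eq0.
Qed.

Lemma tsp_refl x y : x.1 != y.1 -> tsp x y \in refls rep.
Proof. by move=> xy; rewrite inE fixsp_tsp // dim_Hpt. Qed.

(** Every fixed vector satisfies z_(uw) = z_u. If [w] moves [u], this is an equation between two
    points valid on the hyperplane, and [Hpt_sub] identifies [u] and its image. *)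
Lemma Hpt_fix x y w : x.1 != y.1 -> (Hpt C x y <= fixsp rep w)%VS ->
  w = 1%g \/ w = tsp x y.
Proof.
move=> xy /subvP sub.
have moved u : pt u w != u -> [\/ pt u w = y /\ u = x, pt u w = x /\ u = y,
    pt u w = neg y /\ u = neg x | pt u w = neg x /\ u = neg y].
  rewrite eq_sym => wu; case: (Hpt_sub one_neqN1 xy wu).
  + by move=> z zH; rewrite (mem_fixsp one_neqN1 _ _ (sub z zH)).
  + by case=> -> ->; apply: Or41.
  + by case=> -> ->; apply: Or42.
  + by case=> -> ->; apply: Or43.
  + by case=> -> ->; apply: Or44.
have [e1 e2 e3 e4] := pair1_neq xy.
have wD u : u.1 != x.1 -> u.1 != y.1 -> pt u w = u.
  move=> ux uy; apply/eqP; apply: contraT => /moved[] [_ uE]; subst;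
  by rewrite ?eqxx in ux uy.
have [wx|wx] := eqVneq (pt x w) x.
  have wy : pt y w = y.
    apply/eqP; apply: contraT => /moved[] [wy yE].
    + by rewrite yE eqxx in xy.
    + by case/negP: xy; rewrite -(inj_eq (@pt_inj _ _ one_neqN1 w)) in e1; rewrite wx wy eqxx in e1.
    + by rewrite yE eqxx in e4.
    + by have := neg_neq y; rewrite -yE eqxx.
  left; apply: pt_eq one_neqN1 _ _ _ => u; rewrite pt1.
  have [/esym/same_pt[]->|ux] := eqVneq u.1 x.1; rewrite ?pt_neg ?wx //.
  have [/esym/same_pt[]->|uy] := eqVneq u.1 y.1; rewrite ?pt_neg ?wy //.
  exact: wD.
have wxy : pt x w = y.
  case/moved: wx => [[] //|||] [_ xE].
  + by rewrite xE eqxx in e1.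
  + by have := neg_neq x; rewrite -xE eqxx.
  + by rewrite xE eqxx in e2.
right; apply: tsp_eq => //.
have : pt y w != y.
  by rewrite -{2}wxy (inj_eq (@pt_inj _ _ one_neqN1 w)) e3.
case/moved => [[_ yE]|[] //|[_ yE]|[_ yE]].
+ by rewrite yE eqxx in e3.
+ by rewrite yE eqxx in e4.
+ by have := neg_neq y; rewrite -yE eqxx.
Qed.

Lemma moved_even w : (forall x, (pt x w).1 = x.1) ->
  ~~ odd #|[set i : 'I_n | pt (i, false) w != (i, false)]|.
Proof.
move=> fix_idx; rewrite -sum1_card (big_morph odd oddD (erefl _)) big_mkcond /=.
rewrite (eq_bigr (wsgn one_neqN1 w)) ?wsgn_even // => i _.
rewrite inE /pt xpair_eqE /=; have -> : wperm one_neqN1 w i = i.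
  exact: (fix_idx (i, false)).
by rewrite eqxx; case: (wsgn _ _ _).
Qed.

(** A reflection moving an index fixes the hyperplane that equates a point with its image. One
    fixing all indices would change an even number of signs, so two coordinates would vanish on its
    fixed space, which would then equal two different hyperplanes. *)
Lemma reflsP w : reflect (exists x y, x.1 != y.1 /\ w = tsp x y) (w \in refls rep).
Proof.
apply: (iffP idP) => [|[x [y [xy ->]]]]; last exact: tsp_refl.
rewrite inE => /eqP dim_w.
suff [x [y [xy fixE]]] : exists x y, x.1 != y.1 /\ fixsp rep w = Hpt C x y.
  exists x, y; split=> //; case: (@Hpt_fix x y w xy); rewrite ?fixE // => w1.
  suff fix1 : fixsp rep 1%g = fullv.
    move: dim_w; rewrite w1 fix1 dimvf /dim /= muln1 => /eqP.
    by rewrite eqn_leq ltnn.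
  by apply/vspaceP=> z; rewrite memvf; apply/fixedSpaceP/actfun1.
have eq_fix x y : x.1 != y.1 -> (forall z, z \in fixsp rep w -> zc z x = zc z y) ->
    fixsp rep w = Hpt C x y.
  move=> xy E; apply/eqP; rewrite eqEdim; apply/andP; split.
    by apply/subvP=> z /E; rewrite mem_Hpt => ->.
  by rewrite -ltnS dim_w dim_Hpt.
have [[x w_x]|no_move] := pselect (exists x, (pt x w).1 != x.1).
  exists (pt x w), x; split=> //; apply: eq_fix => // z.
  by move/(mem_fixsp one_neqN1)/(_ x).
have fix_idx x : (pt x w).1 = x.1.
  by apply/eqP; apply: contraT => wx; case: no_move; exists x.
pose S := [set i : 'I_n | pt (i, false) w != (i, false)].
have SP x : x.1 \in S -> pt x w = neg x.
  rewrite inE => xS; apply: negb1; last by rewrite fix_idx.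
  apply: contra xS => /eqP wx; have [x0|x0] := @same_pt x (x.1, false) erefl.
    by rewrite x0 -wx.
  by rewrite x0 pt_neg -wx.
have S_odd : ~~ odd #|S| by apply: moved_even.
have : S != set0.
  apply/eqP=> S0; move: dim_w; suff -> : fixsp rep w = fullv.
    by rewrite dimvf /dim /= muln1 => /eqP; rewrite eqn_leq ltnn.
  apply/vspaceP=> z; rewrite memvf; apply/(mem_fixsp one_neqN1) => x; congr (zc z _).
  have : x.1 \notin S by rewrite S0 inE.
  rewrite inE negbK => /eqP w0; have [x0|x0] := @same_pt (x.1, false) x erefl.
    by rewrite x0.
  by rewrite x0 pt_neg w0.
case/set0Pn=> i iS; have : S :\ i != set0.
  rewrite -card_gt0; move: S_odd; rewrite (cardsD1 i) iS; by case: #|_|.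
case/set0Pn=> j; rewrite !inE => /andP[ji jS].
have z0 z k : z \in fixsp rep w -> k \in S -> forall b, zc z (k, b) = 0.
  move=> /(mem_fixsp one_neqN1) zw kS b; move: (zw (k, b)); rewrite SP // zc_neg => /eqP.
  rewrite eq_sym -addr_eq0 -mulr2n -mulr_natl mulf_eq0 => /orP[|/eqP->//].
  by rewrite mulr2n addr_eq0 (negPf one_neqN1).
have jS' : j \in S by rewrite inE.
have E1 : fixsp rep w = Hpt C (j, false) (i, false) by apply: eq_fix => // z zw; rewrite !z0.
have E2 : fixsp rep w = Hpt C (j, false) (i, true) by apply: eq_fix => // z zw; rewrite !z0.
have ji' : (j, false).1 != (i, true).1 by [].
have [] := @Hpt_sub _ _ one_neqN1 (j, false) (i, false) (j, false) (i, true) ji.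
- by apply/negP; rewrite xpair_eqE (negPf ji).
- by move=> z; rewrite -E1 E2 mem_Hpt => /eqP.
- by case.
- by case=> [[E]]; rewrite E eqxx in ji.
- by case.
- by case=> [[E]]; rewrite E eqxx in ji.
Qed.
End Reflections.

(** * Hyperplanes and their supports *)

Section Hyperplanes.
Variables (C : fieldType) (n : nat).
Hypothesis one_neqN1 : (1 : C) != -1.
Local Notation W := (G22 C n).
Local Notation rep := (G22_rep C n).
Local Notation hyper := (hyper rep).
Local Notation sp := ('I_n * bool)%type.
Local Notation pt := (pt one_neqN1).
Local Notation tsp := (tsp one_neqN1).
Implicit Types (w : W) (x y u v : sp) (z : 'cV[C]_n) (H : hyper) (B : {set hyper}).

Lemma hyp_pts H : {xy : sp * sp | xy.1.1 != xy.2.1 /\ hsp H = Hpt C xy.1 xy.2}.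
Proof.
apply: cid; case: H => U /= /[dup] /imageP[r /(reflsP one_neqN1)[x [y [xy ->]]] UE] _.
by exists (x, y); split=> //=; rewrite /hsp /= UE fixsp_tsp.
Qed.

Definition rH H : W := tsp (sval (hyp_pts H)).1 (sval (hyp_pts H)).2.

(* H is the hyperplane where the coordinates at x and at y agree. *)
Definition on H x y : bool := (x.1 != y.1) && (pt x (rH H) == y).

Lemma rH_tsp H x y : x.1 != y.1 -> hsp H = Hpt C x y -> rH H = tsp x y.
Proof.
move=> xy; rewrite /rH; case: (hyp_pts H) => -[x' y'] /= [xy' ->] HE.
have xy'' : x' != y' by apply: contraNneq xy' => ->.
have := Hpt_sub one_neqN1 xy xy''; rewrite -HE => /(_ _)[z|[-> ->]|[-> ->]|[-> ->]|[-> ->]] //.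
- by rewrite mem_Hpt => /eqP.
- by rewrite tspC // eq_sym.
- by rewrite tsp_neg.
- by rewrite tsp_neg 1?eq_sym // tspC // eq_sym.
Qed.

Lemma onP H x y : reflect (x.1 != y.1 /\ hsp H = Hpt C x y) (on H x y).
Proof.
apply: (iffP andP) => [[xy /eqP]|[xy HE]]; last first.
  by rewrite xy (rH_tsp xy HE) tspL.
rewrite /rH; case: (hyp_pts H) => -[x' y'] /= [xy' ->] yE; split=> //; move: yE.
have [/esym/same_pt[]->|ux] := eqVneq x.1 x'.1.
- by rewrite tspL // => ->.
- by rewrite pt_neg tspL // => <-; rewrite Hpt_neg.
have [/esym/same_pt[]->|uy] := eqVneq x.1 y'.1.
- by rewrite tspR // => ->; rewrite HptC.
- by rewrite pt_neg tspR // => <-; rewrite Hpt_neg HptC.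
by rewrite tspD // => xy0; rewrite xy0 eqxx in xy.
Qed.

Lemma on_r H x y : on H x y -> rH H = tsp x y.
Proof. by case/onP; apply: rH_tsp. Qed.

Lemma on_ne H x y : on H x y -> x.1 != y.1. Proof. by case/andP. Qed.

Lemma on_sym H x y : on H x y = on H y x.
Proof. by apply/onP/onP; rewrite eq_sym HptC. Qed.

Lemma on_neg H x y : on H (neg x) (neg y) = on H x y.
Proof. by apply/onP/onP; rewrite Hpt_neg. Qed.

Lemma on_inj H H' x y : on H x y -> on H' x y -> H = H'.
Proof. by move=> /onP[_ E] /onP[_ E']; apply: hsp_inj; rewrite E E'. Qed.

Lemma on_fun H x y y' : on H x y -> on H x y' -> y = y'.
Proof. by move=> /andP[_ /eqP<-] /andP[_ /eqP]. Qed.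

Lemma on_any H : exists x y, on H x y.
Proof.
by case: (hyp_pts H) => -[x y] [xy HE]; exists x, y; apply/onP.
Qed.

Lemma on_ex x y : x.1 != y.1 -> {H | on H x y}.
Proof.
move=> xy; have Hin : Hpt C x y \in hyps rep.
  by apply/imageP; exists (tsp x y); rewrite ?tsp_refl ?fixsp_tsp.
by exists (SeqSub Hin); apply/onP.
Qed.

Lemma on_act w H x y : on (hact w H) x y = on H (pt x w) (pt y w).
Proof.
have memE z : (z \in hsp (hact w H)) = (actfun rep w^-1%g z \in hsp H).
  rewrite -[hsp (hact w H)]/(actfun rep w @: hsp H)%VS.
  apply/memv_imgP/idP => [[u uH ->]|zH]; first by rewrite actfunK.
  by exists (actfun rep w^-1%g z); rewrite // actfunVK.
apply/onP/onP; rewrite pt_idx => -[xy HE]; split=> //; apply/vspaceP=> z.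
  have := memE (actfun rep w z); rewrite actfunK => <-.
  by rewrite HE !mem_Hpt !(zc_act one_neqN1).
by rewrite memE HE !mem_Hpt !(zc_act one_neqN1) !ptK.
Qed.

Lemma rHJ w H : rH (hact w H) = (w * rH H * w^-1)%g.
Proof.
have [x [y Hxy]] := on_any H; rewrite (on_r Hxy) tspJ ?(on_ne Hxy) //.
by apply: on_r; rewrite on_act !ptVK.
Qed.

Lemma rHK H : (rH H * rH H)%g = 1%g.
Proof.
have [x [y Hxy]] := on_any H; have xy := on_ne Hxy; rewrite (on_r Hxy).
apply: pt_eq one_neqN1 _ _ _ => u; rewrite ptM pt1.
have [/esym/same_pt[]->|ux] := eqVneq u.1 x.1; rewrite ?pt_neg ?tspL ?tspR //.
have [/esym/same_pt[]->|uy] := eqVneq u.1 y.1; rewrite ?pt_neg ?tspR ?tspL //.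
by rewrite !tspD // ?tspD.
Qed.

Lemma rHV H : ((rH H)^-1)%g = rH H.
Proof. by apply/eqP; rewrite eq_invg_mul rHK. Qed.

Lemma fixsp_rH H : fixsp rep (rH H) = hsp H.
Proof.
have [x [y Hxy]] := on_any H; rewrite (on_r Hxy).
by case/onP: Hxy => xy ->; rewrite fixsp_tsp.
Qed.

Lemma rH_refl H : rH H \in refls rep.
Proof.
have [x [y Hxy]] := on_any H; rewrite (on_r Hxy).
exact: tsp_refl (on_ne Hxy).
Qed.

Lemma refl_rH r : r \in refls rep -> {H | r = rH H}.
Proof.
move=> rr; apply: cid; have /(reflsP one_neqN1)[x [y [xy ->]]] := rr.
by have [H /on_r] := on_ex xy; exists H.
Qed.

Lemma hsp_fix H w : (hsp H <= fixsp rep w)%VS -> w = 1%g \/ w = rH H.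
Proof.
have [x [y Hxy]] := on_any H; rewrite (on_r Hxy).
by case/onP: Hxy => xy ->; apply: Hpt_fix.
Qed.

(** * Supports and the pairing modulo 2 *)

Definition supp H : {set 'I_n} := [set i | (pt (i, false) (rH H)).1 != i].

Lemma in_supp H x : (x.1 \in supp H) = ((pt x (rH H)).1 != x.1).
Proof. by rewrite inE /pt. Qed.

Lemma on_supp H x y : on H x y -> supp H = [set x.1; y.1].
Proof.
move=> Hxy; have xy := on_ne Hxy; apply/setP=> i.
rewrite (in_supp H (i, false)) (on_r Hxy) tspE !inE /=.
 have [->|ix] := eqVneq i x.1; first by rewrite /= tpermL eq_sym.
have [->|iy] := eqVneq i y.1; first by rewrite /= tpermR.
by rewrite tpermD ?eqxx // eq_sym.
Qed.

Lemma on_supp1 H x y : on H x y -> x.1 \in supp H.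
Proof. by move/on_supp->; rewrite !inE eqxx. Qed.

Lemma supp_on H x : x.1 \in supp H -> on H x (pt x (rH H)).
Proof. by rewrite in_supp /on eqxx andbT eq_sym. Qed.

Lemma pt_notin H x : x.1 \notin supp H -> pt x (rH H) = x.
Proof.
have [y [y' Hyy]] := on_any H; rewrite (on_supp Hyy) !inE negb_or => /andP[xy xy'].
by rewrite (on_r Hyy) tspD.
Qed.

Lemma card_supp H : #|supp H| = 2%N.
Proof.
by have [x [y Hxy]] := on_any H; rewrite (on_supp Hxy) cards2 (on_ne Hxy).
Qed.

Lemma supp_act w H i : (i \in supp (hact w H)) = ((pt (i, false) w).1 \in supp H).
Proof.
apply/idP/idP => [/(@supp_on _ (i, false))|].
  by rewrite on_act => /on_supp1.
move/supp_on; set y := pt _ _ => yH.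
by apply: (@on_supp1 _ (i, false) (pt (pt y (rH H)) w^-1%g)); rewrite on_act ptVK.
Qed.

(** By [Hpt_sub] an endpoint can be negated in any of the four ordered pairs of points describing
    [H], always with the same result. *)
Lemma bar_ex H : {H' | forall x y, on H' x y = on H x (neg y)}.
Proof.
apply: cid; have [x [y Hxy]] := on_any H; have xy := on_ne Hxy.
have [H' H'xy] : {H' | on H' x (neg y)} by apply: on_ex.
have hsub H1 H2 a b u b' : on H1 a b -> on H2 a (neg b) -> on H1 u b' -> on H2 u (neg b').
  move=> H1xy H2xy H1uv; have /onP[_ E1] := H1xy; have /onP[uv E2] := H1uv.
  have uv' : u != b' by apply: contraNneq uv => ->.
  case: (Hpt_sub one_neqN1 (on_ne H1xy) uv') => [z||||] [].
  - by rewrite -E1 E2 mem_Hpt => /eqP.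
  - by move=> -> ->.
  - by move=> -> ->; rewrite -on_neg negK on_sym.
  - by move=> -> ->; rewrite on_neg.
  - by move=> -> ->; rewrite negK on_sym.
exists H' => u v; apply/idP/idP => [H'uv|].
  by apply: (hsub _ _ x (neg y)) H'uv; rewrite ?negK.
by move/(hsub _ _ _ _ _ _ Hxy H'xy); rewrite negK.
Qed.

(* Sealed as a function: comparing [bar H] with [H] by conversion diverges. *)
Lemma bar_fun : {f : hyper -> hyper | forall H x y, on (f H) x y = on H x (neg y)}.
Proof. by exists (fun H => sval (bar_ex H)) => H x y; case: (bar_ex H). Qed.

Definition bar : hyper -> hyper := sval bar_fun.

Lemma on_bar H x y : on (bar H) x y = on H x (neg y).
Proof. by rewrite /bar; case: bar_fun => f /= ->. Qed.

Lemma on_eq H H' : (forall x y, on H x y -> on H' x y) -> H = H'.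
Proof. by move=> E; have [x [y Hxy]] := on_any H; apply: on_inj (Hxy) (E _ _ Hxy). Qed.

Lemma barK : involutive bar.
Proof. by move=> H; apply: on_eq => x y; rewrite !on_bar negK. Qed.

Lemma bar_inj : injective bar. Proof. exact: can_inj barK. Qed.

Lemma bar_neq H : bar H != H.
Proof.
apply/eqP=> E; have [x [y Hxy]] := on_any H.
have := Hxy; rewrite -{1}E on_bar => /(on_fun Hxy) yE.
by have := neg_neq y; rewrite -yE eqxx.
Qed.

Lemma bar_act w H : hact w (bar H) = bar (hact w H).
Proof. by apply: on_eq => x y; rewrite on_bar !on_act on_bar pt_neg. Qed.

Lemma supp_bar H : supp (bar H) = supp H.
Proof.
have [x [y Hxy]] := on_any H; rewrite (on_supp Hxy).
by rewrite (@on_supp (bar H) x (neg y)) // on_bar negK.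
Qed.

Lemma same_supp H H' : supp H = supp H' -> H' = H \/ H' = bar H.
Proof.
have [x [y Hxy]] := on_any H; have xy := on_ne Hxy => E.
have /supp_on H'x : x.1 \in supp H' by rewrite -E (on_supp1 Hxy).
have : (pt x (rH H')).1 \in supp H.
  by rewrite E (on_supp1 (y := x)) // on_sym.
rewrite (on_supp Hxy) !inE => /orP[/eqP E1|/eqP/esym/same_pt[] E1].
- by have := on_ne H'x; rewrite E1 eqxx.
- by left; apply: on_inj Hxy; rewrite -E1.
- by right; apply: on_inj H'x _; rewrite on_bar E1 negK.
Qed.

(* Written as a sum mod 2 to be bilinear in the supports; for distinct
   hyperplanes it is the negation of transversality. *)
Definition ip H H' : bool :=
  \big[addb/false]_i ((i \in supp H) && (i \in supp H')).

Lemma ipE H H' : ip H H' = odd #|supp H :&: supp H'|.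
Proof.
rewrite -sum1_card (big_morph odd oddD (erefl _)) big_mkcond /=.
by apply: eq_bigr => i _; rewrite in_setI; case: (_ && _).
Qed.

Lemma ip_sym H H' : ip H H' = ip H' H.
Proof. by apply: eq_bigr => i _; rewrite andbC. Qed.

Lemma ip_bar H H' : ip H (bar H') = ip H H'.
Proof. by rewrite /ip supp_bar. Qed.

Lemma ip_barl H H' : ip (bar H) H' = ip H H'.
Proof. by rewrite ip_sym ip_bar ip_sym. Qed.

Lemma ip_same H H' : supp H = supp H' -> ip H H' = false.
Proof. by rewrite ipE => ->; rewrite setIid card_supp. Qed.

Lemma ipp H : ip H H = false. Proof. exact: ip_same. Qed.

Lemma ip_act w H H' : ip (hact w H) (hact w H') = ip H H'.
Proof.
rewrite /ip [RHS](reindex_inj (@perm_inj _ (wperm one_neqN1 w))).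
by apply: eq_bigr => i _; rewrite !supp_act.
Qed.

Lemma ip_disj H H' : [disjoint supp H & supp H'] -> ip H H' = false.
Proof. by rewrite ipE -setI_eq0 => /eqP->; rewrite cards0. Qed.

(** Two sets of two elements that meet in an even number of elements are disjoint or equal. *)
Lemma ip0P H H' : ip H H' = false ->
  [\/ [disjoint supp H & supp H'], H' = H | H' = bar H].
Proof.
move=> ip0; have [dj|] := boolP [disjoint supp H & supp H']; first by apply: Or31.
rewrite -setI_eq0 -card_gt0 => c0; move: ip0; rewrite ipE.
have c2 : (#|supp H :&: supp H'| <= 2)%N.
  by rewrite -(card_supp H) subset_leq_card ?subsetIl.
move=> o0; have {o0}/eqP c2' : #|supp H :&: supp H'| == 2%N.
  by case: #|_| o0 c0 c2 => [|[|[|]]].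
have EH : supp H :&: supp H' = supp H.
  by apply/eqP; rewrite eqEcard subsetIl card_supp c2'.
have EH' : supp H :&: supp H' = supp H'.
  by apply/eqP; rewrite eqEcard subsetIr card_supp c2'.
by have [->|->] := same_supp (etrans (esym EH) EH'); [apply: Or32|apply: Or33].
Qed.

Lemma ip1P H H' : ip H H' ->
  exists x y y', [/\ on H x y, on H' x y' & y.1 != y'.1].
Proof.
rewrite ipE => o1; have : supp H :&: supp H' != set0.
  by apply: contraTneq o1 => ->; rewrite cards0.
case/set0Pn=> i; rewrite inE => /andP[/(@supp_on _ (i, false)) H1 /(@supp_on _ (i, false)) H2].
do 3!eexists; split; [exact: H1|exact: H2|].
apply: contraL o1 => /eqP E; rewrite (on_supp H1) (on_supp H2) E setIid cards2.
by have := on_ne H2 => /= ->.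
Qed.

Lemma ip0_act H H' : ip H H' = false -> hact (rH H) H' = H'.
Proof.
have [x [y Hxy]] := on_any H; have xy := on_ne Hxy.
case/ip0P=> [dj|->|->]; apply/esym/on_eq => u v.
- move=> Huv; have Hvu : on H' v u by rewrite on_sym.
  by rewrite on_act !pt_notin // ?(disjointFl dj (on_supp1 Huv)) ?(disjointFl dj (on_supp1 Hvu)).
- move=> Huv; rewrite on_act (on_r Huv) tspL ?tspR ?(on_ne Huv) //.
  by rewrite on_sym.
move=> Huv; have := Huv; rewrite on_act on_bar => Hu; have uv := on_ne Huv.
rewrite (on_r Hu) tspL //; have -> : pt v (tsp u (neg v)) = neg u.
  by rewrite -{1}[v]negK pt_neg tspR.
by rewrite on_neg on_sym.
Qed.

(** For a common point [x], both sides are the hyperplane through the two remaining points [y] and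
    [y']. *)
Lemma ip1_act H H' : ip H H' -> hact (rH H) H' = hact (rH H') H.
Proof.
case/ip1P=> x [y [y' [Hxy Hxy' yy']]]; have xy := on_ne Hxy; have xy' := on_ne Hxy'.
have H1 : on (hact (rH H) H') y y'.
  rewrite on_act (on_r Hxy) tspR // tspD // eq_sym //.
apply: on_inj H1 _; have yx : y.1 != x.1 by rewrite eq_sym.
by rewrite on_act (on_r Hxy') tspR // tspD // on_sym.
Qed.

Lemma supp_ip1 H H' i : ip H H' ->
  (i \in supp (hact (rH H) H')) = (i \in supp H) (+) (i \in supp H').
Proof.
case/ip1P=> x [y [y' [Hxy Hxy' yy']]]; have xy := on_ne Hxy; have xy' := on_ne Hxy'.
have H1 : on (hact (rH H) H') y y'.
  rewrite on_act (on_r Hxy) tspR // tspD // eq_sym //.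
rewrite (on_supp H1) (on_supp Hxy) (on_supp Hxy') !inE.
have [->|ix] := eqVneq i x.1; first by rewrite (negPf xy) (negPf xy').
by have [->|iy] := eqVneq i y.1; rewrite //= (negPf yy').
Qed.

(** Supports behave as vectors over the field with two elements: the third hyperplane of a
    non-transverse pair has the sum of the two supports. Most later transversality checks reduce to
    this bilinearity. *)
Lemma ip_ip1 H H' H'' : ip H H' ->
  ip (hact (rH H) H') H'' = ip H H'' (+) ip H' H''.
Proof.
move=> HH'; rewrite /ip -big_split; apply: eq_bigr => i _ /=.
by rewrite supp_ip1 // andb_addl.
Qed.

(** The test vector is [vec2 C u y] with [y] the partner of [u] in [H1]. It lies in [H1], and in
    [H2] because its coordinates vanish there; membership in [H] forces the partner [v] to be
    [y]. *)
Lemma cap_hsp H1 H2 H u v : [disjoint supp H1 & supp H2] ->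
    (forall z, z \in hsp H1 -> z \in hsp H2 -> z \in hsp H) ->
  on H u v -> u.1 \in supp H1 -> H = H1.
Proof.
move=> dj sub Huv uH1; have H1u := supp_on uH1; set y := pt u _ in H1u.
have := sub (vec2 C u y); case/onP: (H1u) => uy ->; case/onP: (Huv) => uv HE.
have [x' [y' H2xy]] := on_any H2; case/onP: (H2xy) => _ ->.
have yH1 : y.1 \in supp H1 by rewrite (on_supp1 (y := u)) // on_sym.
have x'N : x'.1 \notin supp H1 by rewrite (disjointFl dj (on_supp1 H2xy)).
have y'N : y'.1 \notin supp H1 by rewrite (disjointFl dj (on_supp1 (y := x') _)) // on_sym.
have out (t s : sp) : t.1 \notin supp H1 -> s.1 \in supp H1 -> t.1 != s.1.
  by move=> tN sH; apply: contraNneq tN => ->.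
have zcN t : t.1 \notin supp H1 -> zc (vec2 C u y) t = 0.
  move=> tN; rewrite /vec2 zcD !zc_dvec.
  have [-> -> _ _] := pair1_neq (out t u tN uH1).
  by have [-> -> _ _] := pair1_neq (out t y tN yH1); rewrite !subrr addr0.
have uvec : zc (vec2 C u y) u = 1.
  rewrite /vec2 zcD !zc_dvec eqxx [u == neg u]eq_sym neg_neq.
  by have [-> -> _ _] := pair1_neq uy; rewrite subrr subr0 addr0.
rewrite (vec2_in _ uy) HE !mem_Hpt (zcN _ x'N) (zcN _ y'N) eqxx uvec => /(_ isT isT).
rewrite /vec2 zcD !zc_dvec; have [_ _ -> ->] := pair1_neq uv; rewrite subrr add0r.
have [vy _|_] := eqVneq v y; first by apply: on_inj Huv _; rewrite vy.
have [_|_] := eqVneq v (neg y); first by rewrite sub0r (negPf one_neqN1).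
by rewrite subrr oner_eq0.
Qed.

(** If the supports share one index, the third hyperplane through the two other points contains the
    intersection. Otherwise test vectors supported on one side leave room for [H1] and [H2] only. *)
Lemma transverseE H1 H2 : transverse H1 H2 = (H1 != H2) && ~~ ip H1 H2.
Proof.
rewrite /transverse; case: eqP => //= H12; apply/forallP/idP => [tr|/negPf ip0 H].
  apply/negP=> ip12; have [x [y [y' [Hxy Hxy' yy']]]] := ip1P ip12.
  have H3 : on (hact (rH H1) H2) y y'.
    rewrite on_act (on_r Hxy) tspR ?(on_ne Hxy) // tspD // 1?eq_sym //.
    exact: on_ne Hxy'.
  have /implyP/(_ _)/orP[] := tr (hact (rH H1) H2).
  - apply/subvP=> z; rewrite memv_cap.
    case/onP: (Hxy) => _ ->; case/onP: (Hxy') => _ ->; case/onP: (H3) => _ ->.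
    by rewrite !mem_Hpt => /andP[/eqP<-].
  - move/eqP=> E; have := ip_act (rH H1) H2 H1; rewrite E.
    by rewrite -{1}(ip0_act (ipp H1)) ip_act ipp ip_sym ip12.
  by move/eqP=> E; have := ip_ip1 H2 ip12; rewrite E !ipp ip12.
apply/implyP=> /subvP sub.
have {}sub z : z \in hsp H1 -> z \in hsp H2 -> z \in hsp H.
  by move=> z1 z2; apply: sub; rewrite memv_cap z1.
have [u [v Huv]] := on_any H; have Hvu : on H v u by rewrite on_sym.
(* A basis vector at an index outside both supports lies in both hyperplanes, but not in a
   hyperplane having this index in its support. *)
have in_supp (u' v' : sp) : on H u' v' -> (u'.1 \in supp H1) || (u'.1 \in supp H2).
  move=> Huv'; apply: contraT; rewrite negb_or => /andP[n1 n2].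
  have dvecH H' : u'.1 \notin supp H' -> dvec C u' \in hsp H'.
    have [x [y Hxy]] := on_any H'; rewrite (on_supp Hxy) !inE negb_or => /andP[ux uy].
    by case/onP: Hxy => _ ->; apply: dvec_in.
  have := sub _ (dvecH _ n1) (dvecH _ n2); case/onP: Huv' => uv ->.
  rewrite mem_Hpt !zc_dvec eqxx [u' == neg u']eq_sym neg_neq.
  by have [_ _ -> ->] := pair1_neq uv; rewrite subr0 subrr oner_eq0.
case: (ip0P ip0) => [dj|E|E]; last 2 first.
- by rewrite E in H12.
- have EH : supp H1 = supp H.
    apply/esym/eqP; rewrite eqEcard !card_supp leqnn andbT (on_supp Huv).
    apply/subsetP=> i; rewrite in_set2 => /orP[]/eqP->.
    + by have := in_supp _ _ Huv; rewrite E supp_bar orbb.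
    + by have := in_supp _ _ Hvu; rewrite E supp_bar orbb.
  by case: (same_supp EH) => ->; rewrite ?E eqxx ?orbT.
case/orP: (in_supp _ _ Huv) => uS.
  by rewrite (cap_hsp dj sub Huv uS) eqxx.
rewrite disjoint_sym in dj; rewrite (cap_hsp dj _ Huv uS) ?eqxx ?orbT //.
by move=> z z2 z1; apply: sub.
Qed.

(** The sign change at the two indices of the support. *)
Definition zH H : W := (rH H * rH (bar H))%g.

Lemma pt_zH H x : pt x (zH H) = if x.1 \in supp H then neg x else x.
Proof.
rewrite /zH ptM; case: ifPn => xH; last by rewrite !pt_notin ?supp_bar.
have H1 := supp_on xH; set y := pt x _ in H1 *.
have : on (bar H) y (neg x) by rewrite on_bar negK on_sym.
by case/andP=> _ /eqP.
Qed.

Lemma zHC H : zH H = (rH (bar H) * rH H)%g.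
Proof.
apply: pt_eq one_neqN1 _ _ _ => x; rewrite pt_zH.
by rewrite -{1}(supp_bar H) -pt_zH /zH barK.
Qed.

(** A sign change turns [H'] into [bar H'] exactly when it affects one of the two indices of [H']
    and not the other. *)
Lemma zH_act H H' : hact (zH H) H' = if ip H H' then bar H' else H'.
Proof.
rewrite zHC hactM; case: ifPn => [HH'|/negPf ip0]; last by rewrite !ip0_act ?ip_barl.
rewrite (_ : hact (rH H) H' = hact (rH (bar H)) (bar H')).
  by rewrite -hactM rHK hact1.
by rewrite bar_act [in RHS]ip1_act ?ip_barl // bar_act barK ip1_act.
Qed.
End Hyperplanes.

(** * Closed collections and the groups K_B *)

Section Collections.
Variables (C : fieldType) (n : nat).
Hypothesis one_neqN1 : (1 : C) != -1.
Local Notation W := (G22 C n).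
Local Notation rep := (G22_rep C n).
Local Notation hyper := (hyper rep).
Local Notation rH := (rH one_neqN1).
Local Notation supp := (supp one_neqN1).
Local Notation bar := (bar one_neqN1).
Local Notation ip := (ip one_neqN1).
Local Notation zH := (zH one_neqN1).
Implicit Types (w g s : W) (H : hyper) (B D : {set hyper}).

(* For non-transverse H1 and H0, the unique reflection exchanging them. *)
Definition th H1 H0 : W := rH (hact (rH H1) H0).

Lemma thE H1 H0 : th H1 H0 = (rH H1 * rH H0 * rH H1)%g.
Proof. by rewrite /th rHJ rHV. Qed.

Lemma thV H1 H0 : ((th H1 H0)^-1)%g = th H1 H0. Proof. exact: rHV. Qed.

Lemma th_refl H1 H0 : th H1 H0 \in refls rep. Proof. exact: rH_refl. Qed.

Lemma th_act H1 H0 : ip H1 H0 -> hact (th H1 H0) H1 = H0.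
Proof.
move=> ip10; rewrite thE !hactM (ip0_act (ipp _ _)).
by rewrite -(ip1_act ip10) -hactM rHK hact1.
Qed.

Lemma th_actV H1 H0 : ip H1 H0 -> hact (th H1 H0) H0 = H1.
Proof. by move=> ip10; rewrite -[X in hact _ X](th_act ip10) -hactM rHK hact1. Qed.

(** The hyperplane of a reflection that moves [H1] to [H0] is the third one of a non-transverse
    triple, hence determined by the other two. This reduces the sum in (B5) to one term. *)
Lemma refl_th H1 H0 s : s \in refls rep -> hact s H1 = H0 -> H0 != H1 ->
  ip H1 H0 /\ s = th H1 H0.
Proof.
move=> /(refl_rH one_neqN1)[H ->] HE H01.
have ip1 : ip H H1.
  by apply: contraT => /negPf ip0; rewrite -HE ip0_act // eqxx in H01.
rewrite (ip1_act ip1) in HE; split.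
  by rewrite ip_sym -HE ip_ip1 ?ipp // ip_sym.
by rewrite /th -HE -hactM rHK hact1.
Qed.

Lemma refls_toE H1 H0 : H0 != H1 ->
  refls_to H1 H0 = if ip H1 H0 then [set th H1 H0] else set0.
Proof.
move=> H01; apply/setP=> s; rewrite inE; apply/andP/idP.
  by case=> sr /eqP sH; have [-> ->] := refl_th sr sH H01; rewrite set11.
case: ifP => [ip1|]; rewrite inE // => /eqP->.
by rewrite th_refl th_act.
Qed.

Definition ipfree B : bool := [forall H in B, forall H' in B, ~~ ip H H'].
Definition compat H B : bool := [forall H' in B, ~~ ip H H'].
Definition has_bar B : bool := [exists H in B, bar H \in B].
Definition bar_closed B : bool := has_bar B ==> [forall H in B, bar H \in B].
Definition closed_coll B : bool := ipfree B && bar_closed B.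
Definition cl B : {set hyper} := if has_bar B then B :|: bar @: B else B.

Lemma ipfreeP B : reflect {in B &, forall H H', ip H H' = false} (ipfree B).
Proof.
apply: (iffP forall_inP) => [E H H' HB H'B|E H HB].
  by apply: negbTE; move/forall_inP: (E H HB); apply.
by apply/forall_inP=> H' H'B; rewrite E.
Qed.

Lemma compatP H B : reflect {in B, forall H', ip H H' = false} (compat H B).
Proof.
by apply: (iffP forall_inP) => E H' H'B; [apply/negbTE/E|rewrite E].
Qed.

Lemma transverse_collP B : transverse_coll B <-> ipfree B.
Proof.
split=> [tr|/ipfreeP fr H H' HB H'B HH']; last by rewrite transverseE HH' fr.
apply/ipfreeP=> H H' HB H'B; have [->|HH'] := eqVneq H H'; first exact: ipp.
by have := tr H H' HB H'B HH'; rewrite (transverseE one_neqN1) => /andP[_ /negPf].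
Qed.

Lemma has_barP B : reflect (exists2 H, H \in B & bar H \in B) (has_bar B).
Proof. exact: exists_inP. Qed.

Lemma bar_closedP B : reflect (has_bar B -> forall H, H \in B -> bar H \in B) (bar_closed B).
Proof.
apply: (iffP implyP) => [E dB H|E dB]; first by move/forall_inP: (E dB); apply.
by apply/forall_inP; apply: E.
Qed.

Lemma sub_cl B : B \subset cl B.
Proof. by rewrite /cl; case: ifP => // _; apply: subsetUl. Qed.

Lemma cl_id B : bar_closed B -> cl B = B.
Proof.
move/bar_closedP=> E; rewrite /cl; case: ifP => // /E {}E.
by apply/setUidPl/subsetP=> _ /imsetP[H HB ->]; apply: E.
Qed.

Lemma has_bar_sub B D : B \subset D -> has_bar B -> has_bar D.
Proof.
move=> /subsetP BD /has_barP[H HB barH]; apply/has_barP.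
by exists H; apply: BD.
Qed.

Lemma cl_closed B : bar_closed (cl B).
Proof.
apply/bar_closedP; rewrite /cl; case: ifP => [_ _ H|dB]; last by rewrite dB.
rewrite !inE => /orP[HB|/imsetP[H' H'B ->]]; last by rewrite barK H'B.
by rewrite imset_f ?orbT.
Qed.

Lemma cl_sub B D : bar_closed D -> B \subset D -> cl B \subset D.
Proof.
move=> /bar_closedP Dcl BD; rewrite /cl; case: ifP => // dB.
rewrite subUset BD; apply/subsetP=> _ /imsetP[H HB ->].
by apply: Dcl; [apply: has_bar_sub dB|apply: (subsetP BD)].
Qed.

Lemma cl_mono B D : B \subset D -> cl B \subset cl D.
Proof. by move=> BD; apply: cl_sub (cl_closed D) (subset_trans BD (sub_cl D)). Qed.

Lemma cl_add_cl H B : cl (H |: cl B) = cl (H |: B).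
Proof.
apply/eqP; rewrite eqEsubset; apply/andP; split.
  apply: cl_sub (cl_closed _) _; rewrite subUset.
  rewrite (subset_trans _ (sub_cl _)) ?subsetUl //=.
  by apply: cl_mono; apply: subsetUr.
by apply/cl_mono/setUS/sub_cl.
Qed.

Lemma in_cl H B : H \in cl B -> H \in B \/ bar H \in B.
Proof.
rewrite /cl; case: ifP; rewrite ?inE => _; last by left.
by case/orP; [left|case/imsetP=> H' H'B ->; right; rewrite barK].
Qed.

Lemma compat_cl H B : compat H (cl B) = compat H B.
Proof.
apply/compatP/compatP => E H' H'B; first by apply/E/(subsetP (sub_cl B)).
by have [/E|/E] := in_cl H'B; rewrite ?ip_bar.
Qed.

Lemma ipfree_cl B : ipfree (cl B) = ipfree B.
Proof.
apply/idP/idP => /ipfreeP fr; apply/ipfreeP=> H H' HB H'B.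
  by apply: fr; apply: (subsetP (sub_cl B)).
have [h|h] := in_cl HB; have [h'|h'] := in_cl H'B; first exact: fr.
- by rewrite -ip_bar fr.
- by rewrite -ip_barl fr.
by rewrite -ip_bar -ip_barl fr.
Qed.

Lemma ipfree_add H B : ipfree (H |: B) = compat H B && ipfree B.
Proof.
apply/ipfreeP/andP => [E|[/compatP c /ipfreeP fr] H1 H2].
  split; first by apply/compatP => H' H'B; apply: E; rewrite !inE ?eqxx ?H'B ?orbT.
  by apply/ipfreeP=> H1 H2 H1B H2B; apply: E; rewrite !inE ?H1B ?H2B orbT.
rewrite !inE => /orP[/eqP->|H1B] /orP[/eqP->|H2B]; rewrite ?ipp ?c //.
  by rewrite ip_sym c.
exact: fr.
Qed.

Definition join H B : {set hyper} := cl (H |: B).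

Lemma join_closed H B : closed_coll B -> compat H B -> closed_coll (join H B).
Proof.
case/andP=> fr _ c; rewrite /closed_coll cl_closed andbT.
by rewrite /join ipfree_cl ipfree_add c.
Qed.

Lemma sub_join H B : B \subset join H B.
Proof. exact: subset_trans (subsetUr _ _) (sub_cl _). Qed.

Lemma in_join H B : H \in join H B.
Proof. by apply: (subsetP (sub_cl _)); rewrite setU11. Qed.

Lemma join_id H B : closed_coll B -> H \in B -> join H B = B.
Proof. by case/andP=> _ cB HB; rewrite /join (setUidPr _) ?sub1set ?cl_id. Qed.

Lemma joinC H1 H2 B : join H1 (join H2 B) = join H2 (join H1 B).
Proof. by rewrite /join !cl_add_cl setUCA. Qed.

Lemma compat_join H1 H2 B : compat H1 (join H2 B) = ~~ ip H1 H2 && compat H1 B.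
Proof.
rewrite /join compat_cl; apply/compatP/andP => [E|[/negPf i12 /compatP c] H].
  split; first by rewrite E // setU11.
  by apply/compatP=> H HB; apply: E; rewrite !inE HB orbT.
by rewrite !inE => /orP[/eqP->|/c].
Qed.

Lemma in_cact w H B : (H \in cact w B) = (hact w^-1%g H \in B).
Proof.
apply/imsetP/idP => [[H' H'B ->]|HB]; first by rewrite -hactM mulVg hact1.
by exists (hact w^-1%g H); rewrite // -hactM mulgV hact1.
Qed.

Lemma mem_cact w H B : (hact w H \in cact w B) = (H \in B).
Proof. by rewrite in_cact -hactM mulVg hact1. Qed.

Lemma hact_inj w : injective (@hact _ _ _ rep w).
Proof. by move=> H H' E; rewrite -[H](hact1 (rho := rep)) -(mulVg w) hactM E -hactM mulVg hact1. Qed.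

Lemma card_cact w B : #|cact w B| = #|B|.
Proof. by rewrite /cact card_imset //; apply: hact_inj. Qed.

Lemma ipfree_act w B : ipfree (cact w B) = ipfree B.
Proof.
apply/ipfreeP/ipfreeP => fr H H'.
  by rewrite -!(mem_cact w _ B) -(ip_act one_neqN1 w); apply: fr.
by rewrite !in_cact => HB H'B; rewrite -(ip_act one_neqN1 w^-1%g); apply: fr.
Qed.

Lemma compat_act w H B : compat (hact w H) (cact w B) = compat H B.
Proof.
apply/compatP/compatP => fr H'.
  by rewrite -(mem_cact w) -(ip_act one_neqN1 w); apply: fr.
by rewrite in_cact => H'B; rewrite -(ip_act one_neqN1 w^-1%g) -hactM mulVg hact1; apply: fr.
Qed.

Lemma has_bar_act w B : has_bar (cact w B) = has_bar B.
Proof.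
apply/has_barP/has_barP => -[H HB barH].
  by exists (hact w^-1%g H); rewrite -?in_cact // -bar_act -in_cact.
by exists (hact w H); rewrite ?mem_cact // -bar_act mem_cact.
Qed.

Lemma cl_act w B : cl (cact w B) = cact w (cl B).
Proof.
rewrite /cl has_bar_act; case: ifP => // _; rewrite /cact imsetU -!imset_comp.
by congr (_ :|: _); apply: eq_imset => H /=; rewrite bar_act.
Qed.

Lemma bar_closed_act w B : bar_closed (cact w B) = bar_closed B.
Proof.
rewrite /bar_closed has_bar_act; congr (_ ==> _); apply/forall_inP/forall_inP => E H.
  by rewrite -(mem_cact w) => /E; rewrite -bar_act mem_cact.
by rewrite !in_cact => /E; rewrite bar_act.
Qed.

Lemma closed_act w B : closed_coll (cact w B) = closed_coll B.
Proof. by rewrite /closed_coll ipfree_act bar_closed_act. Qed.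

Lemma join_act w H B : join (hact w H) (cact w B) = cact w (join H B).
Proof. by rewrite /join -cl_act /cact imsetU1. Qed.

Lemma set0_closed : closed_coll set0.
Proof.
apply/andP; split; first by apply/ipfreeP=> H H'; rewrite inE.
by apply/bar_closedP=> /has_barP[H]; rewrite inE.
Qed.

(** * Generators of K_B *)

Lemma KB_gensP B g : reflect
  ((exists2 H, H \in B & g = rH H) \/
   exists s1 s2, [/\ s1 \in refls rep, s2 \in refls rep, cact s1 B = cact s2 B,
      cact s1 B != B & (forall H, H \in B -> H \notin cact s1 B -> hact s1 H != hact s2 H)
      /\ g = (s2^-1 * s1)%g]) (g \in KB_gens B).
Proof.
rewrite inE; apply: (iffP orP) => -[].
- rewrite inE => /andP[/(refl_rH one_neqN1)[H ->] /exists_inP[H' H'B /eqP]].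
  by rewrite fixsp_rH => /hsp_inj <-; left; exists H'.
- case/imset2P=> s1 s2 s1r; rewrite inE => /andP[s2r /and3P[/eqP E1 E2 /forall_inP E3]] ->.
  by right; exists s1, s2; split=> //; split=> // H HB HN; apply: E3; rewrite inE HN.
- case=> H HB ->; left; rewrite inE rH_refl; apply/exists_inP; exists H => //.
  by rewrite fixsp_rH.
case=> s1 [s2 [s1r s2r E1 E2 [E3 ->]]]; right; apply/imset2P.
exists s1 s2 => //; rewrite inE s2r E2 E1 eqxx /=; apply/forall_inP=> H.
by rewrite inE => /andP[HN HB]; apply: E3; rewrite // E1.
Qed.

Lemma rH_KB H B : H \in B -> rH H \in KB B.
Proof. by move=> HB; apply/mem_gen/KB_gensP; left; exists H. Qed.

(** Some [H0] in the common image lies outside [B]. It is the image of an [H1] under [s1] and of an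
    [H2] under [s2], and [refl_th] recovers both reflections from these hyperplanes. *)
Lemma KB_gens_th B s1 s2 : s1 \in refls rep -> s2 \in refls rep ->
    cact s1 B = cact s2 B -> cact s1 B != B ->
  exists H1 H2 H0, [/\ H1 \in B, H2 \in B, H0 \notin B, ip H1 H0 /\ ip H2 H0
                     & s1 = th H1 H0 /\ s2 = th H2 H0].
Proof.
move=> s1r s2r E1 E2; have /subsetPn[H0 H0s H0B] : ~~ (cact s1 B \subset B).
  by apply: contra E2; rewrite eqEcard card_cact leqnn andbT.
have /imsetP[H1 H1B H1E] := H0s; move: H0s; rewrite E1 => /imsetP[H2 H2B H2E].
have n1 : H0 != H1 by apply: contraNneq H0B => ->.
have n2 : H0 != H2 by apply: contraNneq H0B => ->.
have [ip1 s1E] := refl_th s1r (esym H1E) n1.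
have [ip2 s2E] := refl_th s2r (esym H2E) n2.
by exists H1, H2, H0.
Qed.

(** This converts the side condition on the generators: s1 H = s2 H means that [g] fixes H, and then
    the last hypothesis gives s1 H = H, so that H lies in s1 B. *)
Lemma KB_th_aux B H1 H2 H0 : H1 \in B -> ip H1 H0 -> ip H2 H0 -> ipfree B ->
    let g := (th H2 H0 * th H1 H0)%g in
    (forall H, H \in B -> hact g H \in B) ->
    (forall H, H \in B -> hact g H = H -> hact (th H1 H0) H = H) ->
  g \in KB B.
Proof.
move=> H1B ip1 ip2 /ipfreeP fr g gB gfix; apply/mem_gen/KB_gensP; right.
exists (th H1 H0), (th H2 H0); split; rewrite ?th_refl //; last 1 first.
- split=> [H HB|]; last by rewrite thV.
  apply: contraNneq => E; rewrite -[X in X \in _](gfix H HB) ?mem_cact //.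
  by rewrite /g hactM E -hactM rHK hact1.
- have gBB : cact g B = B.
    apply/eqP; rewrite eqEcard card_cact leqnn andbT.
    by apply/subsetP=> _ /imsetP[H HB ->]; apply: gB.
  by rewrite -{2}gBB -cactM /g mulgA rHK mul1g.
apply/eqP=> E; have : H0 \in B by rewrite -E -[X in X \in _](th_act ip1) mem_cact.
by move=> H0B; rewrite fr in ip1.
Qed.

Lemma ip_supp_sub H1 H2 H0 i : [disjoint supp H1 & supp H2] -> ip H0 H1 -> ip H0 H2 ->
  i \in supp H0 -> (i \in supp H1) || (i \in supp H2).
Proof.
move=> d12 i1 i2 i0; apply: contraT; rewrite negb_or => /andP[n1 n2].
have pos K : ip H0 K -> (0 < #|supp H0 :&: supp K|)%N.
  by rewrite ipE lt0n; apply: contraTneq => ->.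
have : (#|(supp H0 :&: supp H1) :|: (supp H0 :&: supp H2)| <= #|supp H0 :\ i|)%N.
  apply/subset_leq_card/subsetP=> j; rewrite !in_setU !in_setI in_setD1.
  by case/orP=> /andP[-> jH]; rewrite andbT; apply: contraTneq jH => ->.
rewrite cardsU -setIIr (_ : supp H1 :&: supp H2 = set0) ?setI0; last first.
  by apply/eqP; rewrite setI_eq0.
rewrite cards0 subn0; have := cardsD1 i (supp H0); rewrite i0 card_supp add1n => -[<-].
by move: (pos _ i1) (pos _ i2); case: #|_| => // a; case: #|_| => // b _ _; rewrite addnS.
Qed.

Lemma ip_two H0 H1 H2 H : [disjoint supp H1 & supp H2] ->
    [disjoint supp H1 & supp H] -> [disjoint supp H2 & supp H] ->
  ip H0 H1 -> ip H0 H2 -> ip H0 H = false.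
Proof.
move=> d12 d1 d2 i1 i2; apply: ip_disj; rewrite disjoint_sym.
apply/pred0P=> i /=; apply/negP=> /andP[iH i0].
by case/orP: (ip_supp_sub d12 i1 i2 i0); rewrite ?(disjointFl d1) ?(disjointFl d2).
Qed.

Lemma th_bar H1 H0 : ip H1 H0 -> th (bar H1) H0 = rH (bar (hact (rH H1) H0)).
Proof. by move=> ip1; rewrite /th ip1_act ?ip_barl // bar_act (ip1_act ip1). Qed.

Lemma rHM H1 H2 : ip H1 H2 = false -> (rH H1 * rH H2)%g = (rH H2 * rH H1)%g.
Proof.
by move=> /(ip0_act) E; rewrite -{2}E rHJ rHV -mulgA rHK mulg1.
Qed.

Lemma th_cross H1 H2 H0 : ip H1 H0 -> ip H2 H0 -> ip H1 H2 = false ->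
  hact (th H1 H0) H2 = hact (th H2 H0) H1.
Proof.
move=> ip1 ip2 ip12; have ip21 : ip H2 H1 = false by rewrite ip_sym.
rewrite !thE !hactM (ip0_act ip12) (ip0_act ip21).
rewrite -(ip1_act ip1) -(ip1_act ip2) -!hactM (rHM ip12) //.
Qed.

(* The action of e_H0 on states does not depend on the hyperplane of B, not
   transverse to H0, that defines it. *)
Lemma KB_th B H1 H2 H0 : closed_coll B -> H1 \in B -> H2 \in B ->
  ip H1 H0 -> ip H2 H0 -> ((th H2 H0)^-1 * th H1 H0)%g \in KB B.
Proof.
case/andP=> fr /bar_closedP clB H1B H2B ip1 ip2; rewrite thV.
have [->|H12] := eqVneq H2 H1; first by rewrite rHK group1.
have /ipfreeP frB := fr; case: (ip0P (frB _ _ H1B H2B)) => [d12|E|E].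
- have dbl : has_bar B -> bar H1 \in B /\ bar H2 \in B by move=> dB; rewrite !clB.
  (* The product exchanges [H1] and [H2], hence also their bars, and both reflections fix every
     member whose support is disjoint from both. *)
  have g1 : hact (th H2 H0 * th H1 H0)%g H1 = H2.
    by rewrite hactM th_act // th_actV.
  have g2 : hact (th H2 H0 * th H1 H0)%g H2 = H1.
    by rewrite hactM (th_cross ip1 ip2) ?frB // -hactM rHK hact1.
  have gD H : H \in B -> [disjoint supp H1 & supp H] -> [disjoint supp H2 & supp H] ->
      hact (th H1 H0) H = H /\ hact (th H2 H0) H = H.
    move=> HB d1 d2; have ipH : ip H0 H = false.
      by apply: (ip_two d12 d1 d2); rewrite ip_sym.
    by split; rewrite ip0_act // ip_ip1 // ip_disj.
  apply: KB_th_aux => // H HB.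
    case: (ip0P (frB _ _ H1B HB)) => [d1|->|E]; rewrite ?g1 //.
      case: (ip0P (frB _ _ H2B HB)) => [d2|->|E]; rewrite ?g2 //.
        by have [E1 E2] := gD H HB d1 d2; rewrite hactM E1 E2.
      rewrite E bar_act g2; apply: clB H1B; apply/has_barP; exists H2; rewrite -?E //.
    rewrite E bar_act g1; apply: clB H2B; apply/has_barP; exists H1; rewrite -?E //.
  case: (ip0P (frB _ _ H1B HB)) => [d1|->|->]; last 2 first.
  + by rewrite g1 => E; rewrite E eqxx in H12.
  + by rewrite bar_act g1 => /bar_inj E; rewrite E eqxx in H12.
  case: (ip0P (frB _ _ H2B HB)) => [d2|->|->].
  + by have [E1 _] := gD H HB d1 d2.
  + by rewrite g2 => E; rewrite E eqxx in H12.
  + by rewrite bar_act g2 => /bar_inj E; rewrite E eqxx in H12.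
- by rewrite E eqxx in H12.
(* The two reflections belong to a hyperplane and its bar, so the product is a sign change. It maps
   each member H to H or [bar H], and both lie in [B] because [B] is closed and contains a pair. *)
have gE : (th H2 H0 * th H1 H0)%g = zH (hact (rH H1) H0) by rewrite E th_bar // zHC.
apply: KB_th_aux => // H HB; rewrite gE zH_act; case: ifP => // ipH.
  by apply: clB HB; apply/has_barP; exists H1; rewrite -?E.
  by move=> /eqP; rewrite (negPf (bar_neq _ H)).
by move=> _; rewrite ip0_act.
Qed.

Lemma KB_sub_stab B : ipfree B -> KB B \subset stab B.
Proof.
move/ipfreeP=> fr; rewrite gen_subG; apply/subsetP=> g /KB_gensP[[H HB ->]|].
  rewrite inE eqEcard card_cact leqnn andbT.
  by apply/subsetP=> _ /imsetP[H' H'B ->]; rewrite ip0_act ?fr.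
case=> s1 [s2 [_ _ E _ [_ ->]]].
by rewrite inE cactM E -cactM mulVg cact1.
Qed.

(** The condition s1 B = s2 B need not survive the passage to [D]. The generators are therefore
    rewritten as products of two [th], which [KB_th] accepts for [D] as well. *)
Lemma KB_mono B D : closed_coll B -> closed_coll D -> B \subset D ->
  KB B \subset KB D.
Proof.
move=> clB clD /subsetP BD; rewrite gen_subG; apply/subsetP=> g /KB_gensP[[H HB ->]|].
  exact/rH_KB/BD.
case=> s1 [s2 [s1r s2r E1 E2 [_ ->]]].
have [H1 [H2 [H0 [H1B H2B _ [ip1 ip2] [-> ->]]]]] := KB_gens_th s1r s2r E1 E2.
by apply: KB_th; rewrite ?BD.
Qed.

Lemma KB_gens_conj w B g :
  g \in KB_gens B -> (w * g * w^-1)%g \in KB_gens (cact w B).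
Proof.
case/KB_gensP=> [[H HB ->]|[s1 [s2 [s1r s2r E1 E2 [E3 ->]]]]]; apply/KB_gensP.
  by left; exists (hact w H); rewrite ?mem_cact ?rHJ.
have conj_act s D : cact (w * s * w^-1)%g (cact w D) = cact w (cact s D).
  by rewrite -!cactM -!mulgA mulVg mulg1.
have conj_hact s H : hact (w * s * w^-1)%g (hact w H) = hact w (hact s H).
  by rewrite -!hactM -!mulgA mulVg mulg1.
have conj_refl s : s \in refls rep -> (w * s * w^-1)%g \in refls rep.
  by move=> sr; rewrite -(refls_conj rep w) conjgE !mulgA mulVg mul1g mulgKV.
have cact_inj : injective (@cact _ _ _ rep w) by apply/imset_inj/hact_inj.
right; exists (w * s1 * w^-1)%g, (w * s2 * w^-1)%g.
split; rewrite ?conj_refl ?conj_act ?E1 //; first by rewrite -E1 (inj_eq cact_inj).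
split; last by rewrite !invMg invgK !mulgA mulgKV.
move=> H; have -> : H = hact w (hact w^-1%g H) by rewrite -hactM mulgV hact1.
move: (hact _ H) => {}H; rewrite !mem_cact !conj_hact (inj_eq (@hact_inj w)) -E1.
exact: E3.
Qed.

Lemma KB_conj w B k : k \in KB B -> (w * k * w^-1)%g \in KB (cact w B).
Proof.
move=> kB; have : (k ^ w^-1)%g \in <<KB_gens B :^ w^-1>>%g.
  by rewrite genJ memJ_conjg.
rewrite conjgE invgK mulgA; apply/subsetP; rewrite gen_subG.
apply/subsetP=> _ /imsetP[g gB ->]; rewrite conjgE invgK mulgA.
exact/mem_gen/KB_gens_conj.
Qed.
End Collections.

(** * The action on states *)

Section StateModule.
Variables (C : fieldType) (n : nat).
Hypothesis one_neqN1 : (1 : C) != -1.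
Local Notation W := (G22 C n).
Local Notation rep := (G22_rep C n).
Local Notation hyper := (hyper rep).
Local Notation rH := (rH one_neqN1).
Local Notation ip := (ip one_neqN1).
Local Notation th := (th one_neqN1).
Local Notation compat := (compat one_neqN1).
Local Notation closed_coll := (closed_coll one_neqN1).
Local Notation join := (join one_neqN1).
Implicit Types (w k : W) (H : hyper) (B D : {set hyper}) (S : {set W}).

Lemma thC H1 H0 : ip H1 H0 -> th H1 H0 = th H0 H1.
Proof. by move=> ip1; rewrite /th ip1_act. Qed.

Lemma thJ w H1 H0 : th (hact w H1) (hact w H0) = (w * th H1 H0 * w^-1)%g.
Proof. by rewrite /th -rHJ; congr rH; rewrite rHJ -!hactM mulgKV. Qed.

(* The state (B, S) with S = KB B u stands for delta^-|B| e_B u. *)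
Definition is_state (p : {set hyper} * {set W}) : bool :=
  closed_coll p.1 && [forall k in KB p.1, forall u in p.2, (k * u)%g \in p.2].
Definition state : Type := {p | is_state p}.
HB.instance Definition _ := Finite.on state.
Implicit Types (x y : state).

Definition stB x : {set hyper} := (val x).1.
Definition stS x : {set W} := (val x).2.

Lemma stB_closed x : closed_coll (stB x). Proof. by case/andP: (valP x). Qed.

Lemma stSP x k u : k \in KB (stB x) -> u \in stS x -> (k * u)%g \in stS x.
Proof.
by case/andP: (valP x) => _ /forall_inP E kK; move: u; apply/forall_inP/E.
Qed.

Lemma state_eq x y : stB x = stB y -> stS x = stS y -> x = y.
Proof.
move=> E1 E2; apply: val_inj.
by rewrite [val x]surjective_pairing [val y]surjective_pairing; congr pair.
Qed.

Lemma is_stateP B S : closed_coll B ->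
  (forall k u, k \in KB B -> u \in S -> (k * u)%g \in S) -> is_state (B, S).
Proof.
move=> Bcl E; rewrite /is_state Bcl /=; apply/forall_inP=> k kB.
by apply/forall_inP=> u; apply: E.
Qed.

Lemma stW_state w x : is_state (cact w (stB x), (w *: stS x)%g).
Proof.
apply: is_stateP => [|k u]; first by rewrite closed_act stB_closed.
move=> /(KB_conj one_neqN1 w^-1%g); rewrite invgK -cactM mulVg cact1 => kB.
by rewrite !mem_lcoset => /(stSP kB); rewrite !mulgA mulgK.
Qed.

Definition stW w x : state := Sub _ (stW_state w x).

Lemma stB_W w x : stB (stW w x) = cact w (stB x). Proof. by []. Qed.
Lemma stS_W w x : stS (stW w x) = (w *: stS x)%g. Proof. by []. Qed.

Lemma stW1 x : stW 1%g x = x.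
Proof. by apply: state_eq; rewrite ?stB_W ?cact1 // stS_W lcoset1. Qed.

Lemma stWM w v x : stW (w * v)%g x = stW w (stW v x).
Proof. by apply: state_eq; rewrite ?stB_W ?cactM // !stS_W lcosetM. Qed.

Lemma stW_KB k x : k \in KB (stB x) -> stW k x = x.
Proof.
move=> kB; have /KB_sub_stab/subsetP/(_ k kB) : ipfree one_neqN1 (stB x).
  by case/andP: (stB_closed x).
rewrite inE => /eqP kE; apply: state_eq; rewrite // stS_W; apply/setP=> u.
rewrite mem_lcoset; apply/idP/idP => uS; last by rewrite stSP ?groupV.
by rewrite -[u](mulKVg k) stSP.
Qed.

Lemma stJ_state H x : is_state
  (if compat H (stB x) then join H (stB x) else stB x,
   (KB (if compat H (stB x) then join H (stB x) else stB x) * stS x)%g).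
Proof.
apply: is_stateP => [|k u kB /mulsgP[k' u' k'B u'S ->]].
  by case: ifP => c; rewrite ?join_closed // stB_closed.
by rewrite mulgA mem_mulg ?groupM.
Qed.

(** The case distinction makes the target closed for every [H], so that [stJ] is total; [stE] calls
    it for compatible [H]. *)
Definition stJ H x : state := Sub _ (stJ_state H x).

Definition stE H x : state :=
  if [pick H1 in stB x | ip H1 H] is Some H1 then stW (th H1 H) x else stJ H x.

Lemma compat_pick H x : compat H (stB x) ->
  [pick H1 in stB x | ip H1 H] = None.
Proof.
move/compatP=> c; case: pickP => // H1 /andP[/c + ip1].
by rewrite ip_sym ip1.
Qed.

Lemma ip_compatF H H1 B : H1 \in B -> ip H1 H -> compat H B = false.
Proof. by move=> H1B ip1; apply/negP=> /compatP/(_ _ H1B); rewrite ip_sym ip1. Qed.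

Lemma compatFP H B : compat H B = false -> exists2 H1, H1 \in B & ip H1 H.
Proof.
by move/negbT/forall_inPn=> [H1 H1B]; rewrite negbK ip_sym; exists H1.
Qed.

Lemma stB_compat H x : compat H (stB x) -> stB (stE H x) = join H (stB x).
Proof. by move=> c; rewrite /stE compat_pick // /stB /= c. Qed.

Lemma stS_compat H x : compat H (stB x) ->
  stS (stE H x) = (KB (join H (stB x)) * stS x)%g.
Proof. by move=> c; rewrite /stE compat_pick // /stS /= c. Qed.

Lemma stE_ip H1 H x : H1 \in stB x -> ip H1 H -> stE H x = stW (th H1 H) x.
Proof.
move=> H1B ip1; rewrite /stE; case: pickP => [H2 /andP[H2B ip2]|/(_ H1)]; last first.
  by rewrite /= H1B ip1.
rewrite -[LHS]stW1 -(mulgV (th H1 H)) stWM; congr (stW _ _).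
by rewrite -stWM stW_KB // KB_th ?stB_closed.
Qed.

Lemma stE_act w H x : stE (hact w H) (stW w x) = stW w (stE H x).
Proof.
case c: (compat H (stB x)).
  have c' : compat (hact w H) (stB (stW w x)) by rewrite stB_W compat_act.
  apply: state_eq; rewrite ?stB_W ?stS_W ?stB_compat ?stS_compat ?stB_W ?stS_W ?join_act //.
  apply/setP=> u; rewrite mem_lcoset; apply/mulsgP/mulsgP => -[k v kK vS uE].
    exists (w^-1 * k * w)%g (w^-1 * v)%g; rewrite -?mem_lcoset //.
      by have := KB_conj one_neqN1 w^-1%g kK; rewrite invgK -cactM mulVg cact1.
    by rewrite uE !mulgA mulgK.
  exists (w * k * w^-1)%g (w * v)%g; rewrite ?mem_lcoset ?mulKg //.
    exact: KB_conj.
  by rewrite -[u](mulKVg w) uE !mulgA mulgKV.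
have [H1 H1B ip1] := compatFP c.
rewrite (stE_ip H1B ip1) (@stE_ip (hact w H1)) ?stB_W ?mem_cact ?ip_act //.
by rewrite thJ -!stWM mulgKV.
Qed.

Lemma stE_in H x : H \in stB (stE H x).
Proof.
case c: (compat H (stB x)); first by rewrite stB_compat // in_join.
have [H1 H1B ip1] := compatFP c.
by rewrite (stE_ip H1B ip1) stB_W -{1}(th_act ip1) mem_cact.
Qed.

Lemma in_compat H B : ipfree one_neqN1 B -> H \in B -> compat H B.
Proof. by move=> /ipfreeP fr HB; apply/compatP=> H'; apply: fr. Qed.

Lemma stB_compat_in H x : H \in stB x -> compat H (stB x).
Proof. by apply: in_compat; case/andP: (stB_closed x). Qed.

Lemma stE_id H x : H \in stB x -> stE H x = x.
Proof.
move=> HB; have c := stB_compat_in HB.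
have J := join_id (stB_closed x) HB.
apply: state_eq; rewrite ?stB_compat ?stS_compat ?J //.
apply/setP=> u; apply/mulsgP/idP => [[k v kB vS ->]|uS]; first exact: stSP.
by exists 1%g u; rewrite ?group1 ?mul1g.
Qed.

Lemma stE_sub H x : compat H (stB x) -> stB x \subset stB (stE H x).
Proof. by move=> c; rewrite stB_compat // sub_join. Qed.

(** * Scalars, and the defining relations on functions of states *)

Variables (K : fieldType) (a : brscalars rep K).
Local Notation term := (pterm K (brgen rep)).

Definition muH H : K := mu a (rH H).

Lemma muH_act w H : muH (hact w H) = muH H.
Proof.
rewrite /muH rHJ; have -> : (w * rH H * w^-1)%g = (rH H ^ w^-1)%g.
  by rewrite conjgE invgK mulgA.
by rewrite mu_conj // rH_refl.
Qed.

Lemma muH_th H1 H0 : mu a (th H1 H0) = muH H0.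
Proof. by rewrite -[LHS]/(muH _) muH_act. Qed.

Lemma muH_ip H1 H2 : ip H1 H2 -> muH H1 = muH H2.
Proof. by move=> ip12; rewrite -(muH_act (rH H2)) -ip1_act // muH_act. Qed.

Definition stc H x : K := if compat H (stB x) then delta a else muH H.

Lemma stc_act w H x : stc (hact w H) (stW w x) = stc H x.
Proof. by rewrite /stc stB_W compat_act muH_act. Qed.

Lemma stc_ip H1 H x : H1 \in stB x -> ip H1 H -> stc H x = muH H.
Proof. by move=> H1B ip1; rewrite /stc (ip_compatF H1B ip1). Qed.

Lemma stc_in H x : H \in stB x -> stc H x = delta a.
Proof. by move=> HB; rewrite /stc stB_compat_in. Qed.

Lemma th_fix H1 H0 H : ip H1 H0 -> ip H1 H = false -> ip H0 H = false ->
  hact (th H1 H0) H = H.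
Proof. by move=> ip1 i1 i0; rewrite ip0_act // ip_ip1 // i1 i0. Qed.

Definition st_comm H1 H2 x : Prop := stE H1 (stE H2 x) = stE H2 (stE H1 x) /\
  stc H2 x * stc H1 (stE H2 x) = stc H1 x * stc H2 (stE H1 x).

Lemma st_comm_sym H1 H2 x : st_comm H1 H2 x -> st_comm H2 H1 x.
Proof. by case=> E1 E2; split; apply: esym. Qed.

(** The reflection [th H4 H2] fixes [H1], and [H4] is still in the collection after e_H1 has acted.
    So e_H2 acts by this reflection both before and after e_H1. *)
Lemma st_comm_ip1 H1 H2 H4 x : ip H1 H2 = false -> H4 \in stB x ->
  ip H4 H2 -> ip H4 H1 = false -> st_comm H1 H2 x.
Proof.
move=> ip12 H4B ip42 ip41; have ip21 : ip H2 H1 = false by rewrite ip_sym.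
have sH1 : hact (th H4 H2) H1 = H1 by apply: th_fix.
have H4E : H4 \in stB (stE H1 x).
  case c: (compat H1 (stB x)); first exact: (subsetP (stE_sub c)).
  have [H3 H3B ip31] := compatFP c; rewrite (stE_ip H3B ip31) stB_W.
  have /andP[/ipfreeP fr _] := stB_closed x.
  have <- : hact (th H3 H1) H4 = H4 by apply: th_fix; [|apply: fr|rewrite ip_sym].
  by rewrite mem_cact.
split.
  by rewrite (stE_ip H4B ip42) (stE_ip H4E ip42) -{1}sH1 stE_act.
rewrite (stc_ip H4B ip42) (stc_ip H4E ip42) (stE_ip H4B ip42).
by rewrite -{1}sH1 stc_act mulrC.
Qed.

Lemma st_commP H1 H2 x : ip H1 H2 = false -> st_comm H1 H2 x.
Proof.
move=> ip12; have ip21 : ip H2 H1 = false by rewrite ip_sym.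
have /andP[/ipfreeP fr _] := stB_closed x.
have [[H4 [H4B ip42 ip41]]|no1] :=
    pselect (exists H4, [/\ H4 \in stB x, ip H4 H2 & ip H4 H1 = false]).
  exact: st_comm_ip1 ip42 ip41.
have [[H4 [H4B ip41 ip42]]|no2] :=
    pselect (exists H4, [/\ H4 \in stB x, ip H4 H1 & ip H4 H2 = false]).
  by apply/st_comm_sym; apply: st_comm_ip1 ip41 ip42.
(* From here on each member of the collection is transverse to both hyperplanes or to neither. *)
have ip_eq H4 : H4 \in stB x -> ip H4 H1 = ip H4 H2.
  move=> H4B; case i1: (ip H4 H1); case i2: (ip H4 H2) => //.
    by case: no2; exists H4.
  by case: no1; exists H4.
case c1: (compat H1 (stB x)).
  have c2 : compat H2 (stB x).
    apply/compatP=> H HB; rewrite ip_sym -ip_eq // ip_sym.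
    by move/compatP: c1; apply.
  have c12 : compat H1 (stB (stE H2 x)) by rewrite stB_compat // compat_join ip12.
  have c21 : compat H2 (stB (stE H1 x)) by rewrite stB_compat // compat_join ip21.
  split; last by rewrite /stc c1 c2 c12 c21.
  have E J H H' : compat H (stB x) -> compat H' (stB (stE H x)) ->
      J = join H' (join H (stB x)) -> stS (stE H' (stE H x)) = (KB J * stS x)%g.
    move=> c c' JE; rewrite stS_compat // stS_compat // stB_compat // -JE.
    apply/setP=> u; apply/mulsgP/mulsgP => -[k v kJ]; last first.
      move=> vS ->; exists k v => //; apply/mulsgP; exists 1%g v; rewrite ?group1 ?mul1g //.
    case/mulsgP=> k' v' k'J v'S -> ->; exists (k * k')%g v'; rewrite ?mulgA //.
    rewrite groupM //; apply: (subsetP (KB_mono _ _ _)) k'J.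
    + by rewrite join_closed ?stB_closed.
    + rewrite JE join_closed ?join_closed ?stB_closed //.
      by rewrite -stB_compat.
    by rewrite JE sub_join.
  have J12 : join H2 (join H1 (stB x)) = join H1 (join H2 (stB x)) by apply: joinC.
  apply: state_eq; last by rewrite (E _ _ _ c2 c12 J12) (E _ _ _ c1 c21 erefl).
  by rewrite (stB_compat c12) (stB_compat c2) (stB_compat c21) (stB_compat c1) J12.
have [H3 H3B ip31] := compatFP c1; have ip32 : ip H3 H2 by rewrite -ip_eq.
(* Pulling [H1] back along [th H3 H2], or [H2] along [th H3 H1], gives the same [b], and bilinearity
   of [ip] makes [b] compatible with the collection. Both products are thus a reflection applied to
   e_b x. *)
pose b := hact (th H3 H2) H1.
have bE : b = hact (th H3 H1) H2.
  by rewrite /b !(thC ip32, thC ip31) th_cross // ip_sym.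
have ip_g : ip (hact (rH H3) H2) H1 by rewrite ip_ip1 // ip31 ip21.
have cb : compat b (stB x).
  apply/compatP=> H HB; rewrite ip_ip1 // ip_ip1 // fr // [ip H2 _]ip_sym -ip_eq //.
  by rewrite ip_sym addbb.
have sV : hact (th H3 H2) b = H1 by rewrite /b -hactM rHK hact1.
have tV : hact (th H3 H1) b = H2 by rewrite bE -hactM rHK hact1.
pose y := stE b x; have H3y : H3 \in stB y by apply: (subsetP (stE_sub cb)).
have b_in : b \in stB y by apply: stE_in.
have E1 : stE H1 (stE H2 x) = stW (th H3 H2) y.
  by rewrite (stE_ip H3B ip32) -{1}sV stE_act.
have E2 : stE H2 (stE H1 x) = stW (th H3 H1) y.
  by rewrite (stE_ip H3B ip31) -{1}tV stE_act.
have ipb2 : ip b H2.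
  by rewrite /b ip_ip1 // ip12 addbF ip_ip1 // ip32 ipp.
(* The reflection carrying [b] to [H2] is unique. As [H3] and [b] both lie in the collection of [y],
   the reflections [th H3 H2] and [th b H2] agree on [y]. *)
have tE : th H3 H1 = th b H2.
  have [] // := refl_th one_neqN1 (th_refl one_neqN1 H3 H1) tV.
  by apply: contraTneq ipb2 => ->; rewrite ipp.
split; first by rewrite E1 E2 tE -(stE_ip H3y ip32) -(stE_ip b_in ipb2).
rewrite (stc_ip H3B ip32) (stc_ip H3B ip31) (stE_ip H3B ip32) (stE_ip H3B ip31).
rewrite -[X in stc X (stW (th H3 H2) x)]sV -[X in stc X (stW (th H3 H1) x)]tV !stc_act; congr (_ * _).
by rewrite -(muH_ip ip31) (muH_ip ip32).
Qed.

(** Functions are pulled back along the left action on states, hence the reversed order for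
    products. *)
Fixpoint sact (t : term) (f : state -> K) : state -> K :=
  match t with
  | PCst c => fun x => c * f x
  | PGen (GenW w) => fun x => f (stW w x)
  | PGen (GenE H) => fun x => stc H x * f (stE H x)
  | PAdd s t => fun x => sact s f x + sact t f x
  | PMul s t => sact t (sact s f)
  end.

Lemma sact_add t f g x : sact t (fun y => f y + g y) x = sact t f x + sact t g x.
Proof.
elim: t f g x => [c|[w|H]|s IHs t IHt|s IHs t IHt] f g x //=.
- by rewrite mulrDr.
- by rewrite mulrDr.
- by rewrite IHs IHt addrACA.
by rewrite -IHt; congr (sact t _ x); apply/funext=> y; apply: IHs.
Qed.

Lemma sact_scale t c f x : sact t (fun y => c * f y) x = c * sact t f x.
Proof.
elim: t f x => [c'|[w|H]|s IHs t IHt|s IHs t IHt] f x //=.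
- by rewrite mulrCA.
- by rewrite mulrCA.
- by rewrite IHs IHt mulrDr.
by rewrite -IHt; congr (sact t _ x); apply/funext=> y; apply: IHs.
Qed.

Lemma sact_sum (I : finType) (P : pred I) (t : I -> term) f x :
  sact (\big[@PAdd K (brgen rep)/PCst 0]_(i | P i) t i) f x = \sum_(i | P i) sact (t i) f x.
Proof. by elim/big_rec2: _ => [|i y1 y2 _ <-] //=; rewrite mul0r. Qed.

Lemma sact_rel s t : brrel a s t -> forall f, sact s f = sact t f.
Proof.
case=> [|w1 w2|H|w H|w H /(hsp_fix one_neqN1)|H1 H2|H1 H2 H12] /=.
- by move=> f; apply/funext=> x; rewrite stW1 mul1r.
- by move=> f; apply/funext=> x; rewrite stWM.
- move=> f; apply/funext=> x.
  by rewrite (stc_in (stE_in H x)) (stE_id (stE_in H x)).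
- move=> f; apply/funext=> x; rewrite -stE_act -stWM mulgV stW1.
  by rewrite -(stc_act w) -stWM mulgV stW1.
- case=> -> f; apply/funext=> x; first by rewrite stW1.
  by rewrite stW_KB // rH_KB // stE_in.
- rewrite (transverseE one_neqN1) => /andP[_ /negPf ip12] f; apply/funext=> x.
  by case: (st_commP x ip12) => E1 E2; rewrite !mulrA E1 E2.
rewrite (transverseE one_neqN1) H12 /= negbK => ip12 f; apply/funext=> x.
have ip21 : ip H2 H1 by rewrite ip_sym.
rewrite sact_sum refls_toE // ip21 big_set1 /= muH_th.
(* After e_H2 the collection contains [H2], so e_H1 acts by [th H2 H1], the only reflection in the
   sum of (B5). *)
have H2B := stE_in H2 x.
by rewrite (stc_ip H2B ip21) (stE_ip H2B ip21) mulrA.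
Qed.

Lemma sact_congr s t : pcongr (brrel a) s t -> forall f, sact s f = sact t f.
Proof.
elim=> {s t} //=.
- exact: sact_rel.
- by move=> s t u _ Est _ Etu f; rewrite Est.
- by move=> s s' t t' _ Es _ Et f; rewrite Es Et.
- by move=> s s' t t' _ Es _ Et f; rewrite Es Et.
- by move=> s t u f; apply/funext=> x; rewrite addrA.
- by move=> s t f; apply/funext=> x; rewrite addrC.
- by move=> t f; apply/funext=> x; rewrite mul0r add0r.
- by move=> t f; apply/funext=> x; rewrite sact_scale mulN1r addNr mul0r.
- by move=> t f; apply/funext=> x; rewrite sact_scale mul1r.
- by move=> s t u f; apply/funext=> x; rewrite sact_add.
- by move=> a' b f; apply/funext=> x; rewrite mulrDl.
- by move=> a' b f; apply/funext=> x; rewrite mulrCA mulrA.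
by move=> b t f; apply/funext=> x; rewrite sact_scale.
Qed.

Lemma KB0 : KB (set0 : {set hyper}) = 1%g.
Proof.
apply/trivgP; rewrite gen_subG; apply/subsetP=> g /(KB_gensP one_neqN1)[[H]|].
  by rewrite inE.
by case=> s1 [s2 [_ _ _]]; rewrite /cact imset0 eqxx.
Qed.

Lemma st0_state : is_state (set0, 1%g).
Proof.
apply: is_stateP => [|k u]; first exact: set0_closed.
by rewrite KB0 => /set1gP-> /set1gP->; rewrite mulg1 inE.
Qed.

Definition st0 : state := Sub _ st0_state.

End StateModule.

Lemma perm_prod_comm (R : pzRingType) (I : eqType) (F : I -> R) (s t : seq I) :
    {in s &, forall i j, F i * F j = F j * F i} -> perm_eq s t ->
  \prod_(i <- s) F i = \prod_(i <- t) F i.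
Proof.
elim: s t => [|i s IHs] t comm st.
  by move: st; rewrite perm_sym => /perm_nilP->.
have it : i \in t by rewrite -(perm_mem st) mem_head.
case/splitPr: it st => t1 t2 st.
have st' : perm_eq s (t1 ++ t2).
  by rewrite -(perm_cons i) (perm_trans st) // -[i :: t2]cat1s perm_catCA.
rewrite big_cons (IHs _ _ st'); last first.
  by move=> j k js ks; apply: comm; rewrite inE ?js ?ks orbT.
rewrite !big_cat big_cons /= !mulrA; congr (_ * _).
have {st'} : {in t1, forall j, F i * F j = F j * F i}.
  move=> j jt; apply: comm; first exact: mem_head.
  by rewrite inE (perm_mem st') mem_cat jt orbT.
elim: t1 {st} => [|j t1 IH] E; first by rewrite big_nil mul1r mulr1.
rewrite big_cons mulrA E ?mem_head // -!mulrA IH // => k kt.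
by apply: E; rewrite inE kt orbT.
Qed.

(** * A basis of the Brauer-Chen algebra *)

Section BrauerAlgebra.
Variables (C : fieldType) (n : nat).
Hypothesis one_neqN1 : (1 : C) != -1.
Local Notation W := (G22 C n).
Local Notation rep := (G22_rep C n).
Local Notation hyper := (hyper rep).
Local Notation rH := (rH one_neqN1).
Local Notation supp := (supp one_neqN1).
Local Notation bar := (bar one_neqN1).
Local Notation ip := (ip one_neqN1).
Local Notation zH := (zH one_neqN1).
Local Notation th := (th one_neqN1).
Local Notation compat := (compat one_neqN1).
Local Notation ipfree := (ipfree one_neqN1).
Local Notation closed_coll := (closed_coll one_neqN1).
Local Notation join := (join one_neqN1).
Local Notation cl := (cl one_neqN1).
Local Notation st0 := (@st0 C n one_neqN1).
Local Notation stE := (@stE C n one_neqN1).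
Local Notation stW := (@stW C n one_neqN1).
Local Notation state := (@state C n one_neqN1).
Variables (K : fieldType) (a : brscalars rep K).
Local Notation Br := (Br a).
Local Notation brw := (brw a).
Local Notation bre := (bre a).
Local Notation breB := (breB a).
Local Notation muH := (muH one_neqN1 a).
Implicit Types (w k : W) (H : hyper) (B D : {set hyper}) (v : Br).

Lemma pclass_rel s t : brrel a s t -> pclass (brrel a) s = pclass (brrel a) t.
Proof. by move=> st; apply/pclassP/pc_rel. Qed.

Lemma pclass_scale c t : pclass (brrel a) (PCst c * t)%PT = c *: (pclass _ t : Br).
Proof. by rewrite pclassM. Qed.

Lemma brw1 : brw 1%g = 1.
Proof. exact: (pclass_rel (br_one a)). Qed.

Lemma brwM w1 w2 : brw (w1 * w2)%g = brw w1 * brw w2.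
Proof. by rewrite -[RHS]pclassM -(pclass_rel (br_mul a w1 w2)). Qed.

Lemma brwK w v : brw w^-1%g * (brw w * v) = v.
Proof. by rewrite mulrA -brwM mulVg brw1 mul1r. Qed.

Lemma bre_sqr H : bre H * bre H = delta a *: bre H.
Proof. by rewrite -[LHS]pclassM (pclass_rel (br_B1 a H)) pclass_scale. Qed.

Lemma brw_bre w H : brw w * bre H = bre (hact w H) * brw w.
Proof.
have -> : bre (hact w H) = brw w * bre H * brw w^-1%g.
  by rewrite /(bre _) /pgen -(pclass_rel (br_B2 a w H)) !pclassM.
by rewrite -[RHS]mulrA -brwM mulVg brw1 mulr1.
Qed.

Lemma bre_comm H1 H2 : ip H1 H2 = false -> bre H1 * bre H2 = bre H2 * bre H1.
Proof.
move=> ip12; have [->//|H12] := eqVneq H1 H2.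
rewrite -[LHS]pclassM -[RHS]pclassM; apply/pclass_rel/br_B4.
by rewrite (transverseE one_neqN1) H12 ip12.
Qed.

Lemma rH_bre H : brw (rH H) * bre H = bre H.
Proof.
by rewrite -[LHS]pclassM; apply/pclass_rel/br_B3; rewrite fixsp_rH subvv.
Qed.

Lemma pclass_sum (I : finType) (P : pred I) (t : I -> pterm K (brgen rep)) :
  pclass (brrel a) (\big[@PAdd K (brgen rep)/PCst 0]_(i | P i) t i) =
  \sum_(i | P i) (pclass _ (t i) : Br).
Proof.
elim/big_rec2: _ => [|i y1 y2 _ <-]; last by rewrite pclassD.
by rewrite -[LHS]/(pcst (brrel a) 0) pcstE scale0r.
Qed.

Lemma bre_ip H1 H2 : ip H2 H1 -> bre H1 * bre H2 = muH H1 *: (brw (th H2 H1) * bre H2).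
Proof.
move=> ip21; have H12 : H1 != H2 by apply: contraTneq ip21 => ->; rewrite ipp.
rewrite -[LHS]pclassM (pclass_rel (br_B5 a H12 _)); last first.
  by rewrite (transverseE one_neqN1) H12 ip_sym ip21.
rewrite pclass_sum (refls_toE one_neqN1 H12) ip21 big_set1 pclass_scale pclassM.
by rewrite muH_th.
Qed.

Definition hseq B : seq hyper := [seq H <- index_enum hyper | H \in B].

Lemma mem_hseq B H : (H \in hseq B) = (H \in B).
Proof. by rewrite mem_filter mem_index_enum andbT. Qed.

Lemma hseq_uniq B : uniq (hseq B).
Proof. by rewrite filter_uniq ?index_enum_uniq. Qed.

Lemma breB_hseq B : breB B = \prod_(H <- hseq B) bre H.
Proof. by rewrite big_filter. Qed.

Lemma breB_perm (s : seq hyper) B : ipfree B -> perm_eq s (hseq B) ->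
  breB B = \prod_(H <- s) bre H.
Proof.
move=> /ipfreeP fr sB; rewrite breB_hseq; apply/esym/perm_prod_comm => //.
move=> H H'; rewrite !(perm_mem sB) !mem_hseq => HB H'B.
by apply/bre_comm/fr.
Qed.

Lemma breB_add H B : ipfree (H |: B) -> H \notin B ->
  breB (H |: B) = bre H * breB B.
Proof.
move=> fr HB; rewrite (@breB_perm (H :: hseq B)) //.
  by rewrite big_cons breB_hseq.
apply: uniq_perm; rewrite /= ?mem_hseq ?HB ?hseq_uniq // => H'.
by rewrite inE !mem_hseq !inE.
Qed.

Lemma breB_split H B : ipfree B -> H \in B -> breB B = bre H * breB (B :\ H).
Proof.
by move=> fr HB; rewrite -{1}(setD1K HB) breB_add ?setD1K // setD11.
Qed.

Lemma breB_in H B : ipfree B -> H \in B -> bre H * breB B = delta a *: breB B.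
Proof.
by move=> fr HB; rewrite (breB_split fr HB) mulrA bre_sqr scalerAl.
Qed.

Lemma breB_ip H1 H B : ipfree B -> H1 \in B -> ip H1 H ->
  bre H * breB B = muH H *: (brw (th H1 H) * breB B).
Proof.
move=> fr H1B ip1; rewrite (breB_split fr H1B) mulrA bre_ip //.
by rewrite -scalerAl mulrA.
Qed.

Lemma brw_breB w B : ipfree B -> brw w * breB B = breB (cact w B) * brw w.
Proof.
move=> fr; rewrite (@breB_perm (map (hact w) (hseq B)) (cact w B)).
- rewrite big_map breB_hseq; elim: (hseq B) => [|H s IHs].
    by rewrite !big_nil mulr1 mul1r.
  by rewrite !big_cons mulrA brw_bre -!mulrA IHs.
- by rewrite ipfree_act.
apply: uniq_perm; rewrite ?(map_inj_uniq (@hact_inj _ _ w)) ?hseq_uniq // => H.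
rewrite mem_hseq; apply/mapP/imsetP => -[H' H'B ->]; exists H' => //;
by move: H'B; rewrite mem_hseq.
Qed.

Lemma muH_unit H : muH H != 0.
Proof. by rewrite -unitfE mu_unit // rH_refl. Qed.

(** Up to the invertible scalar [muH H], both sides are the product of e_H and e_B. *)
Lemma breB_th H1 H2 H B : ipfree B -> H1 \in B -> H2 \in B -> ip H1 H -> ip H2 H ->
  brw (th H1 H) * breB B = brw (th H2 H) * breB B.
Proof.
move=> fr H1B H2B ip1 ip2; apply: (scalerI (muH_unit H)).
by rewrite -!breB_ip.
Qed.

(** The elements fixing e_B form a group, so generators suffice; for a quotient of two reflections
    the claim is [breB_th]. *)
Lemma KB_breB k B : ipfree B -> k \in KB B -> brw k * breB B = breB B.
Proof.
move=> fr; pose G := [set k : W | brw k * breB B == breB B].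
have gG : group_set G.
  apply/group_setP; split; first by rewrite inE brw1 mul1r.
  move=> k1 k2; rewrite !inE => /eqP E1 /eqP E2.
  by rewrite brwM -mulrA E2 E1.
suff /subsetP sub : KB B \subset Group gG by move=> /sub; rewrite inE => /eqP.
rewrite gen_subG; apply/subsetP=> g /(KB_gensP one_neqN1)[[H HB ->]|].
  by rewrite inE (breB_split fr HB) mulrA rH_bre.
case=> s1 [s2 [s1r s2r E1 E2 [_ ->]]].
have [H1 [H2 [H0 [H1B H2B _ [ip1 ip2] [s1E s2E]]]]] := KB_gens_th one_neqN1 s1r s2r E1 E2.
by rewrite inE brwM -mulrA s1E s2E (breB_th fr H1B H2B) // brwK.
Qed.

(* z changes the sign of one coordinate in supp H and one in supp H'. *)
Lemma bar_fix B H H' : ipfree B -> H \in B -> bar H \in B ->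
    [disjoint supp H & supp H'] ->
  exists z, brw z * breB B = breB B /\ hact z H' = bar H'.
Proof.
move=> fr HB barHB dj; have [x [y Hxy]] := on_any one_neqN1 H.
have [x' [y' Hxy']] := on_any one_neqN1 H'.
have x'N : x'.1 \notin supp H by rewrite (disjointFl dj) // (on_supp1 Hxy').
have xN : x.1 \notin supp H' by rewrite (disjointFr dj) // (on_supp1 Hxy).
have xx' : x.1 != x'.1 by apply: contraNneq x'N => <-; rewrite (on_supp1 Hxy).
have [g gxx] := on_ex one_neqN1 xx'; have gE := on_supp gxx.
have ipgH : ip g H.
  rewrite ipE (_ : supp g :&: supp H = [set x.1]) ?cards1 //.
  apply/setP=> i; rewrite in_setI gE in_set2 in_set1.
  have [->|ix] := eqVneq i x.1; first by rewrite (on_supp1 Hxy).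
  by have [->|//] := eqVneq i x'.1; rewrite (negPf x'N).
have ipgH' : ip g H'.
  rewrite ipE (_ : supp g :&: supp H' = [set x'.1]) ?cards1 //.
  apply/setP=> i; rewrite in_setI gE in_set2 in_set1.
  have [->|ix] := eqVneq i x'.1; first by rewrite orbT (on_supp1 Hxy').
  by have [->|//] := eqVneq i x.1; rewrite (negPf xN).
exists (zH g); rewrite zH_act ipgH'; split=> //.
(* The reflections in [g] and [bar g] send [H] and [bar H] to the same [H0], so they act equally on
   e_B, and [zH g] is their product. *)
pose H0 := hact (rH g) H.
have neq K1 : ip g K1 -> hact (rH g) K1 != K1.
  by move=> i1; apply/eqP=> E; have := ip_ip1 K1 i1; rewrite E ipp i1.
have barE : hact (rH (bar g)) (bar H) = H0.
  have := zH_act one_neqN1 g H; rewrite ipgH zHC hactM => <-.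
  by rewrite -hactM rHK hact1.
have [ip1 E1] := refl_th one_neqN1 (rH_refl one_neqN1 g) (erefl H0) (neq _ ipgH).
have H0b : H0 != bar H.
  rewrite -barE; apply/eqP=> E; have ip2 : ip (bar g) (bar H) by rewrite ip_barl ip_bar.
  by have := ip_ip1 (bar H) ip2; rewrite E ipp ip2.
have [ip2 E2] := refl_th one_neqN1 (rH_refl one_neqN1 (bar g)) barE H0b.
by rewrite zHC brwM -mulrA E1 (breB_th fr HB barHB ip1 ip2) -E2 mulrA -brwM rHK brw1 mul1r.
Qed.

(** The power of delta makes the element invariant under closure, see [eB_cl], and makes its pairing
    under [ev] the value at a single state. *)
Definition eB B : Br := delta a ^- #|B| *: breB B.

Lemma delta_neq0 : delta a != 0. Proof. by rewrite -unitfE delta_unit. Qed.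

Lemma eB_add H B : ipfree (H |: B) -> H \notin B ->
  bre H * eB B = delta a *: eB (H |: B).
Proof.
move=> fr HB; rewrite /eB breB_add // cardsU1 HB -scalerAr scalerA.
by rewrite exprS invfM mulrA mulfV ?delta_neq0 // mul1r.
Qed.

Lemma eB_in H B : ipfree B -> H \in B -> bre H * eB B = delta a *: eB B.
Proof. by move=> fr HB; rewrite /eB -scalerAr breB_in // scalerA mulrC -scalerA. Qed.

Lemma eB_bar B H H' : ipfree B -> H \in B -> bar H \in B -> H' \in B ->
  bar H' \notin B -> eB (bar H' |: B) = eB B.
Proof.
move=> fr HB barHB H'B barH'.
have dj : [disjoint supp H & supp H'].
  have /ipfreeP frB := fr; case: (ip0P (frB _ _ HB H'B)) => // E.
    by rewrite E barHB in barH'.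
  by rewrite E barK HB in barH'.
have [z [zB zH']] := bar_fix fr HB barHB dj.
have fr' : ipfree (bar H' |: B).
  rewrite ipfree_add fr andbT; apply/compatP=> H1 H1B; rewrite ip_barl.
  by move/ipfreeP: fr; apply.
have zin : bar H' \in cact z B by rewrite -zH' mem_cact.
have : bre (bar H') * breB B = delta a *: breB B.
  by rewrite -{1}zB brw_breB // mulrA breB_in ?ipfree_act // -scalerAl -brw_breB // zB.
move=> E; apply: (scalerI delta_neq0); rewrite -eB_add //.
by rewrite /eB -scalerAr E scalerA mulrC -scalerA.
Qed.

Lemma eB_cl B : ipfree B -> eB (cl B) = eB B.
Proof.
have [m] := ubnP #|cl B :\: B|; elim: m B => // m IHm B.
rewrite ltnS => Bm fr; have [->//|clB] := eqVneq (cl B) B.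
have /set0Pn[H'] : cl B :\: B != set0.
  by apply: contraNneq clB => /eqP; rewrite setD_eq0 eqEsubset sub_cl andbT.
rewrite inE => /andP[H'N H'cl]; have [H'B|] := in_cl H'cl; first by rewrite H'B in H'N.
have dB : has_bar one_neqN1 B by apply: contraNT clB => /negPf; rewrite /(cl _) => ->.
have /has_barP[H HB barHB] := dB => barH'.
have fr' : ipfree (H' |: B).
  rewrite ipfree_add fr andbT; apply/compatP=> H1 H1B; rewrite -ip_barl.
  by move/ipfreeP: fr; apply.
have clE : cl (H' |: B) = cl B.
  have HclB : H' |: cl B = cl B by apply/setUidPr; rewrite sub1set.
  by rewrite -cl_add_cl HclB cl_id // cl_closed.
rewrite -clE IHm //; first by rewrite -[H']barK (eB_bar fr HB barHB barH') ?barK.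
rewrite clE -setDDl; apply: leq_trans Bm; apply/proper_card/properP.
split; first by rewrite setDDl setDS // subsetUr.
by exists H'; rewrite !inE ?eqxx ?H'N.
Qed.

(* Pairs f with the action of v on the state (set0, 1), which stands for 1; this
   detects linear independence in Br. *)
Definition ev v (f : state -> K) : K := sact a (prepr v) f st0.

Lemma ev_class t f : ev (pclass _ t) f = sact a t f st0.
Proof. by rewrite /ev (sact_congr (prepr_pclass _ _)). Qed.

Lemma evD v1 v2 f : ev (v1 + v2) f = ev v1 f + ev v2 f.
Proof.
elim/pclass_ind: v1 => s; elim/pclass_ind: v2 => t.
by rewrite -[X in ev X]pclassD !ev_class.
Qed.

Lemma evZ c v f : ev (c *: v) f = c * ev v f.
Proof.
by elim/pclass_ind: v => t; rewrite -pclass_scale !ev_class /= sact_scale.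
Qed.

Lemma ev_sum (I : finType) (P : pred I) (F : I -> Br) f :
  ev (\sum_(i | P i) F i) f = \sum_(i | P i) ev (F i) f.
Proof.
apply: (big_morph (ev^~ f)) => [v1 v2|]; first exact: evD.
by rewrite -(scale0r (0 : Br)) evZ mul0r.
Qed.

Lemma ev1 f : ev 1 f = f st0.
Proof. by rewrite -[X in ev X]/(pclass (brrel a) (PCst 1)) ev_class /= mul1r. Qed.

Lemma ev_w w v f : ev (brw w * v) f = ev v (fun x => f (stW w x)).
Proof.
by elim/pclass_ind: v => t; rewrite -[brw w * _]pclassM !ev_class.
Qed.

Lemma ev_e H v f : ev (bre H * v) f = ev v (fun x => stc a H x * f (stE H x)).
Proof.
by elim/pclass_ind: v => t; rewrite -[bre H * _]pclassM !ev_class.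
Qed.

(** This is e_B applied to the state of 1. Each join multiplies the group part by the K of a larger
    closed collection, which absorbs the earlier one by [KB_mono]. *)
Lemma foldr_st (s : seq hyper) : ipfree [set H in s] ->
  stB (foldr stE st0 s) = cl [set H in s] /\
  stS (foldr stE st0 s) = KB (cl [set H in s]).
Proof.
elim: s => [|H s IHs] /=.
  move=> _; have -> : [set H in [::]] = set0 :> {set hyper} by apply/setP=> H; rewrite !inE.
  have cl0 : cl (set0 : {set hyper}) = set0.
    by apply: cl_id; case/andP: (@set0_closed C n one_neqN1).
  by rewrite cl0 /stB /stS /= KB0.
have -> : [set H' in H :: s] = H |: [set H' in s] by apply/setP=> H'; rewrite !inE.
rewrite ipfree_add => /andP[c /[dup] fr /IHs[E1 E2]].
have c' : compat H (stB (foldr stE st0 s)) by rewrite E1 compat_cl.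
rewrite (stB_compat c') (stS_compat c') E1 E2 /(join _ _) cl_add_cl; split=> //.
apply/eqP; rewrite eqEsubset; apply/andP; split.
  apply/subsetP=> _ /mulsgP[k1 k2 k1B k2B ->]; rewrite groupM //.
  apply: (subsetP (KB_mono _ _ _)) k2B; last by rewrite cl_mono ?subsetUr.
    by rewrite /(closed_coll _) cl_closed ipfree_cl fr.
  by rewrite /(closed_coll _) cl_closed ipfree_cl ipfree_add c fr.
by apply/subsetP=> k kB; rewrite -[k]mulg1 mem_mulg ?group1.
Qed.

Definition stK B : state := foldr stE st0 (hseq B).

Lemma hseqE B : [set H in hseq B] = B.
Proof. by apply/setP=> H; rewrite inE mem_hseq. Qed.

Lemma stK_closed B : closed_coll B -> stB (stK B) = B /\ stS (stK B) = KB B.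
Proof.
case/andP=> fr clB; have := @foldr_st (hseq B); rewrite hseqE => /(_ fr).
by rewrite cl_id.
Qed.

Lemma ev_breB B f : ipfree B -> ev (breB B) f = delta a ^+ #|B| * f (stK B).
Proof.
rewrite breB_hseq cardE /stK; have -> : size (enum B) = size (hseq B).
  by apply/perm_size/uniq_perm; rewrite ?enum_uniq ?hseq_uniq // => H; rewrite mem_enum mem_hseq.
rewrite -{1}(hseqE B); elim: (hseq B) f => [|H s IHs] f /=.
  by rewrite big_nil ev1 mul1r.
have -> : [set H' in H :: s] = H |: [set H' in s] by apply/setP=> H'; rewrite !inE.
rewrite ipfree_add => /andP[c fr]; rewrite big_cons ev_e IHs //.
have [E1 _] := foldr_st fr.
by rewrite /stc E1 compat_cl c exprS mulrA [_ * delta a]mulrC.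
Qed.

Lemma ev_eB B f : ipfree B -> ev (eB B) f = f (stK B).
Proof.
move=> fr; rewrite evZ ev_breB // mulrA mulVf ?mul1r //.
by rewrite expf_neq0 // delta_neq0.
Qed.

Definition is_bidx (p : {set hyper} * {set W}) : bool :=
  closed_coll p.1 && (p.2 \in lcosets (KB p.1) [set: W]).
Definition bidx : Type := {p | is_bidx p}.
HB.instance Definition _ := Finite.on bidx.
Implicit Types (p q : bidx).

Definition bv p : Br := brw (repr (val p).2) * eB (val p).1.

Lemma bidx_closed p : closed_coll (val p).1. Proof. by case/andP: (valP p). Qed.

Lemma bidx_coset p : (val p).2 = (repr (val p).2 *: KB (val p).1)%g.
Proof.
case/andP: (valP p) => _ /lcosetsP[u _ ->].
by apply/esym/lcoset_eqP; apply: mem_repr (lcoset_refl _ _).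
Qed.

Definition stp p : state := stW (repr (val p).2) (stK (val p).1).

Lemma ev_bv p f : ev (bv p) f = f (stp p).
Proof. by rewrite ev_w ev_eB //; case/andP: (bidx_closed p). Qed.

(** The set in the state is the coset itself; the collection is recovered by undoing the action of
    the coset representative. *)
Lemma stp_inj : injective stp.
Proof.
move=> p q E; have [B1 S1] := stK_closed (bidx_closed p).
have [B2 S2] := stK_closed (bidx_closed q).
have ES : (val p).2 = (val q).2.
  by rewrite bidx_coset -S1 -stS_W -/(stp p) E stS_W S2 -bidx_coset.
have EB : (val p).1 = (val q).1.
  apply: (imset_inj (@hact_inj C n (repr (val p).2))).
  rewrite -!/(cact _ _) {2}ES -B1 -[in RHS]B2 -!stB_W.
  by rewrite -[in RHS]/(stp q) -E.
by apply: val_inj; rewrite [val p]surjective_pairing EB ES -surjective_pairing.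
Qed.

Definition in_bspan v : Prop := exists c : bidx -> K, v = \sum_p c p *: bv p.

Lemma bspan_bv p : in_bspan (bv p).
Proof.
exists (fun q => (q == p)%:R); rewrite (bigD1 p) //= eqxx scale1r big1 ?addr0 //.
by move=> q /negPf->; rewrite scale0r.
Qed.

Lemma bspanD v1 v2 : in_bspan v1 -> in_bspan v2 -> in_bspan (v1 + v2).
Proof.
move=> [c1 ->] [c2 ->]; exists (fun p => c1 p + c2 p); rewrite -big_split.
by apply: eq_bigr => p _; rewrite scalerDl.
Qed.

Lemma bspanZ c v : in_bspan v -> in_bspan (c *: v).
Proof.
move=> [c1 ->]; exists (fun p => c * c1 p); rewrite scaler_sumr.
by apply: eq_bigr => p _; rewrite scalerA.
Qed.

Lemma bspan_sum (I : finType) (F : I -> Br) :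
  (forall i, in_bspan (F i)) -> in_bspan (\sum_i F i).
Proof.
move=> E; apply: (big_ind in_bspan) => //; last exact: bspanD.
exists (fun=> 0); rewrite big1 // => p _; exact: scale0r.
Qed.

Lemma bspan_eB w B : closed_coll B -> in_bspan (brw w * eB B).
Proof.
move=> clB; have pB : is_bidx (B, w *: KB B)%g.
  by rewrite /is_bidx clB; apply/lcosetsP; exists w.
suff -> : brw w * eB B = bv (Sub _ pB) by apply: bspan_bv.
rewrite /bv /=; have : repr (w *: KB B)%g \in (w *: KB B)%g by apply: mem_repr (lcoset_refl _ _).
case/lcosetP=> k kB ->; rewrite brwM -mulrA /eB -!scalerAr (KB_breB _ kB) //.
by case/andP: clB.
Qed.

Definition brclass t : Br := pclass (brrel a) t.

(** The span contains 1, so stability under left multiplication by all terms makes it the whole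
    algebra. *)
Lemma bspan_mul t v : in_bspan v -> in_bspan (brclass t * v).
Proof.
elim: t v => [c|g|s IHs t IHt|s IHs t IHt] v vS.
- by rewrite -[brclass _ * v]/(c *: v); apply: bspanZ.
- have gen_bv : forall p, in_bspan (brclass (PGen g) * bv p).
    case: g => [w|H] p; rewrite /bv.
      rewrite -[brclass _]/(brw w) mulrA -brwM; apply: bspan_eB.
      exact: bidx_closed.
    rewrite -[brclass _]/(bre H); move: (repr _) => u; have clB := bidx_closed p.
    move: (val p).1 clB => B clB; have /andP[fr bcl] := clB.
    (* By (B2) the group element moves to the left, and only products of some e_H with e_B
       remain. *)
    have -> : bre H * (brw u * eB B) = brw u * (bre (hact u^-1%g H) * eB B).
      by rewrite !mulrA brw_bre -hactM mulgV hact1.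
    move: (hact _ H) => {}H; case c: (compat H B).
      have [HB|HB] := boolP (H \in B).
        by rewrite eB_in // -scalerAr; apply/bspanZ/bspan_eB.
      have fr' : ipfree (H |: B) by rewrite ipfree_add c.
      rewrite eB_add // -scalerAr -eB_cl //; apply/bspanZ/bspan_eB.
      exact: join_closed.
    have [H1 H1B ip1] := compatFP c.
    rewrite /eB -!scalerAr (breB_ip fr H1B ip1) -!scalerAr mulrA -brwM.
    apply/bspanZ/bspanZ; rewrite -[breB B]scale1r.
    rewrite -(mulfV (expf_neq0 #|B| delta_neq0)) -scalerA -scalerAr.
    by apply/bspanZ/bspan_eB.
  case: vS => c ->; rewrite mulr_sumr; apply: bspan_sum => p.
  by rewrite -scalerAr; apply/bspanZ/gen_bv.
- have -> : brclass (s + t) = brclass s + brclass t by apply: pclassD.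
  by rewrite mulrDl; apply: bspanD; [apply: IHs|apply: IHt].
have -> : brclass (s * t) = brclass s * brclass t by apply: pclassM.
by rewrite -mulrA; apply/IHs/IHt.
Qed.

Lemma bspan_all v : in_bspan v.
Proof.
elim/pclass_ind: v => t; rewrite -[pclass _ t]/(brclass t) -[brclass t]mulr1.
apply: bspan_mul.
have -> : 1 = brw 1%g * eB set0.
  by rewrite brw1 mul1r /eB cards0 expr0 invr1 scale1r /Defs.breB big_set0.
exact/bspan_eB/set0_closed.
Qed.

(** Each basis vector evaluates functions at its own state, so the indicator of the state of [p] is
    the coordinate at [p]. *)
Lemma bv_free (c : bidx -> K) : \sum_p c p *: bv p = 0 -> forall p, c p = 0.
Proof.
move=> E p; have := congr1 (ev^~ (fun x => (x == stp p)%:R)) E.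
rewrite ev_sum (bigD1 p) //= big1 => [|q qp].
  by rewrite evZ ev_bv eqxx mulr1 addr0 => ->; rewrite -(scale0r (0 : Br)) evZ mul0r.
by rewrite evZ ev_bv (inj_eq stp_inj) (negPf qp) mulr0.
Qed.

Lemma Br_dim : has_dim Br #|{: bidx}|.
Proof.
exists (fun i => bv (enum_val i)) => v.
have reindex_b (c : bidx -> K) : \sum_p c p *: bv p =
    \sum_(i < #|{: bidx}|) c (enum_val i) *: bv (enum_val i).
  by rewrite -(big_enum_val (fun p => c p *: bv p)); apply: eq_bigl.
have [c vE] := bspan_all v; exists [ffun i => c (enum_val i)]; split.
  by rewrite vE reindex_b; apply: eq_bigr => i _; rewrite ffunE.
move=> c' vE'; apply/ffunP=> i; rewrite ffunE.
pose d p := c p - c' (enum_rank p).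
have /bv_free/(_ (enum_val i)) : \sum_p d p *: bv p = 0.
  under eq_bigr do rewrite scalerBl; rewrite sumrB -vE reindex_b.
  by under eq_bigr do rewrite enum_valK; rewrite -vE' subrr.
by rewrite /d enum_valK => /eqP; rewrite subr_eq0 => /eqP.
Qed.

Lemma card_bidx : #|{: bidx}| = \sum_(B | closed_coll B) #|[set: W] : KB B|%g.
Proof.
rewrite card_sig -sum1_card.
under [RHS]eq_bigr do rewrite -card_lcosets -sum1_card.
by rewrite pair_big_dep.
Qed.

(** Pairing x e_B with the indicator of the state attached to u K_B extracts the sum over this
    coset, up to a power of delta. *)
Lemma annKW_coset B (x : galg K W) u : closed_coll B -> annKW a B x ->
  \sum_(w in (u *: KB B)%g) x w = 0.
Proof.
move=> clB; have /andP[fr _] := clB; have [BE SE] := stK_closed clB.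
rewrite /annKW => E; pose f y := (y == stW u (stK B))%:R : K.
have := congr1 (ev^~ f) E; rewrite /br_of_galg mulr_suml ev_sum.
have -> : ev 0 f = 0 by rewrite -(scale0r (0 : Br)) evZ mul0r.
have term w : ev (x w *: brw w * breB B) f =
    delta a ^+ #|B| * (if w \in (u *: KB B)%g then x w else 0).
  rewrite -scalerAl evZ ev_w ev_breB // mulrCA; congr (_ * _).
  rewrite /f; case: ifP => wu.
    case/lcosetP: wu => k kB ->; rewrite stWM (@stW_KB _ _ _ k) ?eqxx ?mulr1 // BE //.
  case: eqP => [/(congr1 (@stS _ _ one_neqN1))|_]; last by rewrite mulr0.
  by rewrite !stS_W SE => /lcoset_eqP; rewrite wu.
under eq_bigr do rewrite term; rewrite -mulr_sumr -big_mkcond => /eqP.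
by rewrite mulf_eq0 (negPf (expf_neq0 _ delta_neq0)) => /eqP.
Qed.
End BrauerAlgebra.

(** * Group algebras, linear spans and sums over cosets *)

Section GroupAlgebraFacts.
Variables (K : fieldType) (gT : finGroupType).
Implicit Types (x y : galg K gT) (g h : gT) (G H : {group gT}).

Lemma gelt_mulE g x h : (gelt K g * x) h = x (g^-1 * h)%g.
Proof.
rewrite [LHS]ffunE (bigD1 g) //= big1 => [|k /negPf kg].
  by rewrite ffunE eqxx mul1r addr0.
by rewrite ffunE kg mul0r.
Qed.

Lemma mulE_gelt g x h : (x * gelt K g) h = x (h * g^-1)%g.
Proof.
rewrite [LHS]ffunE (bigD1 (h * g^-1)%g) //= big1 => [|k /negPf kg].
  by rewrite ffunE invMg invgK mulgKV eqxx mulr1 addr0.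
rewrite ffunE; case: eqP => [E|_]; last by rewrite mulr0.
by rewrite -E invMg invgK mulKVg eqxx in kg.
Qed.

Lemma geltM g h : gelt K (g * h)%g = gelt K g * gelt K h.
Proof. by apply/ffunP=> k; rewrite gelt_mulE !ffunE -(inj_eq (mulgI g^-1%g)) mulKg. Qed.

Lemma galg_sum x : x = \sum_g x g *: gelt K g.
Proof.
apply/ffunP=> h; rewrite sum_ffunE (bigD1 h) //= big1 => [|g /negPf gh].
  by rewrite !ffunE eqxx addr0 [_ *: _]mulr1.
by rewrite !ffunE eq_sym gh [_ *: _]mulr0.
Qed.

Lemma lin_span_fin (V : lmodType K) (P : V -> Prop) (I : finType) (c : I -> K) (u : I -> V) :
  (forall i, P (u i)) -> lin_span P (\sum_i c i *: u i).
Proof.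
move=> Pu; exists #|I|, (fun i => c (enum_val i)), (fun i => u (enum_val i)).
by split=> //; rewrite -(big_enum_val (fun i => c i *: u i)); apply: eq_bigl.
Qed.

Lemma lin_span_ind (V : lmodType K) (P Q : V -> Prop) v :
    Q 0 -> (forall u1 u2, Q u1 -> Q u2 -> Q (u1 + u2)) ->
    (forall c u, Q u -> Q (c *: u)) -> (forall u, P u -> Q u) ->
  lin_span P v -> Q v.
Proof.
move=> Q0 QD QZ PQ [m [c [u [Pu ->]]]]; apply: (big_ind Q) => // i _.
exact/QZ/PQ.
Qed.

(** Subtracting this zero turns an element with vanishing coset sums into a combination of
    differences between group elements and their coset representatives. *)
Lemma coset_sum0 G (V : lmodType K) x (F : gT -> V) :
    (forall g, \sum_(h in (g *: G)%g) x h = 0) ->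
  \sum_g (x g : K) *: F (repr (g *: G)%g) = 0.
Proof.
move=> x0; rewrite (partition_big (fun g => (g *: G)%g) (fun S => S \in lcosets G [set: gT])) /=.
  rewrite big1 // => _ /lcosetsP[g _ ->].
  rewrite (eq_bigr (fun h => (x h : K) *: F (repr (g *: G)%g))) => [|h /eqP-> //].
  rewrite -scaler_suml (eq_bigl (mem (g *: G)%g)) ?x0 ?scale0r // => h /=.
  by apply/eqP/idP => [<-|/lcoset_eqP //]; apply: lcoset_refl.
by move=> g _; apply/lcosetsP; exists g.
Qed.

Lemma repr_coset G g : exists2 h, h \in G & g = (repr (g *: G) * h)%g.
Proof.
have /lcosetP[h hG E] : repr (g *: G)%g \in (g *: G)%g by apply: mem_repr (lcoset_refl _ _).
by exists h^-1%g; rewrite ?groupV // E mulgK.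
Qed.
End GroupAlgebraFacts.

(** * Admissibility and annihilators *)

Section Admissibility.
Variables (C : fieldType) (n : nat).
Hypothesis one_neqN1 : (1 : C) != -1.
Local Notation W := (G22 C n).
Local Notation rep := (G22_rep C n).
Local Notation hyper := (hyper rep).
Local Notation bar := (bar one_neqN1).
Local Notation on := (on one_neqN1).
Local Notation ipfree := (ipfree one_neqN1).
Local Notation closed_coll := (closed_coll one_neqN1).
Local Notation bar_closed := (bar_closed one_neqN1).
Implicit Types (w k : W) (H : hyper) (B D : {set hyper}).

Lemma signz (k : int) : {b : bool |
  (-1) ^ k = (-1) ^+ b :> C /\ (-1) ^ (k + 1) = (-1) ^+ (~~ b) :> C}.
Proof.
have N1u : (-1 : C) \is a GRing.unit by rewrite unitrN1.
have E : {b : bool | (-1) ^ k = (-1) ^+ b :> C}.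
  case: k => m; [exists (odd m)|exists (odd m.+1)].
    by rewrite -exprnP signr_odd.
  by rewrite NegzE -exprnN invr_sign signr_odd.
case: E => b E; exists b; split=> //.
by rewrite exprzDr // E expr1z; case: b {E}; rewrite /= ?expr0 ?expr1 ?mulrNN ?mulr1 ?mul1r.
Qed.

Lemma Hij_Hpt (i j : 'I_n) (k : int) (b : bool) : (-1) ^ k = (-1) ^+ b :> C ->
  Hij C i j k = Hpt C (i, false) (j, b).
Proof.
by move=> E; apply/vspaceP=> z; rewrite mem_Hij mem_Hpt /zc /= expr0 mul1r E.
Qed.

Lemma Hij_inP (i j : 'I_n) (k : int) (b : bool) B : i != j -> (-1) ^ k = (-1) ^+ b :> C ->
  Hij_in i j k B <-> exists2 H, H \in B & on H (i, false) (j, b).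
Proof.
move=> ij E; split=> [[H HB HE]|[H HB /onP[_ HE]]]; exists H => //.
  by apply/onP; rewrite -(Hij_Hpt _ _ E).
by rewrite (Hij_Hpt _ _ E).
Qed.

Lemma on_std H : exists i j b, on H (i, false) (j, b).
Proof.
have [[i c] [[j b] Hxy]] := on_any one_neqN1 H; case: c Hxy => Hxy; exists i, j.
  by exists (~~ b); rewrite -on_neg /neg /= negbK.
by exists b.
Qed.

Lemma bar_closed_cond B : bar_closed B <->
  forall (i j i' j' : 'I_n) (k : int), i != j -> i' != j' ->
    Hij_in i j 0 B -> Hij_in i j 1 B -> Hij_in i' j' k B ->
    Hij_in i' j' (k + 1) B.
Proof.
have E0 : (-1) ^ (0 : int) = (-1) ^+ false :> C by [].
have E1 : (-1) ^ (1 : int) = (-1) ^+ true :> C by [].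
split=> [/bar_closedP clB i j i' j' k ij ij'|E].
  move=> /(Hij_inP _ ij E0)[H HB Hij0] /(Hij_inP _ ij E1)[H1 H1B Hij1].
  have [b [Eb Eb1]] := signz k; case/(Hij_inP _ ij' Eb)=> H' H'B Hij'.
  apply/(Hij_inP _ ij' Eb1); exists (bar H'); last by rewrite on_bar /neg /= negbK.
  apply: clB => //; apply/has_barP; exists H => //.
  have -> // : bar H = H1.
  by apply: (@on_inj _ _ one_neqN1 _ _ (i, false) (j, true)); rewrite ?on_bar.
apply/bar_closedP=> /has_barP[H HB barHB] H' H'B.
have [i [j [b Hij0]]] := on_std H; have [i' [j' [b' Hij1]]] := on_std H'.
have ij := on_ne Hij0; have ij' := on_ne Hij1.
(* [H] and [bar H] are the hyperplanes of the two signs on the indices i and j; the bit b tells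
   which one is which. *)
have in01 c : exists2 H0, H0 \in B & on H0 (i, false) (j, c).
  have [->|cb] := eqVneq c b; first by exists H.
  exists (bar H) => //; rewrite on_bar /neg /=.
  have -> : ~~ c = b by move: cb; case: (c); case: (b).
  by [].
have [b1 [Eb Eb1]] := signz (Posz b'); have bE : b1 = b'.
  by apply: (signC_inj one_neqN1); rewrite -Eb.
have H01 : Hij_in i j 0 B by apply/(Hij_inP _ ij E0).
have H11 : Hij_in i j 1 B by apply/(Hij_inP _ ij E1).
have Hb : Hij_in i' j' (Posz b') B by apply/(Hij_inP _ ij' Eb); exists H'; rewrite // bE.
have [H2 H2B] := E _ _ _ _ _ ij ij' H01 H11 Hb.
rewrite (Hij_Hpt _ _ Eb1) bE => H2E.
suff -> : bar H' = H2 by [].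
apply: (@on_inj _ _ one_neqN1 _ _ (i', false) (j', ~~ b')); last exact/onP.
by rewrite on_bar /neg /= negbK.
Qed.

Variables (K : fieldType) (a : brscalars rep K).
Local Notation brw := (brw a).
Local Notation breB := (breB a).
Implicit Types (x y : galg K W).

Lemma br_of_galgD x y : br_of_galg a (x + y) = br_of_galg a x + br_of_galg a y.
Proof.
by rewrite -big_split; apply: eq_bigr => w _; rewrite ffunE scalerDl.
Qed.

Lemma br_of_galgZ c x : br_of_galg a (c *: x) = c *: br_of_galg a x.
Proof. by rewrite scaler_sumr; apply: eq_bigr => w _; rewrite ffunE scalerA. Qed.

Lemma br_of_gelt g : br_of_galg a (gelt K g) = brw g.
Proof.
rewrite /br_of_galg (bigD1 g) //= big1 => [|w /negPf wg].
  by rewrite ffunE eqxx scale1r addr0.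
by rewrite ffunE wg scale0r.
Qed.

Lemma br_of_galg0 : br_of_galg a 0 = 0.
Proof. by rewrite -(scale0r 0) br_of_galgZ scale0r. Qed.

Lemma br_of_galg_sum (I : finType) (F : I -> galg K W) :
  br_of_galg a (\sum_i F i) = \sum_i br_of_galg a (F i).
Proof. exact: (big_morph _ br_of_galgD br_of_galg0). Qed.

Lemma br_of_galgM x y : br_of_galg a (x * y) = br_of_galg a x * br_of_galg a y.
Proof.
rewrite {1}(galg_sum x) mulr_suml br_of_galg_sum /br_of_galg mulr_suml.
apply: eq_bigr => g _; rewrite -scalerAl -/(br_of_galg a _) br_of_galgZ -scalerAl.
congr (_ *: _); rewrite {1}(galg_sum y) mulr_sumr br_of_galg_sum mulr_sumr.
apply: eq_bigr => h _; rewrite -scalerAr br_of_galgZ -geltM br_of_gelt brwM.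
by rewrite scalerAr.
Qed.

Lemma galg_onM B x y : galg_on (stab B) x -> galg_on (stab B) y -> galg_on (stab B) (x * y).
Proof.
move=> xB yB g; rewrite ffunE => nz.
have [h] : exists h, x h * y (h^-1 * g)%g != 0.
  apply/existsP; apply: contraR nz; rewrite negb_exists => /forallP E.
  by rewrite big1 // => h _; apply/eqP/negPn/E.
rewrite mulf_eq0 negb_or => /andP[/xB hB /yB ghB].
by rewrite -[g](mulKVg h) groupM.
Qed.

Lemma annKW_lin B : annKW a B 0 /\
  (forall x y, annKW a B x -> annKW a B y -> annKW a B (x + y)) /\
  (forall c x, annKW a B x -> annKW a B (c *: x)).
Proof.
rewrite /annKW; split; first by rewrite br_of_galg0 mul0r.
split=> [x y Ex Ey|c x Ex]; first by rewrite br_of_galgD mulrDl Ex Ey addr0.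
by rewrite br_of_galgZ -scalerAl Ex scaler0.
Qed.

Lemma stab_breB B x : ipfree B -> galg_on (stab B) x ->
  br_of_galg a x * breB B = breB B * br_of_galg a x.
Proof.
move=> fr xB; rewrite mulr_suml mulr_sumr; apply: eq_bigr => w _.
rewrite -scalerAl -scalerAr; have [->|/xB] := eqVneq (x w) 0; first by rewrite !scale0r.
by rewrite inE => /eqP E; rewrite (brw_breB a w fr) E.
Qed.

(** Elements of K Stab(B) commute with e_B, so the right factor of a generator u (k - 1) v moves
    behind e_B, and k - 1 kills e_B. *)
Lemma augKB_ann B x : ipfree B -> augKB B x -> annKStab a B x.
Proof.
move=> fr xaug; have [ann0 [annD annZ]] := annKW_lin B.
have [xann xon] : annKW a B x /\ galg_on (stab B) x.
  apply: (lin_span_ind (Q := fun x => annKW a B x /\ galg_on (stab B) x) _ _ _ _ xaug) =>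
    [|x1 x2 [xa xo] [ya yo]|c x1 [xa xo]|_ [u [v [k [uB vB kB ->]]]]].
  - by split=> // g; rewrite ffunE eqxx.
  - split; first exact: annD.
    move=> g; rewrite ffunE; have [->|/xo //] := eqVneq (x1 g) 0.
    by rewrite add0r; apply: yo.
  - split; first exact: annZ.
    by move=> g; rewrite ffunE => nz; apply: xo; apply: contraNneq nz => ->; rewrite scaler0.
  have kon : galg_on (stab B) (gelt K k - 1).
    move=> g; rewrite !ffunE; have [->|_] := eqVneq g k.
      by move=> _; apply: (subsetP (KB_sub_stab fr)).
    by have [->|_] := eqVneq g 1%g; rewrite ?group1 // subrr eqxx.
  split; last by apply: galg_onM vB; apply: galg_onM uB kon.
  rewrite /annKW !br_of_galgM -mulrA stab_breB // mulrA -(mulrA (br_of_galg a u)).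
  rewrite br_of_galgD -scaleN1r br_of_galgZ scaleN1r !br_of_gelt mulrBl KB_breB //.
  by rewrite brw1 mul1r subrr mulr0 mul0r.
(* As x already lies in K Stab(B), its projection to the coset of 1 is x itself. *)
exists (fun w => if w == 1%g then x else 0); split=> [w|]; first by case: ifP.
rewrite (bigD1 1%g) //= big1 => [|w /negPf->].
  rewrite eqxx invg1 mul1r addr0; apply/ffunP=> g; rewrite ffunE.
  have -> : lcoset (stab B) 1%g = stab B by rewrite lcosetE lcoset1.
  by case: ifPn => // gB; apply/eqP; apply: contraR gB => /xon.
rewrite [X in _ * X](_ : _ = 0) ?mulr0 //; apply/ffunP=> g; rewrite !ffunE; by case: ifP.
Qed.

(** The coset sums of an annihilating element vanish, so each g may be replaced by g - r(g) with
    r(g) the representative of g K_B. As g = r(g) k with k in K_B, such a difference is r(g) (k -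
    1). *)
Lemma ann_augKB B x : closed_coll B -> annKStab a B x -> augKB B x.
Proof.
move=> clB [y [ya ->]]; have /andP[fr _] := clB.
have KBs := subsetP (KB_sub_stab fr).
have term w : gelt K w^-1%g * proj_coset B w (y w) =
    \sum_g proj_coset B w (y w) g *: gelt K (w^-1 * g)%g.
  rewrite {1}(galg_sum (proj_coset B w (y w))) mulr_sumr; apply: eq_bigr => g _.
  by rewrite -scalerAr -geltM.
pose r g : W := repr (g *: KB B)%g.
have term2 w : gelt K w^-1%g * proj_coset B w (y w) = \sum_g proj_coset B w (y w) g *:
    (gelt K (w^-1 * g)%g - gelt K (w^-1 * r g)%g).
  rewrite term; under [RHS]eq_bigr do rewrite scalerBr; rewrite sumrB.
  rewrite [X in _ - X](coset_sum0 (G := [group of <<KB_gens B>>%g])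
    (fun g => gelt K (w^-1 * g)%g)) ?subr0 // => u.
  (* Since K_B is contained in Stab(B), the coset u K_B lies inside w Stab(B) or misses it. *)
  have [uw|uw] := boolP (u \in (w *: stab B)%g).
    rewrite -[RHS](annKW_coset u clB (ya w)); apply: eq_bigr => h.
    case/lcosetP=> k kB ->; rewrite ffunE lcosetE; case: ifP => // /negP[].
    by case/lcosetP: uw => s sB ->; rewrite mem_lcoset -!mulgA mulKg groupM //; exact: KBs.
  rewrite big1 // => h /lcosetP[k kB ->]; rewrite ffunE lcosetE; case: ifP => //.
  rewrite mem_lcoset => E; case/negP: uw; rewrite mem_lcoset.
  by rewrite -[u](mulgK k) mulgA groupM // groupV KBs.
under eq_bigr do rewrite term2.
rewrite pair_bigA /=; pose P (p : W * W) := p.2 \in (p.1 *: stab B)%g.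
rewrite (bigID P) /= [X in _ + X]big1 ?addr0 => [|[w g] /= /negPf E]; last first.
  by rewrite ffunE lcosetE -[_ \in _]/(P (w, g)) E scale0r.
rewrite big_mkcond /=.
rewrite (eq_bigr (fun p : W * W => (if P p then proj_coset B p.1 (y p.1) p.2 else 0) *:
  (if P p then gelt K (p.1^-1 * p.2)%g - gelt K (p.1^-1 * r p.2)%g else 0))); last first.
  by move=> p _; case: ifP => //; rewrite scale0r.
apply: lin_span_fin => -[w g]; case: ifP => [/= wg|_]; last first.
  exists 0, 0, 1%g; split; rewrite ?group1 ?mul0r //; by move=> h; rewrite ffunE eqxx.
have [k kB gE] := repr_coset [group of <<KB_gens B>>%g] g.
rewrite -/(r g) in gE.
exists (gelt K (w^-1 * r g)%g), 1, k; split=> //.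
- move=> h; rewrite ffunE; have [-> _|] := eqVneq h; last by rewrite eqxx.
  move: wg; rewrite /P /= mem_lcoset {1}gE mulgA groupMr //.
  exact: KBs.
- move=> h; rewrite ffunE; have [-> _|] := eqVneq h; last by rewrite eqxx.
  exact: group1.
by rewrite mulr1 mulrBr mulr1 -geltM -mulgA -gE.
Qed.

Lemma tens_actE d x (v : 'cV[K]_d) :
  tens_act x (tens 1 v) = [ffun w => (x w : K) *: v] :> {ffun W -> 'cV[K]_d}.
Proof.
apply/ffunP=> w; rewrite !ffunE (bigD1 w) //= big1 => [|g /negPf gw].
  by rewrite !ffunE mulVg eqxx scale1r addr0.
by rewrite !ffunE -eq_mulVg1 gw scale0r scaler0.
Qed.

(** The trivial module is a witness: in the induced module g and r(g) have the same effect on v, and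
    the coefficients over each coset of K_B add up to 0. *)
Lemma closed_admissible B : closed_coll B -> admissible a B.
Proof.
move=> clB; have /andP[fr _] := clB; have KBs := subsetP (KB_sub_stab fr).
have triv : mx_repr (stab B) (fun _ : W => 1%:M : 'M[K]_1).
  by split=> // g h _ _; rewrite mul1mx.
exists 1%N, (MxRepresentation triv); split=> // x v xa; rewrite tens_actE /tens_bal.
pose r g : W := repr (g *: KB B)%g.
have -> : [ffun w => (x w : K) *: v] = \sum_g (x g : K) *:
    (tens (gelt K (r g) * gelt K ((r g)^-1 * g)%g) v - tens (gelt K (r g)) v).
  under eq_bigr do rewrite scalerBr; rewrite sumrB.
  rewrite [X in _ - X](coset_sum0 (G := [group of <<KB_gens B>>%g])
    (fun g => tens (gelt K g) v)) ?subr0 => [|g]; last exact: annKW_coset clB xa.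
  under eq_bigr do rewrite -geltM mulKVg.
  apply/ffunP=> w; rewrite ffunE sum_ffunE (bigD1 w) //= big1 => [|g /negPf gw].
    by rewrite !ffunE eqxx scale1r addr0.
  by rewrite !ffunE eq_sym gw scale0r scaler0.
apply: lin_span_fin => g; exists (gelt K (r g)), ((r g)^-1 * g)%g, v; split.
  have [k kB gE] := repr_coset [group of <<KB_gens B>>%g] g.
  by rewrite {2}gE mulKg KBs.
by rewrite /= mul1mx.
Qed.

(** If a bar is missing, [bar_fix] gives z - 1 in Ann(e_B) with z outside Stab(B). In an induced
    module z v and v lie in different summands, so v would vanish. *)
Lemma admissible_closed B : ipfree B -> admissible a B -> bar_closed B.
Proof.
move=> fr [d [V [d0 adm]]]; apply/bar_closedP=> /has_barP[H HB barHB] H' H'B.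
apply: contraT => barH'; have dj : [disjoint supp one_neqN1 H & supp one_neqN1 H'].
  have /ipfreeP frB := fr; case: (ip0P (frB _ _ HB H'B)) => // E.
    by rewrite E barHB in barH'.
  by rewrite E barK HB in barH'.
have [z [zB zH']] := bar_fix a fr HB barHB dj.
have zN : z \notin stab B.
  by rewrite inE; apply: contraNneq barH' => <-; rewrite -zH' mem_cact.
pose v : 'cV[K]_d := const_mx 1.
(* The component at the identity coset, identified with V: a tensor h ⊗ v with h in Stab(B) goes to
   h v, so balanced tensors go to 0. *)
pose phi (t : {ffun W -> 'cV[K]_d}) := \sum_(g in stab B) V g *m t g.
have phi0 t : tens_bal V t -> phi t = 0.
  move=> tb; apply: (lin_span_ind (Q := fun t => phi t = 0) _ _ _ _ tb) =>
    [|t1 t2 E1 E2|c t1 E1|_ [x [h [u [hB ->]]]]].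
  - by rewrite /phi big1 // => g _; rewrite ffunE mulmx0.
  - rewrite -[RHS]addr0 -{1}E1 -E2 -big_split; apply: eq_bigr => g _.
    by rewrite ffunE mulmxDr.
  - rewrite -(scaler0 _ c) -E1 scaler_sumr; apply: eq_bigr => g _.
    by rewrite ffunE -scalemxAr.
  have ffunB (t1 t2 : {ffun W -> 'cV[K]_d}) g : (t1 - t2) g = t1 g - t2 g by rewrite !ffunE.
  rewrite /phi; under eq_bigr do rewrite ffunB mulmxBr; rewrite sumrB.
  rewrite (reindex_inj (mulIg h)) /=; apply/eqP; rewrite subr_eq0; apply/eqP.
  apply: eq_big => [g|g gB]; first by rewrite groupMr.
  rewrite [tens _ _ _]ffunE mulE_gelt mulgK [tens _ _ _]ffunE -!scalemxAr mulmxA repr_mxM //.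
  by rewrite -(groupMr _ hB).
have annx : annKW a B (gelt K z - 1).
  rewrite /annKW br_of_galgD -scaleN1r br_of_galgZ scaleN1r !br_of_gelt mulrBl zB.
  by rewrite brw1 mul1r subrr.
have /phi0 := adm _ v annx; rewrite tens_actE /phi (bigD1 1%g) ?group1 //= big1 => [|g /andP[gB /negPf g1]].
  rewrite !ffunE repr_mx1 mul1mx addr0; have -> : (1%g == z) = false.
    by apply: contraNF zN => /eqP<-; apply: group1.
  rewrite eqxx sub0r scaleN1r => /eqP; rewrite oppr_eq0 => /eqP/matrixP/(_ (Ordinal d0) 0)/eqP.
  by rewrite !mxE oner_eq0.
rewrite !ffunE g1 subr0; have -> : (g == z) = false by apply: contraNF zN => /eqP<-.
by rewrite scale0r mulmx0.
Qed.
End Admissibility.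

(** * Orders of the groups K_B *)

Section Orders.
Variables (C : fieldType) (n : nat).
Hypothesis one_neqN1 : (1 : C) != -1.
Local Notation W := (G22 C n).
Local Notation rep := (G22_rep C n).
Local Notation hyper := (hyper rep).
Local Notation sp := ('I_n * bool)%type.
Local Notation pt := (pt one_neqN1).
Local Notation rH := (rH one_neqN1).
Local Notation supp := (supp one_neqN1).
Local Notation bar := (bar one_neqN1).
Local Notation on := (on one_neqN1).
Local Notation ip := (ip one_neqN1).
Local Notation zH := (zH one_neqN1).
Local Notation th := (th one_neqN1).
Local Notation ipfree := (ipfree one_neqN1).
Local Notation closed_coll := (closed_coll one_neqN1).
Local Notation has_bar := (has_bar one_neqN1).
Implicit Types (w k : W) (H : hyper) (B D : {set hyper}) (x y : sp).

Definition supB B : {set 'I_n} := \bigcup_(H in B) supp H.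

Lemma supBP B i : reflect (exists2 H, H \in B & i \in supp H) (i \in supB B).
Proof. exact: bigcupP. Qed.

Lemma on_ip H H' x x' : [disjoint supp H & supp H'] ->
  x.1 \in supp H -> x'.1 \in supp H' -> forall g, on g x x' -> ip g H /\ ip g H'.
Proof.
move=> dj xH xH' g gxx; have gE := on_supp gxx.
have x'N : x'.1 \notin supp H by rewrite (disjointFl dj).
have xN : x.1 \notin supp H' by rewrite (disjointFr dj).
split; rewrite ipE.
  rewrite (_ : supp g :&: supp H = [set x.1]) ?cards1 //.
  apply/setP=> i; rewrite in_setI gE in_set2 in_set1.
  have [->|ix] := eqVneq i x.1; first by rewrite xH.
  by have [->|//] := eqVneq i x'.1; rewrite (negPf x'N).
rewrite (_ : supp g :&: supp H' = [set x'.1]) ?cards1 //.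
apply/setP=> i; rewrite in_setI gE in_set2 in_set1.
have [->|ix] := eqVneq i x'.1; first by rewrite orbT.
by have [->|//] := eqVneq i x.1; rewrite (negPf xN).
Qed.

Lemma link H H' : [disjoint supp H & supp H'] -> exists g, ip H g /\ ip H' g.
Proof.
move=> dj; have [x [y Hxy]] := on_any one_neqN1 H.
have [x' [y' Hxy']] := on_any one_neqN1 H'.
have xH := on_supp1 Hxy; have xH' := on_supp1 Hxy'.
have xx' : x.1 != x'.1 by apply: contraTneq xH => ->; rewrite (disjointFl dj).
have [g gxx] := on_ex one_neqN1 xx'; exists g.
by have [] := on_ip dj xH xH' gxx; rewrite ![ip g _]ip_sym.
Qed.

(** The four elements listed form a group that is transitive on the four signed points over the
    support. *)
Lemma pts4 H x y : x.1 \in supp H -> y.1 \in supp H ->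
  exists2 m, m \in [:: 1; rH H; zH H; rH H * zH H]%g & pt y m = x.
Proof.
move=> xH yH; have Hy := supp_on yH; set y1 := pt y _ in Hy.
have y1H : y1.1 \in supp H by rewrite (on_supp1 (y := y)) // on_sym.
move: xH; rewrite (on_supp Hy) in_set2 => /orP[]/eqP/esym/same_pt[]->.
- by exists 1%g; rewrite ?inE ?eqxx ?pt1.
- by exists (zH H); rewrite ?inE ?eqxx ?orbT // pt_zH yH.
- by exists (rH H); rewrite ?inE ?eqxx ?orbT.
by exists (rH H * zH H)%g; rewrite ?inE ?eqxx ?orbT // ptM pt_zH y1H.
Qed.

Lemma hact_fix w H : (forall x, x.1 \in supp H -> pt x w = x) -> hact w H = H.
Proof.
move=> E; apply/esym/(on_eq (one_neqN1 := one_neqN1)) => x y Hxy.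
by rewrite on_act !E ?(on_supp1 Hxy) // (on_supp1 (y := x)) // on_sym.
Qed.

Definition type1 B : bool := ipfree B && ~~ has_bar B.
(** The empty collection has both types; sums over closed collections count it under [type1]. *)
Definition type2 B : bool := ipfree B && [forall H in B, bar H \in B].

Lemma type1P B : reflect (ipfree B /\ {in B &, forall H H', H != H' ->
  [disjoint supp H & supp H']}) (type1 B).
Proof.
apply: (iffP andP) => [[fr nb]|[fr dj]]; split=> //.
  move=> H H' HB H'B HH'; have /ipfreeP frB := fr.
  case: (ip0P (frB _ _ HB H'B)) => // E; first by rewrite E eqxx in HH'.
  by case/has_barP: nb; exists H; rewrite // -E.
apply/has_barP=> -[H HB barHB]; have := dj _ _ HB barHB.
rewrite eq_sym bar_neq supp_bar -setI_eq0 setIid => /(_ isT)/eqP E.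
by have := card_supp one_neqN1 H; rewrite E cards0.
Qed.

Lemma type2P B : reflect (ipfree B /\ {in B, forall H, bar H \in B}) (type2 B).
Proof. by apply: (iffP andP) => -[fr] => [/forall_inP|E]; split=> //; apply/forall_inP. Qed.

Lemma type1_closed B : type1 B -> closed_coll B.
Proof. by case/andP=> fr nb; rewrite /(closed_coll _) fr /bar_closed (negPf nb). Qed.

Lemma type2_closed B : type2 B -> closed_coll B.
Proof. by case/andP=> fr E; rewrite /(closed_coll _) fr /bar_closed E implybT. Qed.

Lemma type1_sub B D : B \subset D -> type1 D -> type1 B.
Proof.
move=> /subsetP BD /type1P[/ipfreeP fr dj]; apply/type1P; split.
  by apply/ipfreeP=> H H' HB H'B; rewrite fr ?BD.
by move=> H H' HB H'B; apply: dj; apply: BD.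
Qed.

Lemma type2_supp D H H' : type2 D -> H \in D -> H' \in D -> H' != H -> H' != bar H ->
  [disjoint supp H & supp H'].
Proof.
move=> /type2P[/ipfreeP fr _] HD H'D n1 n2; case: (ip0P (fr _ _ HD H'D)) => // E;
by rewrite E eqxx in n1 n2.
Qed.

Definition pt_action : {action W &-> sp} := TotalAction (pt1 one_neqN1) (ptM one_neqN1).

Lemma wperm1 (i : 'I_n) : wperm one_neqN1 1%g i = i.
Proof. by have := pt1 one_neqN1 (i, false); rewrite /(pt _ _) => -[]. Qed.

Lemma wpermM (i : 'I_n) w1 w2 :
  wperm one_neqN1 (w1 * w2)%g i = wperm one_neqN1 w2 (wperm one_neqN1 w1 i).
Proof. by have := ptM one_neqN1 (i, false) w1 w2; rewrite /(pt _ _) => -[]. Qed.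

Definition idx_action : {action W &-> 'I_n} :=
  @TotalAction _ _ (fun i w => wperm one_neqN1 w i) wperm1 wpermM.

Lemma pt_wperm x w : (pt x w).1 = wperm one_neqN1 w x.1. Proof. by []. Qed.

(* If B contains no pair H, bar H then KB B has index 2 in L1 B; if B is stable
   under bar then KB B = L2 B. *)
Definition L1 B : {set W} :=
  [set w in stab B | [forall x, (x.1 \notin supB B) ==> (pt x w == x)]].

Definition L2 B : {set W} :=
  [set w in stab B | [forall i, (i \notin supB B) ==> (wperm one_neqN1 w i == i)]].

Lemma L1P B w : reflect (cact w B = B /\ forall x, x.1 \notin supB B -> pt x w = x)
  (w \in L1 B).
Proof.
rewrite inE inE; apply: (iffP andP) => -[E1 E2].
  split=> [|x xB]; first exact/eqP.
  by move/forallP/(_ x)/implyP/(_ xB)/eqP: E2.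
by rewrite E1; split=> //; apply/forallP=> x; apply/implyP=> /E2->.
Qed.

Lemma L2P B w : reflect (cact w B = B /\
    forall i, i \notin supB B -> wperm one_neqN1 w i = i) (w \in L2 B).
Proof.
rewrite inE inE; apply: (iffP andP) => -[E1 E2].
  split=> [|i iB]; first exact/eqP.
  by move/forallP/(_ i)/implyP/(_ iB)/eqP: E2.
by rewrite E1; split=> //; apply/forallP=> x; apply/implyP=> /E2->.
Qed.

Lemma L1_group_set B : group_set (L1 B).
Proof.
apply/group_setP; split; first by apply/L1P; rewrite cact1; split=> // x; rewrite pt1.
move=> v w /L1P[E1 E2] /L1P[E3 E4]; apply/L1P; rewrite cactM E3 E1; split=> // x xB.
by rewrite ptM E2 // E4.
Qed.
Canonical L1_group B := Group (L1_group_set B).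

Lemma L2_group_set B : group_set (L2 B).
Proof.
apply/group_setP; split; first by apply/L2P; rewrite cact1; split=> // x; rewrite wperm1.
move=> v w /L2P[E1 E2] /L2P[E3 E4]; apply/L2P; rewrite cactM E3 E1; split=> // x xB.
by rewrite wpermM E2 // E4.
Qed.
Canonical L2_group B := Group (L2_group_set B).

Lemma in_supB H B i : H \in B -> i \in supp H -> i \in supB B.
Proof. by move=> HB iH; apply/supBP; exists H. Qed.

Lemma th_pair_fix H1 H2 H0 x : [disjoint supp H1 & supp H2] ->
    ip H1 H0 -> ip H2 H0 -> x.1 \notin supp H1 -> x.1 \notin supp H2 ->
  pt x (th H1 H0) = x /\ pt x (th H2 H0) = x.
Proof.
move=> dj i1 i2 n1 n2; have n0 : x.1 \notin supp H0.
  apply/negP=> x0; have := ip_supp_sub dj _ _ x0; rewrite ![ip H0 _]ip_sym i1 i2.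
  by rewrite (negPf n1) (negPf n2) => /(_ isT isT).
by split; rewrite pt_notin // supp_ip1 // (negPf n0) ?(negPf n1) ?(negPf n2).
Qed.

(** The memberships in the product case serve properties such as the vanishing of [sgnD], which is
    additive only on elements stabilising D. *)
Lemma KB_ind (P : W -> Prop) D : closed_coll D -> P 1%g ->
    (forall v w, v \in KB D -> w \in KB D -> P v -> P w -> P (v * w)%g) ->
    (forall H, H \in D -> P (rH H)) ->
    (forall H1 H2 H0, H1 \in D -> H2 \in D -> ip H1 H0 -> ip H2 H0 ->
       H1 != H2 -> P (th H2 H0 * th H1 H0)%g) ->
  forall w, w \in KB D -> P w.
Proof.
move=> clD P1 PM Pr Pth; have /andP[fr _] := clD.
pose G := [set w in KB D | `[< P w >]].
have gG : group_set G.
  apply/group_setP; split; first by rewrite inE group1; apply/asboolP.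
  move=> v w; rewrite !inE => /andP[vD /asboolP Pv] /andP[wD /asboolP Pw].
  by rewrite groupM //; apply/asboolP/PM.
suff sub : KB D \subset Group gG.
  by move=> w /(subsetP sub); rewrite inE => /andP[_ /asboolP].
rewrite gen_subG; apply/subsetP=> g gD; rewrite inE mem_gen //=; apply/asboolP.
case/(KB_gensP one_neqN1): gD => [[H HD ->]|[s1 [s2 [s1r s2r E1 E2 [_ ->]]]]]; first exact: Pr.
have [H1 [H2 [H0 [H1B H2B _ [ip1 ip2] [-> ->]]]]] := KB_gens_th one_neqN1 s1r s2r E1 E2.
rewrite thV; have [->|H12] := eqVneq H1 H2; first by rewrite rHK.
exact: Pth.
Qed.

Lemma KB_L1 D : type1 D -> KB D \subset L1 D.
Proof.
move=> tD; have clD := type1_closed tD; have /andP[fr _] := clD.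
have /type1P[_ dj] := tD; have KBs := subsetP (KB_sub_stab fr).
apply/subsetP=> w wD; apply/L1P; split.
  by have := KBs w wD; rewrite inE => /eqP.
move: w wD; apply: (KB_ind clD) =>
  [x _|v w _ _ Ev Ew x xD|H HD x xD|H1 H2 H0 H1D H2D i1 i2 H12 x xD].
- by rewrite pt1.
- by rewrite ptM Ev // Ew.
- by rewrite pt_notin //; apply: contra xD; apply: in_supB.
have n1 : x.1 \notin supp H1 by apply: contra xD; apply: in_supB.
have n2 : x.1 \notin supp H2 by apply: contra xD; apply: in_supB.
by have [E1 E2] := th_pair_fix (dj _ _ H1D H2D H12) i1 i2 n1 n2; rewrite ptM E2 E1.
Qed.

Lemma zH_stab D H : ipfree D -> H \in D -> cact (zH H) D = D.
Proof.
move=> /ipfreeP fr HD; apply/eqP; rewrite eqEcard card_cact leqnn andbT.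
by apply/subsetP=> _ /imsetP[H' H'D ->]; rewrite zH_act fr.
Qed.

Lemma zH_L1 D H : ipfree D -> H \in D -> zH H \in L1 D.
Proof.
move=> fr HD; apply/L1P; split=> [|x xD]; first exact: zH_stab.
by rewrite pt_zH ifN //; apply: contra xD; apply: in_supB.
Qed.

Definition Q1 D : {group W} := [group of <<KB D :|: [set zH H | H in D]>>%g].

Lemma Q1_L1 D : type1 D -> Q1 D \subset L1 D.
Proof.
move=> tD; rewrite gen_subG subUset KB_L1 //=.
apply/subsetP=> _ /imsetP[H HD ->]; apply: zH_L1 => //.
by case/andP: tD.
Qed.

Lemma KB_Q1 D : KB D \subset Q1 D.
Proof. by apply: subset_trans (subsetUl _ _) (subset_gen _). Qed.

Lemma zH_Q1 D H : H \in D -> zH H \in Q1 D.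
Proof. by move=> HD; rewrite mem_gen // inE; apply/orP; right; apply: imset_f. Qed.

Lemma KB_swap D H H' : closed_coll D -> H \in D -> H' \in D ->
    [disjoint supp H & supp H'] ->
  exists2 k, k \in KB D & hact k H = H'.
Proof.
move=> clD HD H'D dj; have [g [i1 i2]] := link dj.
exists ((th H' g)^-1 * th H g)%g; first exact: KB_th.
by rewrite hactM th_act // thV th_actV.
Qed.

Lemma KB_move D H x y : closed_coll D -> ipfree D -> H \in D ->
    x.1 \in supp H -> y.1 \in supB D ->
  exists2 k, k \in KB D & (pt y k).1 \in supp H.
Proof.
move=> clD /ipfreeP fr HD xH /supBP[H' H'D yH'].
have [dj|E|E] := ip0P (fr _ _ HD H'D); last 2 first.
- by exists 1%g; rewrite ?group1 // pt1 -E.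
- by exists 1%g; rewrite ?group1 // pt1 -(supp_bar one_neqN1) -E.
have [k kD kH] := KB_swap clD HD H'D dj; exists k => //.
by rewrite pt_wperm; move: yH'; rewrite -kH supp_act.
Qed.

Lemma Q1_trans D H x y : type1 D -> H \in D -> x.1 \in supp H -> y.1 \in supB D ->
  exists2 q, q \in Q1 D & pt y q = x.
Proof.
move=> tD HD xH yD; have clD := type1_closed tD; have /andP[fr _] := clD.
have [k kD kyH] := KB_move clD fr HD xH yD.
have [m mS mx] := pts4 xH kyH; exists (k * m)%g; last by rewrite ptM.
apply: groupM; first by apply: (subsetP (KB_Q1 D)).
have rQ : rH H \in Q1 D by apply: (subsetP (KB_Q1 D)); apply: rH_KB.
have zQ := zH_Q1 HD.
by move: mS; rewrite !inE => /or4P[]/eqP->;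
  [apply: group1 | apply: rQ | apply: zQ | apply: (groupM rQ zQ)].
Qed.

Lemma hact_eq w H1 H2 : (hact w^-1%g H1 == H2) = (H1 == hact w H2).
Proof. by apply/eqP/eqP => [<-|->]; rewrite -hactM ?mulgV ?mulVg hact1. Qed.

(** Supports being disjoint, [H] is the only member over [x]. An element of [L1 D] fixing [x]
    therefore fixes [H], hence also the partner of [x] and all four points. *)
Lemma stab_L1 D H x : type1 D -> H \in D -> x.1 \in supp H ->
  'C_(L1 D)[x | pt_action]%g = L1 (D :\ H).
Proof.
move=> tD HD xH; have /type1P[fr dj] := tD; have /andP[_ nb] := tD.
have Hx := supp_on xH; set x1 := pt x _ in Hx.
have HN i : i \in supp H -> i \notin supB (D :\ H).
  move=> iH; apply/supBP=> -[H']; rewrite in_setD1 => /andP[H'H H'D].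
  by apply/negP; rewrite (disjointFr (dj _ _ HD H'D _)) // eq_sym.
have DE i : (i \in supB D) = (i \in supp H) || (i \in supB (D :\ H)).
  apply/supBP/orP => [[H' H'D iH']|[iH|/supBP[H']]].
  - have [E|H'H] := eqVneq H' H; first by left; rewrite -E.
    by right; apply/supBP; exists H'; rewrite // in_setD1 H'H.
  - by exists H.
  by rewrite in_setD1 => /andP[_ H'D]; exists H'.
apply/setP=> w; apply/setIP/L1P => [[/L1P[E1 E2] /astab1P /= wx]|[E1 E2]].
  have wH : hact w H = H.
    have w_in : hact w H \in D by rewrite -E1 mem_cact.
    have wHx : x.1 \in supp (hact w H).
      by rewrite (on_supp1 (y := pt x1 w^-1%g)) // on_act wx ptVK.
    apply/eqP; apply: contraT => wHH; have := dj _ _ w_in HD wHH.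
    by move/disjointFr/(_ wHx); rewrite xH.
  split.
    apply/setP=> H'; rewrite in_cact !in_setD1 -in_cact E1; congr (_ && _).
    by rewrite hact_eq wH.
  move=> y yN; have [yH|yH] := boolP (y.1 \in supp H); last first.
    by apply: E2; rewrite DE negb_or yH.
  have x1w : pt x1 w = x1.
    by apply: (on_fun (x := x) (H := H)) => //; rewrite -{1}wx -on_act wH.
  move: yH; rewrite (on_supp Hx) in_set2 => /orP[]/eqP/esym/same_pt[]->;
  by rewrite ?pt_neg ?wx ?x1w.
have wfix y : y.1 \in supp H -> pt y w = y by move=> yH; apply/E2/HN.
have wH : hact w H = H by apply: hact_fix.
split; last by apply/astab1P; rewrite /= wfix.
apply/L1P; split=> [|y]; last by rewrite DE negb_or => /andP[_ /E2].
apply/setP=> H'; rewrite in_cact; have [->|H'H] := eqVneq H' H.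
  by rewrite -{1}wH -hactM mulVg hact1.
have : H' \in D :\ H = (hact w^-1%g H' \in D :\ H) by rewrite -in_cact E1.
rewrite !in_setD1 H'H /= => ->; by rewrite hact_eq wH H'H.
Qed.

Lemma card_supB1 B : type1 B -> #|supB B| = (2 * #|B|)%N.
Proof.
move=> /type1P[_ dj]; rewrite /supB.
have [r] := ubnP #|B|; elim: r B dj => // r IHr B dj.
have [->|/set0Pn[H HB]] := eqVneq B set0; first by rewrite big_set0 !cards0.
rewrite ltnS (cardsD1 H) HB add1n => Br; rewrite (big_setD1 H) //= cardsU card_supp.
rewrite IHr //; last by move=> H1 H2; rewrite !in_setD1 => /andP[_ h1] /andP[_ h2]; apply: dj.
rewrite (_ : _ :&: _ = set0) ?cards0 ?subn0 ?mulnS //; apply/eqP; rewrite setI_eq0.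
apply/bigcup_disjointP=> H'; rewrite in_setD1 => /andP[H'H H'B].
by apply: dj; rewrite // eq_sym.
Qed.

Lemma L1_0 : L1 set0 = 1%g.
Proof.
apply/setP=> w; rewrite in_set1; apply/L1P/eqP => [[_ E]|->].
  apply: pt_eq one_neqN1 _ _ _ => x; rewrite pt1 E //.
  by apply/supBP=> -[H]; rewrite inE.
by rewrite cact1; split=> // x _; rewrite pt1.
Qed.

(** The orbit of a point consists of all 4|D| signed points over D, with stabiliser [L1] of a
    collection smaller by one; this gives the order. [Q1 D] is already transitive and by induction
    contains that stabiliser, so it is all of [L1 D]. *)
Lemma L1_Q1 D : type1 D -> L1 D = Q1 D /\ #|L1 D| = (4 ^ #|D| * #|D|`!)%N.
Proof.
have [r] := ubnP #|D|; elim: r D => // r IHr D Dr tD.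
have [D0|/set0Pn[H HD]] := eqVneq D set0.
  split; last by rewrite D0 L1_0 cards1 cards0.
  apply/eqP; rewrite eqEsubset Q1_L1 // andbT D0 L1_0 sub1G.
  by [].
have DH1 : #|D| = #|D :\ H|.+1 by rewrite (cardsD1 H) HD.
have tB : type1 (D :\ H) by apply: type1_sub tD; apply: subsetDl.
have [|IH1 IH2] := IHr (D :\ H) _ tB; first by rewrite -ltnS -DH1.
have [x xH] : exists x : sp, x.1 \in supp H.
  by have [x [y /on_supp1]] := on_any one_neqN1 H; exists x.
have stE := stab_L1 tD HD xH.
have orbE : orbit pt_action (L1 D) x = [set y : sp | y.1 \in supB D].
  apply/setP=> y; rewrite [RHS]inE; apply/orbitP/idP => [[w /L1P[E1 E2] <-]|yD].
    apply: contraT => yN; have := E2 _ yN; move/(@pt_inj _ _ one_neqN1 w) => E.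
    by rewrite E (in_supB HD xH) in yN.
  have [q qQ qy] := Q1_trans tD HD xH yD; exists q^-1%g; last by rewrite /= -qy ptK.
  by rewrite groupV (subsetP (Q1_L1 tD)).
split; last first.
  have := card_orbit_stab pt_action [group of L1 D] x; rewrite /= orbE stE IH2 => <-.
  have -> : [set y : sp | y.1 \in supB D] = setX (supB D) [set: bool].
    by apply/setP=> -[i b]; rewrite !inE andbT.
  rewrite cardsX card_supB1 // cardsT card_bool DH1 factS expnS.
  lia.
apply/eqP; rewrite eqEsubset Q1_L1 // andbT; apply/subsetP=> w wL.
have yD : (pt x w^-1%g).1 \in supB D.
  have : pt x w^-1%g \in orbit pt_action (L1 D) x by apply: mem_orbit; rewrite groupV.
  by rewrite orbE inE.
have [q qQ qy] := Q1_trans tD HD xH yD.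
have qw : (q^-1 * w)%g \in Q1 D.
  have : (q^-1 * w)%g \in 'C_(L1 D)[x | pt_action]%g.
    apply/setIP; split; last apply/astab1P.
      by apply: groupM wL; rewrite groupV (subsetP (Q1_L1 tD)).
    by rewrite /= ptM -{1}qy ptK ptVK.
  rewrite stE IH1; apply/subsetP; rewrite gen_subG subUset; apply/andP; split.
    apply: subset_trans (KB_Q1 D); apply: KB_mono; rewrite ?type1_closed //.
    exact: subsetDl.
  by apply/subsetP=> _ /imsetP[H' +  ->]; rewrite in_setD1 => /andP[_ H'D]; apply: zH_Q1.
by rewrite -[w](mulKVg q) groupM.
Qed.
End Orders.

(** * Collections stable under bar, and the parity character in the unpaired case *)

Section PairedOrders.
Variables (C : fieldType) (n : nat).
Hypothesis one_neqN1 : (1 : C) != -1.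
Local Notation W := (G22 C n).
Local Notation rep := (G22_rep C n).
Local Notation hyper := (hyper rep).
Local Notation sp := ('I_n * bool)%type.
Local Notation pt := (pt one_neqN1).
Local Notation rH := (rH one_neqN1).
Local Notation supp := (supp one_neqN1).
Local Notation bar := (bar one_neqN1).
Local Notation on := (on one_neqN1).
Local Notation ip := (ip one_neqN1).
Local Notation zH := (zH one_neqN1).
Local Notation th := (th one_neqN1).
Local Notation closed_coll := (closed_coll one_neqN1).
Local Notation wperm := (wperm one_neqN1).
Local Notation supB := (supB one_neqN1).
Local Notation type1 := (type1 one_neqN1).
Local Notation type2 := (type2 one_neqN1).
Local Notation L1 := (L1 one_neqN1).
Local Notation L2 := (L2 one_neqN1).
Local Notation idx_action := (@idx_action C n one_neqN1).
Implicit Types (w k : W) (H : hyper) (B D : {set hyper}) (x y : sp).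

(** The reflections in [g] and [bar g] send [H] and [bar H] to one hyperplane, so their product is
    of the form treated in [KB_th]. *)
Lemma zH_KB D H g : closed_coll D -> H \in D -> bar H \in D -> ip g H ->
  zH g \in KB D.
Proof.
move=> clD HD barHD ipgH; pose H0 := hact (rH g) H.
have neq (g1 K1 : hyper) : ip g1 K1 -> hact (rH g1) K1 != K1.
  by move=> i1; apply/eqP=> E; have := ip_ip1 K1 i1; rewrite E ipp i1.
have barE : hact (rH (bar g)) (bar H) = H0.
  have := zH_act one_neqN1 g H; rewrite ipgH zHC hactM => <-.
  by rewrite -hactM rHK hact1.
have [ip1 E1] := refl_th one_neqN1 (rH_refl one_neqN1 g) (erefl H0) (neq _ _ ipgH).
have H0b : H0 != bar H by rewrite -barE; apply: neq; rewrite ip_barl ip_bar.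
have [ip2 E2] := refl_th one_neqN1 (rH_refl one_neqN1 (bar g)) barE H0b.
by rewrite zHC E1 E2 -[X in (X * _)%g]thV KB_th.
Qed.

Lemma zH_eq (g g1 g2 : hyper) : (forall i, (i \in supp g) = (i \in supp g1) (+) (i \in supp g2)) ->
  zH g = (zH g1 * zH g2)%g.
Proof.
move=> E; apply: pt_eq one_neqN1 _ _ _ => x; rewrite ptM !pt_zH E.
by case: (x.1 \in supp g1) => /=; case: (x.1 \in supp g2); rewrite /= ?negK.
Qed.

(** If the support of [g] avoids that of [H], an index u of [H] serves as an intermediate: changing
    the signs at x and u and then at y and u changes them at x and y. *)
Lemma zH_KB2 D H g : type2 D -> H \in D -> zH g \in KB D.
Proof.
move=> tD HD; have clD := type2_closed tD; have /type2P[fr barD] := tD.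
have barHD := barD _ HD; case i1: (ip g H); first exact: zH_KB i1.
have zD : zH H \in KB D by rewrite groupM // rH_KB.
case: (ip0P i1) => [dj|E|E].
- have [x [y gxy]] := on_any one_neqN1 g; have [u [v Huv]] := on_any one_neqN1 H.
  have uH := on_supp1 Huv; have xg := on_supp1 gxy.
  have yg : y.1 \in supp g by rewrite (on_supp1 (y := x)) // on_sym.
  have out t : t \in supp g -> t != u.1.
    by move=> tg; apply: contraTneq tg => ->; rewrite (disjointFl dj uH).
  have [g1 g1xu] := on_ex one_neqN1 (out _ xg); have [g2 g2yu] := on_ex one_neqN1 (out _ yg).
  have ipg (g' : hyper) t : t.1 \in supp g -> on g' t u -> ip g' H.
    by move=> tg g't; have [] := on_ip dj tg uH g't.
  have -> : zH g = (zH g1 * zH g2)%g; last first.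
    by apply: groupM; apply: (zH_KB clD HD barHD); [apply: ipg g1xu|apply: ipg g2yu].
  apply: zH_eq.
  move=> i; rewrite (on_supp gxy) (on_supp g1xu) (on_supp g2yu) !in_set2.
  have [->|ix] := eqVneq i x.1; first by rewrite (negPf (on_ne gxy)) (negPf (out _ xg)).
  have [->|iy] /= := eqVneq i y.1; first by rewrite (negPf (out _ yg)).
  by rewrite addbb.
- by rewrite -E.
by rewrite -[g](barK one_neqN1) -E zHC barK; rewrite groupM // rH_KB.
Qed.

Lemma L2_0 w : w \in L2 set0 -> forall i, wperm w i = i.
Proof. by case/L2P=> _ E i; apply: E; apply/supBP=> -[H]; rewrite inE. Qed.

Lemma L2_0I w : (forall i, wperm w i = i) -> w \in L2 set0.
Proof.
by move=> E; apply/L2P; split=> [|i _ //]; rewrite /cact imset0.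
Qed.

(** [L2 set0] consists of the pure sign changes. Their number of signs is even, so they can be
    undone two at a time. *)
Lemma sign_group_sub (G : {group W}) : (forall g, zH g \in G) -> L2 set0 \subset G.
Proof.
move=> zG; apply/subsetP=> w wZ; have fix_idx x : (pt x w).1 = x.1 by apply: L2_0.
have [m] := ubnP #|[set i : 'I_n | pt (i, false) w != (i, false)]|.
elim: m w fix_idx {wZ} => // m IHm w fix_idx; set S := [set i | _] => Sm.
have [S0|/set0Pn[i iS]] := eqVneq S set0.
  suff -> : w = 1%g by apply: group1.
  apply: pt_eq one_neqN1 _ _ _ => x; rewrite pt1.
  have : x.1 \notin S by rewrite S0 inE.
  rewrite inE negbK => /eqP E; have [->|->] := @same_pt n (x.1, false) x erefl => //.
  by rewrite pt_neg E.
have /set0Pn[j] : S :\ i != set0.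
  rewrite -card_gt0; have := moved_even fix_idx; rewrite -/S (cardsD1 i) iS.
  by case: #|_|.
rewrite in_setD1 => /andP[ji jS]; have ij' : (i, false).1 != (j, false).1 by rewrite eq_sym.
have [g gij] := on_ex one_neqN1 ij'.
have neg_pt (k : 'I_n) : k \in S -> pt (k, false) w = neg (k, false).
  by rewrite inE eq_sym => /negb1; apply; rewrite fix_idx.
rewrite -[w](mulgK (zH g)) groupM ?groupV // IHm // => [x|].
  by rewrite ptM pt_zH; case: ifP => _; rewrite -[LHS]/((pt x w).1) fix_idx.
rewrite -ltnS; apply: leq_trans Sm; rewrite ltnS; apply/proper_card/properP; split.
  apply/subsetP=> k; rewrite inE ptM pt_zH fix_idx /= (on_supp gij) in_set2 /=.
  by case: ifP => [/orP[]/eqP->|_] //; rewrite inE.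
exists i => //; rewrite inE ptM pt_zH fix_idx (on_supp1 gij) neg_pt // negK.
by rewrite eqxx.
Qed.

Lemma KB_L2 D : type2 D -> KB D \subset L2 D.
Proof.
move=> tD; have clD := type2_closed tD; have /andP[fr _] := clD.
have KBs := subsetP (KB_sub_stab fr).
apply/subsetP=> w wD; apply/L2P; split.
  by have := KBs w wD; rewrite inE => /eqP.
move: w wD; apply: (KB_ind clD) =>
  [i _|v w _ _ Ev Ew i iD|H HD i iD|H1 H2 H0 H1D H2D i1 i2 H12 i iD].
- by rewrite wperm1.
- by rewrite wpermM Ev // Ew.
- by rewrite -(@pt_wperm _ _ _ (i, false)) pt_notin //; apply: contra iD; apply: in_supB.
rewrite -(@pt_wperm _ _ _ (i, false)); have [E|H2b] := eqVneq H2 (bar H1).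
  by rewrite E th_bar // -zHC pt_zH; case: ifP.
rewrite eq_sym in H12; have dj := type2_supp tD H1D H2D H12 H2b.
have n1 : (i, false).1 \notin supp H1 by apply: contra iD; apply: in_supB.
have n2 : (i, false).1 \notin supp H2 by apply: contra iD; apply: in_supB.
by have [E1 E2] := th_pair_fix dj i1 i2 n1 n2; rewrite ptM E2 E1.
Qed.

Definition Q2 D : {group W} := [group of <<KB D :|: L2 set0>>%g].

Lemma L20_sub D : type2 D -> L2 set0 \subset L2 D.
Proof.
move=> /type2P[fr barD]; apply/subsetP=> w wZ; have wi := L2_0 wZ.
apply/L2P; split=> [|i _]; last exact: wi.
apply/eqP; rewrite eqEcard card_cact leqnn andbT.
apply/subsetP=> _ /imsetP[H HD ->]; have : supp H = supp (hact w H).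
  by apply/setP=> i; rewrite supp_act pt_wperm wi.
by case/same_supp=> -> //; apply: barD.
Qed.

Lemma Q2_L2 D : type2 D -> Q2 D \subset L2 D.
Proof. by move=> tD; rewrite gen_subG subUset KB_L2 // L20_sub. Qed.

Lemma KB_Q2 D : KB D \subset Q2 D.
Proof. by apply: subset_trans (subsetUl _ _) (subset_gen _). Qed.

Lemma Q2_trans D H i j : type2 D -> H \in D -> i \in supp H -> j \in supB D ->
  exists2 q, q \in KB D & wperm q j = i.
Proof.
move=> tD HD iH jD; have clD := type2_closed tD; have /andP[fr _] := clD.
have [k kD kjH] := @KB_move _ _ _ _ _ (i, false) (j, false) clD fr HD iH jD.
have [m mS mx] := @pts4 _ _ _ H (i, false) _ iH kjH.
exists (k * m)%g; last by rewrite -(@pt_wperm _ _ _ (j, false)) ptM mx.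
apply: groupM => //; have rQ := rH_KB one_neqN1 HD; have zQ := zH_KB2 H tD HD.
by move: mS; rewrite !inE => /or4P[]/eqP->;
  [apply: group1 | apply: rQ | apply: zQ | apply: (groupM rQ zQ)].
Qed.

Definition cut D H := D :\ H :\ bar H.

Lemma in_cut D H H' : (H' \in cut D H) = [&& H' != bar H, H' != H & H' \in D].
Proof. by rewrite in_setD1 in_setD1. Qed.

Lemma cut_type2 D H : type2 D -> type2 (cut D H).
Proof.
move=> /type2P[/ipfreeP fr barD]; apply/type2P; split.
  by apply/ipfreeP=> H1 H2; rewrite !in_setD1 => /and3P[_ _ h1] /and3P[_ _ h2]; apply: fr.
move=> H1; rewrite in_cut => /and3P[n1 n2 h1]; rewrite in_cut; apply/and3P; split.
- by rewrite (inj_eq (@bar_inj _ _ one_neqN1)).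
- by apply: contraNneq n1 => <-; rewrite barK.
exact: barD.
Qed.

Lemma card_cut D H : type2 D -> H \in D -> #|D| = #|cut D H|.+2.
Proof.
move=> /type2P[_ barD] HD; rewrite (cardsD1 H) HD (cardsD1 (bar H)) in_setD1 bar_neq.
by rewrite barD.
Qed.

Lemma supB_cut D H : type2 D -> H \in D ->
  (forall i, (i \in supB D) = (i \in supp H) || (i \in supB (cut D H))) /\
  (forall i, i \in supp H -> i \notin supB (cut D H)).
Proof.
move=> tD HD; split=> i; last first.
  move=> iH; apply/supBP=> -[H']; rewrite in_cut => /and3P[n1 n2 H'D].
  by rewrite (disjointFr (type2_supp tD HD H'D n2 n1)).
apply/supBP/orP => [[H' H'D iH']|[iH|/supBP[H']]].
- have [E|H'H] := eqVneq H' H; first by left; rewrite -E.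
  have [E|H'b] := eqVneq H' (bar H); first by left; rewrite -(supp_bar one_neqN1) -E.
  by right; apply/supBP; exists H'; last exact: iH'; rewrite in_cut; apply/and3P.
- by exists H.
by rewrite in_cut => /and3P[_ _ H'D]; exists H'.
Qed.

Lemma card_supB2 D : type2 D -> #|supB D| = #|D|.
Proof.
have [r] := ubnP #|D|; elim: r D => // r IHr D Dr tD.
have [->|/set0Pn[H HD]] := eqVneq D set0.
  by rewrite /(supB _) big_set0 !cards0.
have [E1 E2] := supB_cut tD HD; have cD := card_cut tD HD.
have -> : supB D = supp H :|: supB (cut D H) by apply/setP=> i; rewrite inE E1.
rewrite cardsU card_supp IHr ?cut_type2 //; last by move: Dr; rewrite cD ltnS => /ltnW.
rewrite (_ : _ :&: _ = set0) ?cards0 ?subn0 ?cD //; apply/setP=> i; rewrite !inE.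
by apply/negP=> /andP[+ iB]; move: iB => /[swap] iH; apply/negP/E2; rewrite inE.
Qed.

Lemma type2_even D : type2 D -> ~~ odd #|D|.
Proof.
have [r] := ubnP #|D|; elim: r D => // r IHr D Dr tD.
have [->|/set0Pn[H HD]] := eqVneq D set0; first by rewrite cards0.
have cD := card_cut tD HD; rewrite cD /= negbK IHr ?cut_type2 //.
by move: Dr; rewrite cD ltnS => /ltnW.
Qed.

Lemma cact_setD1 w D H : cact w (D :\ H) = cact w D :\ hact w H.
Proof. by apply/setP=> H'; rewrite in_setD1 !in_cact in_setD1 hact_eq. Qed.

(** Only [H] and [bar H] cover the index i, so an element of [L2 D] fixing i preserves their common
    support and must fix its second index too. *)
Lemma stab_L2 D H i : type2 D -> H \in D -> i \in supp H ->
  'C_(L2 D)[i | idx_action]%g = L2 (cut D H).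
Proof.
move=> tD HD iH; have [DE HN] := supB_cut tD HD; have /type2P[fr barD] := tD.
have barH := barD _ HD.
have cutE w : hact w H = H \/ hact w H = bar H ->
    (cact w (cut D H) = cut D H <-> cact w D = D).
  move=> wH; have wcut : cact w (cut D H) = cut (cact w D) H.
    rewrite /cut !cact_setD1 bar_act; case: wH => ->; first by [].
    by rewrite barK !setDDl [_ |: _]setUC.
  have DE' : D = H |: (bar H |: cut D H).
    by rewrite /cut !setD1K // in_setD1 barH andbT bar_neq.
  split=> E; last by rewrite wcut E.
  rewrite {1}DE' /cact !imsetU1 -/(cact w _) E bar_act.
  case: wH => ->; first by rewrite -DE'.
  by rewrite barK setUCA -DE'.
apply/setP=> w; apply/setIP/L2P => [[/L2P[E1 E2] /astab1P /= wi]|[E1 E2]].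
  have iwH : i \in supp (hact w H) by rewrite supp_act pt_wperm wi.
  have w_in : hact w H \in D by rewrite -E1 mem_cact.
  have wH : hact w H = H \/ hact w H = bar H.
    have [|n1] := eqVneq (hact w H) H; first by left.
    have [|n2] := eqVneq (hact w H) (bar H); first by right.
    by have := disjointFr (type2_supp tD HD w_in n1 n2) iH; rewrite iwH.
  split; first exact/cutE.
  move=> j jN; have [jH|jH] := boolP (j \in supp H); last by rewrite E2 // DE negb_or jH.
  have suppE : supp (hact w H) = supp H by case: wH => ->; rewrite ?supp_bar.
  have : j \in supp (hact w H) by rewrite suppE.
  rewrite supp_act pt_wperm /= => wjH.
  have [->|ji] := eqVneq j i; first by rewrite wi.
  have /cards1P[k kE] : #|supp H :\ i| == 1%N.
    by have := cardsD1 i (supp H); rewrite iH card_supp add1n => -[<-].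
  have /set1P jk : j \in [set k] by rewrite -kE in_setD1 ji.
  have /set1P wjk : wperm w j \in [set k].
    by rewrite -kE in_setD1 wjH andbT -[X in _ != X]wi (inj_eq perm_inj).
  by rewrite wjk jk.
have wH : hact w H = H \/ hact w H = bar H.
  apply: same_supp; apply/setP=> j; rewrite supp_act pt_wperm /=.
  have [jH|jH] := boolP (j \in supp H); first by rewrite E2 ?HN.
  have [jB|jB] := boolP (j \in supB (cut D H)); last by rewrite E2 // (negPf jH).
  apply/esym/negbTE/negP=> wjH; have := E2 _ (HN _ wjH) => /perm_inj wj.
  by rewrite wj (negPf jH) in wjH.
split; last by apply/astab1P; rewrite /= E2 ?HN.
apply/L2P; split; first exact/cutE.
by move=> j; rewrite DE negb_or => /andP[_ /E2].
Qed.

(** As in [L1_Q1], but on indices: r pairs cover 2r indices forming one orbit, each step contributes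
    a factor 2r, and the recursion ends at the group of pure sign changes. *)
Lemma L2_Q2 D : type2 D ->
  L2 D = Q2 D /\ #|L2 D| = (#|L2 (set0 : {set hyper})| * (2 ^ #|D|./2 * (#|D|./2)`!))%N.
Proof.
have [r] := ubnP #|D|; elim: r D => // r IHr D Dr tD.
have [D0|/set0Pn[H HD]] := eqVneq D set0.
  split; last by rewrite D0 cards0 muln1.
  apply/eqP; rewrite eqEsubset Q2_L2 // andbT D0.
  exact: subset_trans (subsetUr _ _) (subset_gen _).
have cD := card_cut tD HD; have tB := cut_type2 H tD.
have [|IH1 IH2] := IHr (cut D H) _ tB; first by move: Dr; rewrite cD ltnS => /ltnW.
have [i iH] : exists i, i \in supp H.
  by have [x [y /on_supp1]] := on_any one_neqN1 H; exists x.1.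
have stE := stab_L2 tD HD iH; have iD := in_supB HD iH.
have orbE : orbit idx_action (L2 D) i = supB D.
  apply/setP=> j; apply/orbitP/idP => [[w /L2P[E1 E2] <-]|jD].
    by apply: contraT => /= yN; have /perm_inj E := E2 _ yN; rewrite E iD in yN.
  have [q qQ qj] := Q2_trans tD HD iH jD; exists q^-1%g.
    by rewrite groupV (subsetP (KB_L2 tD)).
  by rewrite /= -qj -wpermM mulgV wperm1.
split; last first.
  have := card_orbit_stab idx_action [group of L2 D] i; rewrite /= orbE stE IH2 => <-.
  rewrite card_supB2 // cD /= factS expnS.
  have := type2_even tB.
  move: (#|cut D H|) => m; rewrite -{2}(odd_double_half m) => /negPf->; rewrite add0n -mul2n.
  lia.
apply/eqP; rewrite eqEsubset Q2_L2 // andbT; apply/subsetP=> w wL.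
have jD : wperm w^-1%g i \in supB D.
  by rewrite -orbE; apply/orbitP; exists w^-1%g; rewrite ?groupV.
have [q qQ qj] := Q2_trans tD HD iH jD.
have qw : (q^-1 * w)%g \in Q2 D.
  have : (q^-1 * w)%g \in 'C_(L2 D)[i | idx_action]%g.
    apply/setIP; split; last apply/astab1P.
      by apply: groupM wL; rewrite groupV (subsetP (KB_L2 tD)).
    have E : wperm q^-1%g i = wperm w^-1%g i.
      by rewrite -[X in wperm q^-1%g X = _]qj -wpermM mulgV wperm1.
    by rewrite /= wpermM E -wpermM mulVg wperm1.
  rewrite stE IH1; apply/subsetP; rewrite gen_subG subUset; apply/andP; split.
    apply: subset_trans (KB_Q2 D); apply: KB_mono; rewrite ?type2_closed //.
    by apply: subset_trans (subsetDl _ _) (subsetDl _ _).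
  exact: subset_trans (subsetUr _ _) (subset_gen _).
by rewrite -[w](mulKVg q) groupM // (subsetP (KB_Q2 D)).
Qed.

(** One pair in D already puts every sign change of two indices into K_D, so K_D absorbs the sign
    group occurring in [Q2]. *)
Lemma KB_L2_eq D : type2 D -> D != set0 -> KB D = L2 D.
Proof.
move=> tD /set0Pn[H HD]; apply/eqP; rewrite eqEsubset KB_L2 //=.
have [-> _] := L2_Q2 tD; rewrite gen_subG subUset subxx /=.
by apply: sign_group_sub => g; apply: zH_KB2 HD.
Qed.

(* H joins x to y and also neg x to neg y; [origin H] chooses one of these two
   edges. *)
Definition origin H : sp := (sval (hyp_pts one_neqN1 H)).1.

Lemma on_origin H : on H (origin H) (pt (origin H) (rH H)).
Proof.
apply: supp_on; rewrite /origin; case: (hyp_pts one_neqN1 H) => -[x y] /= [xy HE].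
by apply: (on_supp1 (y := y)); apply/onP.
Qed.

Definition lifted H x : bool := (x == origin H) || (x == pt (origin H) (rH H)).

Lemma in_suppP H x : x.1 \in supp H -> [\/ x = origin H, x = pt (origin H) (rH H),
  x = neg (origin H) | x = neg (pt (origin H) (rH H))].
Proof.
rewrite (on_supp (on_origin H)) in_set2 => /orP[]/eqP/esym/same_pt[]->.
- exact: Or41.
- exact: Or43.
- exact: Or42.
exact: Or44.
Qed.

Lemma lifted_neg H x : x.1 \in supp H -> lifted H (neg x) = ~~ lifted H x.
Proof.
move=> /in_suppP; rewrite /lifted; have := on_ne (on_origin H).
move: (origin H) (pt _ _) => o o' oo'; have [e1 e2 e3 e4] := pair1_neq oo'.
have eN (u v : sp) : (neg u == v) = (u == neg v).
  by rewrite -[v in LHS]negK (inj_eq (can_inj (@negK n))).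
by case=> ->; rewrite ?negK ?eN ?[_ == neg _]eq_sym ?eN ?neg_neq ?e1 ?e2 ?e3 ?e4 ?eqxx ?orbT //;
  rewrite ![_ == neg _]eq_sym ?neg_neq ?eN ?e1 ?e2 ?e3 ?e4.
Qed.

Lemma lifted_rH H x : x.1 \in supp H -> lifted H (pt x (rH H)) = lifted H x.
Proof.
have rK y : pt (pt y (rH H)) (rH H) = y by rewrite -ptM rHK pt1.
by rewrite /lifted -{1}[origin H]rK !(inj_eq (@pt_inj _ _ one_neqN1 _)) orbC.
Qed.

(* Whether w sends the chosen edge of H to the edge that is not chosen; the total
   parity over D is the homomorphism on L1 D with kernel KB D. *)
Definition twist w H : bool := ~~ lifted (hact w^-1%g H) (pt (origin H) w).

Lemma in_supp_act w H x : x.1 \in supp H -> (pt x w).1 \in supp (hact w^-1%g H).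
Proof. by rewrite supp_act -[((pt x w).1, _).1]/((pt x w).1) !pt_wperm /= -wpermM mulgV wperm1. Qed.

(** [twist] looks at [origin H] only. Since negation flips [lifted] and the reflection preserves it,
    both before and after [w], the formula extends to all four points over [H]. *)
Lemma lifted_act w H x : x.1 \in supp H ->
  lifted (hact w^-1%g H) (pt x w) = lifted H x (+) twist w H.
Proof.
move=> xH; have oH := on_supp1 (on_origin H).
have lo : lifted H (origin H) by rewrite /lifted eqxx.
have oE : lifted (hact w^-1%g H) (pt (origin H) w) = lifted H (origin H) (+) twist w H.
  by rewrite lo /twist /= negbK.
have roE : pt (pt (origin H) (rH H)) w = pt (pt (origin H) w) (rH (hact w^-1%g H)).
  by rewrite -!ptM rHJ invgK !mulgA mulgV mul1g.
case: (in_suppP xH) => ->.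
- exact: oE.
- by rewrite roE lifted_rH ?in_supp_act // lifted_rH.
- by rewrite pt_neg !lifted_neg ?in_supp_act // oE addNb.
have o'H : (pt (origin H) (rH H)).1 \in supp H.
  by have := on_origin H; rewrite on_sym => /on_supp1.
by rewrite pt_neg !lifted_neg ?in_supp_act // roE lifted_rH ?in_supp_act // lifted_rH // oE addNb.
Qed.

(** The cocycle rule: summed over a collection stable under [w], it becomes the additivity of
    [sgnD]. *)
Lemma twistM w k H : twist (w * k)%g H = twist w H (+) twist k (hact w^-1%g H).
Proof.
have oH := on_supp1 (on_origin H); have owH := in_supp_act w oH.
by rewrite /twist ptM invMg hactM (lifted_act k owH) -addNb.
Qed.

Lemma twist_fix w H : (forall x, x.1 \in supp H -> pt x w = x) -> twist w H = false.
Proof.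
move=> E; have wH : hact w H = H by apply: hact_fix E.
have wVH : hact w^-1%g H = H by apply/eqP; rewrite hact_eq wH.
by rewrite /twist wVH E ?(on_supp1 (on_origin H)) // /lifted eqxx.
Qed.

Definition sgnD D w : bool := \big[addb/false]_(H in D) twist w H.

Lemma sgnDM D w k : cact w D = D -> sgnD D (w * k)%g = sgnD D w (+) sgnD D k.
Proof.
move=> wD; rewrite /sgnD; under eq_bigr do rewrite twistM; rewrite big_split /=.
congr (_ (+) _); rewrite [RHS](reindex_inj (@hact_inj _ _ w^-1%g)) /=.
by apply: eq_bigl => H; rewrite -in_cact wD.
Qed.

Lemma th_comm H1 H2 H0 : ip H1 H0 -> ip H2 H0 -> ip H1 H2 = false ->
  ip (hact (rH H1) H0) (hact (rH H2) H0) = false.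
Proof.
move=> i1 i2 i12; rewrite ip_ip1 // ip_sym ip_ip1 // [ip H0 (hact _ _)]ip_sym ip_ip1 //.
by rewrite ipp [ip H2 H1]ip_sym i12 [ip H0 _]ip_sym i1 i2.
Qed.

Lemma KB_sgn D w : type1 D -> w \in KB D -> sgnD D w = false.
Proof.
move=> tD; have clD := type1_closed tD; have /type1P[fr dj] := tD.
have KBs := subsetP (KB_sub_stab fr).
have stabE v : v \in KB D -> cact v D = D by move=> /KBs; rewrite inE => /eqP.
have out H H' : H \in D -> H' \in D -> H' != H -> forall x, x.1 \in supp H' -> x.1 \notin supp H.
  by move=> HD H'D HH' x xH; rewrite (disjointFr (dj _ _ H'D HD HH')).
move: w; apply: (KB_ind clD) => [|v w vD _ Ev Ew|H HD|H1 H2 H0 H1D H2D i1 i2 H12].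
- by rewrite /sgnD big1 // => H _; apply: twist_fix => x _; rewrite pt1.
- by rewrite sgnDM ?stabE // Ev Ew.
- rewrite /sgnD big1 // => H' H'D; have [->|H'H] := eqVneq H' H; last first.
    by apply: twist_fix => x xH'; rewrite pt_notin // (out H H').
  have oH := on_supp1 (on_origin H).
  rewrite /twist rHV ip0_act ?ipp // lifted_rH //.
  by rewrite /lifted eqxx.
set g := (_ * _)%g; have /ipfreeP frD := fr; have i12 := frD _ _ H1D H2D.
have gg : (g * g)%g = 1%g.
  have c : (th H2 H0 * th H1 H0)%g = (th H1 H0 * th H2 H0)%g.
    by apply: rHM; apply: th_comm; rewrite // ip_sym.
  by rewrite /g {2}c mulgA -[X in (X * _)%g]mulgA rHK mulg1 rHK.
have gV : (g^-1)%g = g by apply/eqP; rewrite eq_invg_mul gg.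
have g1 : hact g H1 = H2 by rewrite /g hactM th_act // th_actV.
rewrite /sgnD (bigD1 H1) //= (bigD1 H2) ?H2D 1?eq_sym //= big1 ?addbF.
  (* By the cocycle rule the twists at [H1] and [H2] add up to the twist of g^2 = 1 at [H1]. *)
  have := twistM g g H1; rewrite gg gV g1 => <-.
  by apply: twist_fix => x _; rewrite pt1.
move=> H /andP[/andP[HD HH1] HH2]; apply: twist_fix => x xH.
have n1 := out _ _ H1D HD HH1 _ xH; have n2 := out _ _ H2D HD HH2 _ xH.
by have [E1 E2] := th_pair_fix (dj _ _ H1D H2D H12) i1 i2 n1 n2; rewrite ptM E2 E1.
Qed.

Lemma zH_sgn D H : type1 D -> H \in D -> sgnD D (zH H) = true.
Proof.
move=> /type1P[fr dj] HD; rewrite /sgnD (bigD1 H) //= big1 => [|H' /andP[H'D H'H]].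
  have oH := on_supp1 (on_origin H).
  rewrite addbF /twist; have -> : hact (zH H)^-1%g H = H.
    by apply/eqP; rewrite hact_eq zH_act ipp.
  by rewrite pt_zH oH lifted_neg // /lifted eqxx.
apply: twist_fix => x xH'; rewrite pt_zH ifN //.
by rewrite (disjointFr (dj _ _ H'D HD H'H)).
Qed.

(** For [g] linking [H] and [H'], the images [g1] and [g2] of [g] have supports with the same sum as
    those of [H] and [H']. The product therefore equals [zH g1 * zH g2], which regroups into two
    quotients of reflections in K_D, one for [g] and one for [bar g]. *)
Lemma zHM_KB D H H' : type1 D -> H \in D -> H' \in D -> H != H' -> (zH H * zH H')%g \in KB D.
Proof.
move=> tD HD H'D HH'; have clD := type1_closed tD; have /type1P[fr dj] := tD.
have [g [i1 i2]] := link (dj _ _ HD H'D HH'); have /ipfreeP frD := fr.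
have ig := th_comm i1 i2 (frD _ _ HD H'D).
pose g1 := hact (rH H) g; pose g2 := hact (rH H') g.
have k1 : (rH g1 * rH g2)%g \in KB D by have := KB_th clD H'D HD i2 i1; rewrite thV.
have bE K : ip K g -> th K (bar g) = rH (bar (hact (rH K) g)).
  by move=> _; rewrite /th bar_act.
have i1b : ip H (bar g) by rewrite ip_bar.
have i2b : ip H' (bar g) by rewrite ip_bar.
have k2 : (rH (bar g1) * rH (bar g2))%g \in KB D.
  by have := KB_th clD H'D HD i2b i1b; rewrite thV !bE.
have -> : (zH H * zH H')%g = (zH g1 * zH g2)%g.
  apply: pt_eq one_neqN1 _ _ _ => x; rewrite [LHS]ptM [RHS]ptM !pt_zH.
  have E1 := supp_ip1 x.1 i1; have E2 := supp_ip1 x.1 i2; rewrite -/g1 -/g2 in E1 E2.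
  have sN (b : bool) : (if b then neg x else x).1 = x.1 by case: b.
  rewrite !sN E1 E2; case: (x.1 \in supp H); case: (x.1 \in supp H');
  by case: (x.1 \in supp g); rewrite //= ?negK.
have igb : ip (bar g1) g2 = false by rewrite ip_barl.
rewrite /zH -mulgA [(rH (bar g1) * _)%g]mulgA (rHM igb) -mulgA mulgA.
exact: groupM k1 k2.
Qed.

(** All the sign changes [zH] of members agree modulo K_D by [zHM_KB], so [L1 D] is the product of
    K_D with one group of order 2; the character [sgnD] shows that the two meet trivially. *)
Lemma card_L1_KB D : type1 D -> D != set0 -> #|L1 D| = (2 * #|KB D|)%N.
Proof.
move=> tD /set0Pn[H HD]; have clD := type1_closed tD; have /andP[fr _] := clD.
pose KG := [group of <<KB_gens D>>%g]; pose z := zH H.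
have zz : (z * z)%g = 1%g.
  apply: pt_eq one_neqN1 _ _ _ => x; rewrite ptM !pt_zH pt1.
  by case xH: (x.1 \in supp H); rewrite /= ?xH ?negK.
have zN : z \notin KG by apply/negP=> /(KB_sgn tD); rewrite zH_sgn.
have z1 : z != 1%g by apply: contraNneq zN => ->; apply: group1.
have oz : #[z]%g = 2%N.
  exact: (@nt_prime_order _ 2 z isT zz z1).
have nz : <[z]>%g \subset 'N(KG).
  rewrite cycle_subG; apply/normP; apply/eqP; rewrite eqEcard cardJg leqnn andbT.
  apply/subsetP=> _ /imsetP[k kD ->]; rewrite conjgE mulgA.
  have -> : (z^-1)%g = z by apply/eqP; rewrite eq_invg_mul zz.
  have := KB_conj one_neqN1 z kD; rewrite zH_stab //.
  by have -> : (z^-1)%g = z by apply/eqP; rewrite eq_invg_mul zz.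
have zE : <[z]>%g = [set 1%g; z].
  exact: cycle2g oz.
have TI : (KG :&: <[z]> = 1)%g.
  apply/trivgP/subsetP=> u /setIP[uK uz]; have : u \in [set 1%g; z] by rewrite -zE.
  rewrite in_set2 in_set1 => /orP[->//|/eqP uE].
  by rewrite -uE uK in zN.
have -> : L1 D = (KG * <[z]>)%g.
  have [-> _] := L1_Q1 tD; rewrite -norm_joinEr //; apply/eqP; rewrite eqEsubset.
  apply/andP; split.
    rewrite gen_subG subUset joing_subl /=; apply/subsetP=> _ /imsetP[H' H'D ->].
    have zJ : z \in (KG <*> <[z]>)%g by apply: (subsetP (joing_subr _ _)); apply: cycle_id.
    have [->//|HH'] := eqVneq H' H.
    rewrite -[zH H']mulg1 -zz mulgA groupM //.
    by apply: (subsetP (joing_subl _ _)); apply: zHM_KB.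
  by rewrite join_subG KB_Q1 cycle_subG; apply: zH_Q1.
by rewrite TI_cardMg // -orderE oz mulnC.
Qed.

(** * Orders of W and of its group of sign changes *)

Hypothesis n_gt0 : (0 < n)%N.

(** Flipping the sign at one fixed index exchanges even and odd sign vectors, so the even ones are
    half of all. *)
Lemma card_even_signs :
  #|[set b : {ffun 'I_n -> bool} | \big[addb/false]_i b i == false]| = (2 ^ n.-1)%N.
Proof.
set E := [set b | _]; pose i0 := Ordinal n_gt0.
pose flip (b : {ffun 'I_n -> bool}) := [ffun i => (i == i0) (+) b i].
have flipK : involutive flip by move=> b; apply/ffunP=> i; rewrite !ffunE addKb.
have flipE b : (flip b \in E) = (b \notin E).
  rewrite !inE; have -> : \big[addb/false]_i flip b i = true (+) \big[addb/false]_i b i.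
    transitivity ((\big[addb/false]_i (i == i0)) (+) \big[addb/false]_i b i).
      by rewrite -big_split; apply: eq_bigr => i _; rewrite ffunE.
    by rewrite (bigD1 i0) //= big1 => [|i /negPf->//]; rewrite ?eqxx.
  by case: (\big[_/_]_i _).
have cE : #|~: E| = #|E|.
  rewrite -(card_imset _ (inv_inj flipK)); congr #|pred_of_set _|; apply/setP=> b.
  rewrite -[b in LHS]flipK mem_imset ?flipK; last exact: inv_inj.
  by rewrite inE flipE negbK.
have := cardsC E; rewrite cE addnn -mul2n card_ffun card_bool card_ord.
by move: #|E| => e; case: (n) n_gt0 => // m _; rewrite expnS => /eqP; rewrite eqn_mul2l => /eqP.
Qed.

Lemma card_G22 : #|[set: W]| = (n`! * 2 ^ n.-1)%N.
Proof.
pose f w := (wperm w, wsgn one_neqN1 w).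
have f_inj : injective f.
  move=> w w' [E1 E2]; apply: pt_eq one_neqN1 _ _ _ => x.
  by rewrite /(pt x w) /(pt x w') E1 E2.
rewrite -(card_imset _ f_inj).
have -> : f @: [set: W] =
    setX [set: 'S_n] [set b : {ffun 'I_n -> bool} | \big[addb/false]_i b i == false].
  apply/setP=> -[s b]; rewrite in_setX in_setT inE /=; apply/imsetP/eqP.
    by case=> w _ [_ ->]; apply: wsgn_even.
  move=> b0; have [w wE] := mkW_ex one_neqN1 s b0; exists w; first exact: in_setT.
  have sE i : wperm w i = s i by have := wE (i, false); case.
  have bE i : wsgn one_neqN1 w i = b i by have := wE (i, false); case.
  by rewrite /f; congr pair; [apply/permP=> i|apply/ffunP=> i]; rewrite ?sE ?bE.
by rewrite cardsX cardsT card_Sn card_even_signs.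
Qed.

Lemma card_L20 : #|L2 (set0 : {set hyper})| = (2 ^ n.-1)%N.
Proof.
pose f w := wsgn one_neqN1 w.
have f_inj : {in L2 (set0 : {set hyper}) &, injective f}.
  move=> w w' /L2_0 E1 /L2_0 E1' E2; apply: pt_eq one_neqN1 _ _ _ => x.
  by rewrite /(pt x w) /(pt x w') E1 E1' -/(f w) E2.
rewrite -(card_in_imset f_inj) -card_even_signs; congr #|pred_of_set _|.
apply/setP=> b; rewrite inE; apply/imsetP/eqP => [[w _ ->]|b0]; first exact: wsgn_even.
have [w wE] := mkW_ex one_neqN1 1%g b0; exists w.
  by apply: L2_0I => i; have := wE (i, false); rewrite perm1; case.
by apply/ffunP=> i; have := wE (i, false); case.
Qed.
End PairedOrders.

(** * Counting closed collections *)

Section Counting.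
Variables (C : fieldType) (n : nat).
Hypothesis one_neqN1 : (1 : C) != -1.
Local Notation W := (G22 C n).
Local Notation rep := (G22_rep C n).
Local Notation hyper := (hyper rep).
Local Notation sp := ('I_n * bool)%type.
Local Notation pt := (pt one_neqN1).
Local Notation rH := (rH one_neqN1).
Local Notation supp := (supp one_neqN1).
Local Notation bar := (bar one_neqN1).
Local Notation on := (on one_neqN1).
Local Notation closed_coll := (closed_coll one_neqN1).
Local Notation has_bar := (has_bar one_neqN1).
Local Notation supB := (supB one_neqN1).
Local Notation type1 := (type1 one_neqN1).
Local Notation type2 := (type2 one_neqN1).
Local Notation cut := (cut one_neqN1).
Implicit Types (w k : W) (H : hyper) (B D : {set hyper}) (x y : sp) (T : {set 'I_n}).

(** Such a hyperplane is given by the point it joins to [(i, false)]: any other index of T, with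
    either sign. *)
Lemma card_hyper_at T (i : 'I_n) : i \in T ->
  #|[set H | (i \in supp H) && (supp H \subset T)]| = (#|T|.-1 * 2)%N.
Proof.
move=> iT; pose f H := pt (i, false) (rH H).
have onf H : i \in supp H -> on H (i, false) (f H) by apply: (@supp_on _ _ _ H (i, false)).
rewrite -(card_in_imset (f := f)) => [|H H']; last first.
  rewrite 2!in_set => /andP[iH _] /andP[iH' _] E.
  by apply: (@on_inj _ _ one_neqN1 _ _ _ _ (onf _ iH)); rewrite E; apply: onf.
have -> : #|T|.-1 = #|T :\ i| by rewrite (cardsD1 i T) iT.
rewrite -card_bool -[#|{: bool}|]cardsT -cardsX; congr #|pred_of_set _|.
apply/setP=> -[j b]; rewrite in_setX in_setT andbT in_setD1; set y := (j, b).
apply/imsetP/andP.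
  case=> H; rewrite in_set => /andP[iH /subsetP HT] E; have Hf := onf _ iH.
  rewrite -E in Hf; split; first by have := on_ne Hf; rewrite eq_sym.
  by apply: HT; rewrite (on_supp Hf) in_set2 eqxx orbT.
case=> yi yT; have iy : (i, false).1 != y.1 by rewrite eq_sym.
have [H Hiy] := on_ex one_neqN1 iy; have iH := on_supp1 Hiy; exists H.
  rewrite inE iH (on_supp Hiy); apply/subsetP=> l; rewrite in_set2.
  by case/orP=> /eqP->.
by apply: (on_fun Hiy); apply: onf.
Qed.

(** Double counting of incidences between hyperplanes and indices; the factor 2 for the two signs
    cancels the two indices of a support. *)
Lemma card_hyper_sub T : #|[set H | supp H \subset T]| = (#|T| * #|T|.-1)%N.
Proof.
have : \sum_(H | supp H \subset T) \sum_(i in T | i \in supp H) 1%N =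
       \sum_(i in T) \sum_(H | (supp H \subset T) && (i \in supp H)) 1%N.
  rewrite (exchange_big_dep (mem T)) /= => [|H i _ /andP[] //].
  by apply: eq_bigr => i iT; apply: eq_bigl => H; rewrite iT.
rewrite (eq_bigr (fun=> 2%N)) => [|H /subsetP HT]; last first.
  rewrite sum1_card -(card_supp one_neqN1 H); apply: eq_card => i.
  by rewrite -[X in X = _]/((i \in T) && (i \in supp H)) andb_idl // => /HT.
rewrite sum_nat_const (eq_bigr (fun=> (#|T|.-1 * 2)%N)) => [|i iT]; last first.
  rewrite sum1_card -(card_hyper_at iT); apply: eq_card => H.
  by rewrite in_set andbC.
rewrite sum_nat_const mulnA => /eqP; rewrite eqn_mul2r => /eqP <-.
by apply: eq_card => H; rewrite inE.
Qed.

Lemma card_hyper_disj B : #|[set H | [disjoint supp H & supB B]]| =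
  ((n - #|supB B|) * (n - #|supB B|).-1)%N.
Proof.
have -> : (n - #|supB B|)%N = #|~: supB B| by have := cardsC (supB B); rewrite card_ord; lia.
rewrite -card_hyper_sub; apply: eq_card => H; rewrite !inE.
by rewrite disjoints_subset.
Qed.

Lemma disj_supBP H B : reflect (forall H', H' \in B -> [disjoint supp H & supp H'])
  [disjoint supp H & supB B].
Proof.
exact: bigcup_disjointP.
Qed.

Lemma type1_add H B : H \notin B -> type1 (H |: B) = type1 B && [disjoint supp H & supB B].
Proof.
move=> HB; apply/idP/andP => [tD|[/type1P[/ipfreeP fr dj] /disj_supBP djH]].
  split; first by apply: type1_sub tD; apply: subsetUr.
  apply/disj_supBP=> H' H'B; have /type1P[_ dj] := tD.
  apply: dj; rewrite ?setU11 ?setU1r //.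
  by apply: contraNneq HB => ->.
apply/type1P; split.
  rewrite ipfree_add; apply/andP; split; last exact/ipfreeP.
  by apply/compatP=> H' H'B; apply: ip_disj; apply: djH.
move=> H1 H2 /setU1P[->|H1B] /setU1P[->|H2B] H12; first by rewrite eqxx in H12.
- exact: djH.
- by rewrite disjoint_sym; apply: djH.
exact: dj.
Qed.

Definition N1 r := #|[set B : {set hyper} | type1 B && (#|B| == r)]|.
Definition N2 r := #|[set B : {set hyper} | type2 B && (#|B| == r.*2)]|.

Lemma sum_flags (P : pred {set hyper}) r (q : nat) :
    (forall B, P B -> #|B| == r -> #|supB B| = q) ->
  \sum_(B | P B && (#|B| == r)) \sum_(H | [disjoint supp H & supB B]) 1%N =
  (#|[set B | P B && (#|B| == r)]| * ((n - q) * (n - q).-1))%N.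
Proof.
move=> E; rewrite -sum1_card big_distrl /= big_mkcond [RHS]big_mkcond.
apply: eq_bigr => B _; rewrite inE; case: ifP => // /andP[PB Br].
by rewrite mul1n -(E B) // -card_hyper_disj sum1_card; apply: eq_card => H; rewrite inE.
Qed.

(** Flags H in D with |D| = r+1 are counted by D and by D without H. The latter covers 2r indices,
    which leaves the remaining ones for H. *)
Lemma N1_S r : (N1 r.+1 * r.+1 = N1 r * ((n - r.*2) * (n - r.*2).-1))%N.
Proof.
rewrite /N1 -sum_flags => [|B tB /eqP Br]; last by rewrite card_supB1 // Br mul2n.
have -> : (#|[set B : {set hyper} | type1 B && (#|B| == r.+1)]| * r.+1)%N =
    \sum_(B : {set hyper} | type1 B && (#|B| == r.+1)) \sum_(H in B) 1%N.
  rewrite -sum1_card big_distrl /= big_mkcond [RHS]big_mkcond.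
  apply: eq_bigr => B _; rewrite inE; case: ifP => // /andP[_ /eqP Br].
  by rewrite mul1n sum1_card Br.
rewrite !pair_big_dep /= (reindex_onto (fun p : {set hyper} * hyper => (p.2 |: p.1, p.2))
  (fun p : {set hyper} * hyper => (p.1 :\ p.2, p.2))) /= => [|[D H] /= /andP[_ HD]]; last first.
  by rewrite setD1K.
apply: eq_bigl => -[B H] /=; rewrite setU11 andbT xpair_eqE eqxx andbT.
have [HB|HB] := boolP (H \in B).
  have -> : ((H |: B) :\ H == B) = false.
    by apply/eqP=> E; move: HB; rewrite -E setD11.
  rewrite andbF; apply/esym/negP=> /andP[_ /disj_supBP/(_ _ HB)].
  by rewrite -setI_eq0 setIid => /eqP E; have := card_supp one_neqN1 H; rewrite E cards0.
rewrite setU1K // eqxx andbT type1_add // cardsU1 HB add1n eqSS.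
by rewrite andbAC.
Qed.

Lemma type2_add H B : H \notin B -> bar H \notin B ->
  type2 (H |: (bar H |: B)) = type2 B && [disjoint supp H & supB B].
Proof.
move=> HB bHB; have HbH : H \notin bar H |: B.
  by apply/setU1P=> -[E|]; [have := bar_neq one_neqN1 H; rewrite -E eqxx|apply/negP].
have cutE : cut (H |: (bar H |: B)) H = B by rewrite /(cut _ _) setU1K // setU1K.
apply/idP/andP => [tD|[/type2P[/ipfreeP fr barB] /disj_supBP djH]].
  split; first by rewrite -cutE; apply: cut_type2.
  have HD : H \in H |: (bar H |: B) by apply: setU11.
  apply/disj_supBP=> H' H'B; apply: (type2_supp tD HD); first by rewrite !setU1r.
    by apply: contraNneq HB => <-.
  by apply: contraNneq bHB => <-.
have barD H1 : H1 \in B -> bar H1 \in B by apply: barB.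
apply/type2P; split.
  rewrite !ipfree_add; apply/andP; split; last (apply/andP; split); last exact/ipfreeP.
    by apply/compatP=> H' /setU1P[->|H'B]; [rewrite ip_bar ipp|apply: ip_disj; apply: djH].
  by apply/compatP=> H' H'B; rewrite ip_barl; apply: ip_disj; apply: djH.
move=> H1 /setU1P[->|/setU1P[->|H1B]].
- by rewrite setU1r // setU11.
- by rewrite barK setU11.
by rewrite !setU1r // barD.
Qed.

(** A flag now marks one of the 2(r+1) hyperplanes of D, and removing it takes its bar away too. *)
Lemma N2_S r : (N2 r.+1 * r.+1.*2 = N2 r * ((n - r.*2) * (n - r.*2).-1))%N.
Proof.
rewrite /N2 -sum_flags => [|B tB /eqP Br]; last by rewrite card_supB2 // Br.
have -> : (#|[set B : {set hyper} | type2 B && (#|B| == r.+1.*2)]| * r.+1.*2)%N =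
    \sum_(B : {set hyper} | type2 B && (#|B| == r.+1.*2)) \sum_(H in B) 1%N.
  rewrite -sum1_card big_distrl /= big_mkcond [RHS]big_mkcond.
  apply: eq_bigr => B _; rewrite inE; case: ifP => // /andP[_ /eqP Br].
  by rewrite mul1n sum1_card Br.
rewrite !pair_big_dep /= (reindex_onto
  (fun p : {set hyper} * hyper => (p.2 |: (bar p.2 |: p.1), p.2))
  (fun p : {set hyper} * hyper => (cut p.1 p.2, p.2))) /= => [|[D H] /= /andP[/andP[tD _] HD]]; last first.
  have /type2P[_ barD] := tD.
  by rewrite /(cut _ _) !setD1K // in_setD1 bar_neq barD.
apply: eq_bigl => -[B H] /=; rewrite setU11 andbT xpair_eqE eqxx andbT.
have [/andP[HB bHB]|HB] := boolP ((H \notin B) && (bar H \notin B)).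
  have HbH : H \notin bar H |: B.
    by apply/setU1P=> -[E|]; [have := bar_neq one_neqN1 H; rewrite -E eqxx|apply/negP].
  have -> : cut (H |: (bar H |: B)) H = B by rewrite /(cut _ _) setU1K // setU1K.
  rewrite eqxx andbT type2_add // !cardsU1 HbH bHB !add1n doubleS !eqSS.
  by rewrite andbAC.
have -> : (cut (H |: (bar H |: B)) H == B) = false.
  apply/eqP=> E; move: HB; rewrite negb_and !negbK -E !in_cut.
  by case/orP=> /and3P[]; [move=> _ | idtac]; rewrite eqxx.
rewrite andbF; apply/esym/negP=> /andP[_ /disj_supBP dj].
suff : [disjoint supp H & supp H].
  by rewrite -setI_eq0 setIid => /eqP E; have := card_supp one_neqN1 H; rewrite E cards0.
move: HB; rewrite negb_and !negbK => /orP[/dj//|/dj].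
by rewrite supp_bar.
Qed.

Lemma type1_0 : type1 (set0 : {set hyper}).
Proof.
by apply/type1P; split=> [|H H']; [apply/ipfreeP=> H H'|]; rewrite inE.
Qed.

Lemma type2_0 : type2 (set0 : {set hyper}).
Proof.
by apply/type2P; split=> [|H]; [apply/ipfreeP=> H H'|]; rewrite inE.
Qed.

Lemma N1E r : (N1 r * r`!)%N = n ^_ r.*2.
Proof.
elim: r => [|r IHr].
  rewrite muln1 ffactn0 /N1 (_ : [set B | _] = [set set0]) ?cards1 //.
  apply/setP=> B; rewrite in_set1 inE cards_eq0; have [->|] := eqVneq B set0.
    by rewrite type1_0.
  by rewrite andbF.
rewrite factS mulnA N1_S mulnAC IHr doubleS !ffactnSr -mulnA; congr (_ * _)%N.
by rewrite subnS.
Qed.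

Lemma N2E r : (N2 r * (2 ^ r * r`!))%N = n ^_ r.*2.
Proof.
elim: r => [|r IHr].
  rewrite muln1 ffactn0 /N2 (_ : [set B | _] = [set set0]) ?cards1 //.
  apply/setP=> B; rewrite in_set1 inE cards_eq0; have [->|] := eqVneq B set0.
    by rewrite type2_0.
  by rewrite andbF.
have -> : (N2 r.+1 * (2 ^ r.+1 * r.+1`!) = (N2 r.+1 * r.+1.*2) * (2 ^ r * r`!))%N.
  by rewrite expnS factS -mul2n; lia.
rewrite N2_S mulnAC IHr doubleS !ffactnSr -mulnA; congr (_ * _)%N.
by rewrite subnS.
Qed.

Hypothesis n_gt0 : (0 < n)%N.

Lemma index_KB B : (#|[set: W] : KB B|%g * #|KB B| = n`! * 2 ^ n.-1)%N.
Proof.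
rewrite -(card_G22 one_neqN1 n_gt0) mulnC.
exact: (Lagrange (subsetT [group of <<KB_gens B>>%g])).
Qed.

Lemma sum_rank (P : pred {set hyper}) (k : {set hyper} -> nat) (F : {set hyper} -> nat) :
    (forall B, P B -> (k B <= n)%N) ->
  \sum_(B | P B) F B = \sum_(0 <= r < n.+1) \sum_(B | P B && (k B == r)) F B.
Proof.
move=> kn; rewrite (partition_big (fun B => inord (k B) : 'I_n.+1) xpredT) //=.
rewrite big_mkord; apply: eq_bigr => r _; apply: eq_bigl => B.
case PB: (P B) => //=; rewrite -(inj_eq val_inj) /= inordK // ltnS.
exact: kn.
Qed.

(** The number of ways to choose r disjoint unordered pairs among n indices. *)
Definition Mr r := (n`! %/ (r`! * 2 ^ r * (n - 2 * r)`!))%N.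

Lemma N2_Mr r : (2 * r <= n)%N ->
  (n`! = N2 r * (2 ^ r * r`!) * (n - 2 * r)`!)%N /\ N2 r = Mr r.
Proof.
move=> rn; have E : (n`! = N2 r * (2 ^ r * r`!) * (n - 2 * r)`!)%N.
  by rewrite N2E -mul2n ffact_fact.
split=> //; rewrite /Mr [in RHS]E [(2 ^ r * _)%N]mulnC -mulnA mulnK //.
by rewrite !muln_gt0 !fact_gt0 expn_gt0.
Qed.

(** Each of r disjoint pairs of indices carries one of two hyperplanes, which gives 2^r [Mr r]
    collections, and each has index 2^(n-r) [Mr r] (n-2r)!. *)
Lemma sum_type1 r : (0 < r)%N ->
  \sum_(B : {set hyper} | type1 B && (#|B| == r)) #|[set: W] : KB B|%g =
  if (2 * r <= n)%N then (2 ^ n * (Mr r ^ 2 * (n - 2 * r)`!))%N else 0%N.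
Proof.
move=> r0; case: ifP => rn; last first.
  rewrite big1 // => B /andP[tB /eqP Br]; have := max_card (supB B).
  by rewrite card_supB1 // Br card_ord rn.
have [nE ME] := N2_Mr rn; rewrite -ME.
have N12 : (N1 r = N2 r * 2 ^ r)%N.
  by apply/eqP; rewrite -(eqn_pmul2r (fact_gt0 r)) N1E -N2E mulnA.
have idx B : type1 B && (#|B| == r) ->
    (#|[set: W] : KB B|%g * 2 ^ r = N2 r * (n - 2 * r)`! * 2 ^ n)%N.
  case/andP=> tB /eqP Br; have B0 : B != set0 by rewrite -card_gt0 Br.
  have E := index_KB B; have E1 := card_L1_KB tB B0; have [_ E2] := L1_Q1 tB.
  rewrite Br in E2; rewrite E2 in E1.
  have n2 : (2 ^ n = 2 * 2 ^ n.-1)%N by rewrite -expnS prednK.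
  have p0 : (0 < 2 ^ r * r`!)%N by rewrite muln_gt0 expn_gt0 fact_gt0.
  apply/eqP; rewrite -(eqn_pmul2r p0); apply/eqP.
  have -> : (#|[set: W] : KB B|%g * 2 ^ r * (2 ^ r * r`!) = #|[set: W] : KB B|%g * (4 ^ r * r`!))%N.
    by rewrite -[4%N]/(2 * 2)%N expnMn; lia.
  rewrite E1 mulnCA E nE n2; lia.
have -> : (2 ^ n * (N2 r ^ 2 * (n - 2 * r)`!) = N2 r * (N2 r * (n - 2 * r)`! * 2 ^ n))%N.
  by rewrite -mulnn; lia.
apply/eqP; rewrite -(eqn_pmul2r (expn_gt0 2 r : (0 < 2 ^ r)%N)) big_distrl /=; apply/eqP.
rewrite (eq_bigr (fun=> (N2 r * (n - 2 * r)`! * 2 ^ n)%N)) // sum_nat_const.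
rewrite -[#|_|]/(#|[pred B : {set hyper} | type1 B && (#|B| == r)]|).
have -> : #|[pred B : {set hyper} | type1 B && (#|B| == r)]| = N1 r.
  by apply: eq_card => B; rewrite !inE.
rewrite N12; lia.
Qed.

Lemma sum_type2 r : (0 < r)%N ->
  \sum_(B : {set hyper} | [&& type2 B, B != set0 & #|B|./2 == r]) #|[set: W] : KB B|%g =
  if (2 * r <= n)%N then (Mr r ^ 2 * (n - 2 * r)`!)%N else 0%N.
Proof.
move=> r0; have cB B : [&& type2 B, B != set0 & #|B|./2 == r] = type2 B && (#|B| == r.*2).
  case tB: (type2 B) => //=; have e := negPf (type2_even tB).
  have -> : (#|B|./2 == r) = (#|B| == r.*2).
    by rewrite -{2}(odd_double_half #|B|) e add0n (inj_eq double_inj).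
  case: (#|B| =P r.*2) => [Br|_]; last by rewrite andbF.
  by rewrite andbT -card_gt0 Br double_gt0.
rewrite (eq_bigl _ _ cB); case: ifP => rn; last first.
  rewrite big1 // => B /andP[tB /eqP Br]; have := max_card (supB B).
  by rewrite card_supB2 // Br card_ord -mul2n rn.
have [nE ME] := N2_Mr rn; rewrite -ME.
have idx B : type2 B && (#|B| == r.*2) -> #|[set: W] : KB B|%g = (N2 r * (n - 2 * r)`!)%N.
  case/andP=> tB /eqP Br; have B0 : B != set0 by rewrite -card_gt0 Br double_gt0.
  have E := index_KB B; have E1 := KB_L2_eq tB B0; have [_ E2] := L2_Q2 tB.
  rewrite Br doubleK (card_L20 one_neqN1 n_gt0) -E1 in E2.
  have p0 : (0 < 2 ^ n.-1 * (2 ^ r * r`!))%N by rewrite !muln_gt0 !expn_gt0 fact_gt0.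
  apply/eqP; rewrite -(eqn_pmul2r p0) -{1}E2 E nE; apply/eqP; lia.
rewrite (eq_bigr _ idx) sum_nat_const.
have -> : #|[pred B : {set hyper} | type2 B && (#|B| == r.*2)]| = N2 r.
  by apply: eq_card => B; rewrite !inE.
rewrite -mulnn; lia.
Qed.

Lemma closed_types B : closed_coll B = type1 B || (type2 B && (B != set0)).
Proof.
apply/idP/orP => [/andP[fr bc]|[/type1_closed //|/andP[/type2_closed]]] //.
have [hb|nb] := boolP (has_bar B); last by left; rewrite /(type1 _) fr nb.
right; apply/andP; split; last first.
  by have /has_barP[H HB _] := hb; apply/set0Pn; exists H.
by apply/type2P; split=> // H; move/bar_closedP: bc; apply.
Qed.

Lemma type12 B : type1 B -> type2 B -> B = set0.
Proof.
move=> /andP[_ nb] /type2P[_ barB]; apply/eqP; apply: contraR nb => /set0Pn[H HB].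
by apply/has_barP; exists H => //; apply: barB.
Qed.

Lemma sum_index : \sum_(B : {set hyper} | closed_coll B) #|[set: W] : KB B|%g =
  (n`! * 2 ^ n.-1 + (2 ^ n + 1) * \sum_(1 <= r < n.+1 | 2 * r <= n)
     (n`! %/ (r`! * 2 ^ r * (n - 2 * r)`!)) ^ 2 * (n - 2 * r)`!)%N.
Proof.
rewrite (bigID type1) /= (eq_bigl type1) => [|B]; last first.
  by rewrite closed_types andb_orl andbb; case: (type1 B); rewrite ?andbF ?orbF.
rewrite [X in (_ + X)%N = _](eq_bigl (fun B => type2 B && (B != set0))) => [|B]; last first.
  rewrite closed_types; case t1: (type1 B) => /=; last by rewrite andbT.
  by apply/esym/negP=> /andP[/(type12 t1)->]; rewrite eqxx.
rewrite (@sum_rank type1 (fun B => #|B|)) => [|B tB]; last first.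
  by have := max_card (supB B); rewrite card_supB1 // card_ord; lia.
rewrite (@sum_rank _ (fun B => #|B|./2)) => [|B /andP[tB _]]; last first.
  by have := max_card (supB B); rewrite card_supB2 // card_ord; lia.
rewrite big_ltn // [X in (_ + X)%N]big_ltn //.
rewrite (big_pred1 set0) => [|B]; last first.
  by rewrite cards_eq0 andb_idl // => /eqP->; apply: type1_0.
have -> : #|[set: W] : KB (set0 : {set hyper})|%g = (n`! * 2 ^ n.-1)%N.
  by rewrite -(index_KB set0); rewrite [X in (_ * #|pred_of_set X|)%N]KB0 ?cards1 ?muln1.
(* Rank 0 contributes nothing to the paired sum, as the empty collection has been counted once
   already, with index |W|. *)
rewrite [X in (_ + (X + _))%N]big1 => [|B /andP[/andP[tB B0] /eqP]]; last first.
  move=> h0; have := odd_double_half #|B|; rewrite h0 (negPf (type2_even tB)) => /esym/eqP.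
  by rewrite cards_eq0 (negPf B0).
rewrite add0n -addnA; congr (_ + _)%N.
rewrite mulnDl mul1n big_distrr /=; congr (_ + _)%N.
  rewrite [RHS]big_mkcond /= !big_nat; apply: eq_bigr => r /andP[r1 _].
  by rewrite sum_type1.
rewrite [RHS]big_mkcond /= !big_nat; apply: eq_bigr => r /andP[r1 _].
by rewrite -sum_type2 //; apply: eq_bigl => B; rewrite andbA.
Qed.
End Counting.

Local Open Scope complex_scope.

Theorem proposition6p15 (R : realType) (n : nat) (n_gt0 : (0 < n)%N)
    (K : fieldType) (a : brscalars (G22_rep R[i] n) K) (aP : proper_field a) :
  (forall B : {set hyper (G22_rep R[i] n)}, B != set0 -> transverse_coll B ->
     (admissible a B <->
        forall (i j i' j' : 'I_n) (k : int), i != j -> i' != j' ->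
          Hij_in i j 0 B -> Hij_in i j 1 B -> Hij_in i' j' k B ->
          Hij_in i' j' (k + 1) B) /\
     (admissible a B -> forall x, annKStab a B x <-> augKB B x)) /\
  has_dim (Br a)
    (n`! * 2 ^ n.-1 +
     (2 ^ n + 1) * \sum_(1 <= r < n.+1 | 2 * r <= n)
        (n`! %/ (r`! * 2 ^ r * (n - 2 * r)`!)) ^ 2 * (n - 2 * r)`!)%N.
Proof.
have ne : (1 : R[i]) != -1.
  by rewrite -subr_eq0 opprK -mulr2n Num.Theory.pnatr_eq0.
split=> [B _ /(transverse_collP ne) fr|]; last first.
  by rewrite -(sum_index ne n_gt0) -(card_bidx n ne); apply: Br_dim.
have adm : admissible a B <-> bar_closed ne B.
  split; first exact: admissible_closed.
  by move=> bc; apply: closed_admissible; rewrite /closed_coll fr.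
split; first by rewrite adm; apply: bar_closed_cond.
move=> /adm bc x; have clB : closed_coll ne B by rewrite /closed_coll fr.
by split; [apply: ann_augKB clB|apply: augKB_ann fr].
Qed.
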